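(* Let $\omega=(\omega_1,\omega_2)\in\mathbb{R}^2$, $M_1=M_2=\mathbb{T}\times\mathbb{R}$, and let $T_0:M_1\times M_2\to M_1\times M_2$ be $T_0\big((\theta_1,r_1),(\theta_2,r_2)\big)=\big((\theta_1+\omega_1+r_1+\mathbb{Z},r_1),(\theta_2+\omega_2+r_2+\mathbb{Z},r_2)\big)$. Let $\alpha>1$ and $L>0$ be real, and put $\gamma=\frac1{\alpha-1}$. There is a constant $C>0$ such that for any $\epsilon>0$ there exist $u\in G^{\alpha,L}(M_1)$ and $v\in G^{\alpha,L}(M_1\times M_2)$ such that (1) $u$ and $v$ are flat for $r_1=0$; (2) $\|u\|_{\alpha,L}+\|v\|_{\alpha,L}<\epsilon$; (3) the torus $\mathcal{T}_0=\{r_1=r_2=0\}\subset M_1\times M_2$ is invariant and diffusive for $T=\Phi^v\circ\Phi^u\circ T_0$, diffusiveness being understood with respect to the function $E=E_{C,\gamma}$.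
   Context: $\mathbb{T}=\mathbb{R}/\mathbb{Z}$, $\mathbb{N}=\{0,1,2,\dots\}$. $M_1\times M_2\simeq\mathbb{T}^2\times\mathbb{R}^2$ carries the symplectic form $d\theta_1\wedge dr_1+d\theta_2\wedge dr_2$ and the standard flat product metric. For a function $H$ generating a complete Hamiltonian vector field ($\dot\theta=\partial_rH$, $\dot r=-\partial_\theta H$), $\Phi^H$ denotes the time-$1$ map of its flow. A function $u$ on $M_1$ is viewed as a function on $M_1\times M_2$ independent of $(\theta_2,r_2)$, so $\Phi^u$ acts on $M_1\times M_2$. A function is flat on a set if it vanishes there together with all its partial derivatives of all orders. For a product $D$ of tori and a Euclidean space, with $N$ variables, $G^{\alpha,L}(D)$ is the set of $f\in C^\infty(D)$ with $\|f\|_{\alpha,L}:=\sum_{\ell\in\mathbb{N}^N}\frac{L^{|\ell|\alpha}}{\ell!^\alpha}\|\partial^\ell f\|_{C^0(D)}<\infty$, where $|\ell|=\ell_1+\cdots+\ell_N$, $\ell!=\ell_1!\cdots\ell_N!$. $E_{C,\gamma}(\nu)=\exp(\exp(C\nu^{-\gamma}))$ for $\nu>0$. For a map $T$ on a metric space $(M,d)$ and $\nu>0$, a point $z\in M$ is $\nu$-diffusive if there exist $\hat z\in M$ and a positive integer $t$ such that $d(\hat z,z)\le\nu$, $t\le E(\nu)$ and $d(T^t\hat z,z)\ge E(2\nu)$. A subset $X\subset M$ is $\nu$-diffusive if all its points are $\nu$-diffusive, and diffusive if there is a sequence of positive numbers $\nu_k\to0$ such that $X$ is $\nu_k$-diffusive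 for each $k$. *)

(* Defs.v *)
From HB Require Import structures.
From mathcomp Require Import all_boot all_order all_algebra.
From mathcomp Require Import generic_quotient ring_quotient.
From mathcomp Require Import all_classical all_reals all_analysis.
Import Order.TTheory GRing.Theory Num.Theory.
Import numFieldNormedType.Exports.

Set Implicit Arguments.
Unset Strict Implicit.
Unset Printing Implicit Defensive.

Local Open Scope classical_set_scope.
Local Open Scope ring_scope.

Definition int_subgroup (R : realType) : zmodClosed R :=
  GRing.ZmodClosed.clone R Num.int_num_subdef _.

(* The additive group R / Z. *)
Definition circle (R : realType) := Quotient.quot (int_subgroup R).

Definition to_circle (R : realType) (x : R) : circle R :=
  \pi_(circle R)%qT x.

Lemma to_circleP (R : realType) (x y : R) :
  to_circle x = to_circle y <-> x - y \is a Num.int.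
Proof.
by rewrite /to_circle; split=> [/eqP|h]; [|apply/eqP];
  rewrite -[(_ == _)](Quotient.idealrBE (int_subgroup R)).
Qed.

Lemma to_circleD (R : realType) (x y : R) :
  to_circle (x + y) = to_circle x + to_circle y.
Proof. exact: (raddfD \pi_(Quotient.quot (int_subgroup R))%qT x y). Qed.

Definition annulus (R : realType) : Type := (circle R * R)%type.

Definition phase_space (R : realType) : Type := (annulus R * annulus R)%type.

(* Universal coverings. The coordinates upstairs are (theta, r), respectively
   (theta_1, r_1, theta_2, r_2). *)
Definition annulus_cover (R : realType) (x : 'rV[R]_2) : annulus R :=
  (to_circle (x 0 0), x 0 1).

Definition phase_cover (R : realType) (x : 'rV[R]_4) : phase_space R :=
  ((to_circle (x 0 0), x 0 1), (to_circle (x 0 2), x 0 3)).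

Definition circle_dist (R : realType) (a b : circle R) : R :=
  inf [set d | exists x y : R,
         [/\ to_circle x = a, to_circle y = b & d = `|x - y|]].

Definition phase_dist (R : realType) (z w : phase_space R) : R :=
  Num.sqrt (circle_dist z.1.1 w.1.1 ^+ 2 + (z.1.2 - w.1.2) ^+ 2 +
            circle_dist z.2.1 w.2.1 ^+ 2 + (z.2.2 - w.2.2) ^+ 2).

(* Differential calculus on a quotient D of R^N by a group of translations is
   done upstairs, on the lift [f \o p] of [f : D -> R] by the covering
   [p : 'rV_N -> D]. *)

Definition partial (R : realType) (N : nat) (i : 'I_N) (g : 'rV[R]_N -> R) :
    'rV[R]_N -> R :=
  fun x => 'D_(delta_mx 0 i) g x.

Definition iter_partial (R : realType) (N : nat) (s : seq 'I_N)
    (g : 'rV[R]_N -> R) : 'rV[R]_N -> R :=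
  foldr (@partial R N) g s.

Definition smooth (R : realType) (N : nat) (g : 'rV[R]_N -> R) : Prop :=
  forall s : seq 'I_N,
    continuous (iter_partial s g) /\
    forall (i : 'I_N) (x : 'rV[R]_N),
      derivable (iter_partial s g) x (delta_mx 0 i).

Definition multi_index (N : nat) := {ffun 'I_N -> nat}.

Definition mi_size (N : nat) (l : multi_index N) : nat := (\sum_(i < N) l i)%N.

Definition mi_fact (N : nat) (l : multi_index N) : nat :=
  (\prod_(i < N) (l i)`!)%N.

Definition mpartial (R : realType) (N : nat) (l : multi_index N)
    (g : 'rV[R]_N -> R) : 'rV[R]_N -> R :=
  iter_partial (flatten [seq nseq (l i) i | i <- enum 'I_N]) g.

Definition sup_norm (R : realType) (T : Type) (g : T -> R) : \bar R :=
  ereal_sup (range (fun x => `|g x|%:E)).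

Definition gevrey_norm (R : realType) (N : nat) (D : Type)
    (p : 'rV[R]_N -> D) (alpha L : R) (f : D -> R) : \bar R :=
  (\esum_(l in [set: multi_index N])
     ((L `^ ((mi_size l)%:R * alpha) / (mi_fact l)%:R `^ alpha)%:E *
      sup_norm (mpartial l (f \o p))))%E.

Definition gevrey (R : realType) (N : nat) (D : Type)
    (p : 'rV[R]_N -> D) (alpha L : R) (f : D -> R) : Prop :=
  smooth (f \o p) /\ (gevrey_norm p alpha L f < +oo)%E.

Definition flat_on (R : realType) (N : nat) (D : Type)
    (p : 'rV[R]_N -> D) (f : D -> R) (A : set D) : Prop :=
  forall (l : multi_index N) (x : 'rV[R]_N),
    A (p x) -> mpartial l (f \o p) x = 0.

(* The symplectic gradient (d_r1 h, - d_theta1 h, d_r2 h, - d_theta2 h). *)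
Definition ham_field (R : realType) (h : 'rV[R]_4 -> R) (x : 'rV[R]_4) :
    'rV[R]_4 :=
  \row_(j < 4) [:: partial 1 h x; - partial 0 h x;
                   partial 3 h x; - partial 2 h x]`_j.

(* [phi] is the flow of the Hamiltonian [H]; since [phi] is defined for all
   times, this includes the completeness of the Hamiltonian vector field. *)
Definition is_ham_flow (R : realType) (H : phase_space R -> R)
    (phi : R -> phase_space R -> phase_space R) : Prop :=
  forall x : 'rV[R]_4, exists c : R -> 'rV[R]_4,
    [/\ c 0 = x,
        forall t : R, is_derive t 1 c (ham_field (H \o @phase_cover R) (c t)) &
        forall t : R, phi t (phase_cover x) = phase_cover (c t)].

Definition is_time_one_map (R : realType) (H : phase_space R -> R)
    (Phi : phase_space R -> phase_space R) : Prop :=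
  exists2 phi, is_ham_flow H phi & Phi = phi 1.

Definition T0 (R : realType) (omega : R * R) (z : phase_space R) :
    phase_space R :=
  ((z.1.1 + to_circle (omega.1 + z.1.2), z.1.2),
   (z.2.1 + to_circle (omega.2 + z.2.2), z.2.2)).

Definition torus0 (R : realType) : set (phase_space R) :=
  [set z | z.1.2 = 0 /\ z.2.2 = 0].

Definition double_exp (R : realType) (C gamma nu : R) : R :=
  expR (expR (C * nu `^ (- gamma))).

Definition diffusive_point (R : realType) (M : Type) (d : M -> M -> R)
    (E : R -> R) (T : M -> M) (nu : R) (z : M) : Prop :=
  exists (zh : M) (t : nat),
    [/\ (0 < t)%N, d zh z <= nu, t%:R <= E nu & E (2 * nu) <= d (iter t T zh) z].

Definition diffusive_at (R : realType) (M : Type) (d : M -> M -> R)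
    (E : R -> R) (T : M -> M) (nu : R) (X : set M) : Prop :=
  forall z, X z -> diffusive_point d E T nu z.

Definition diffusive (R : realType) (M : Type) (d : M -> M -> R)
    (E : R -> R) (T : M -> M) (X : set M) : Prop :=
  exists nu : nat -> R,
    [/\ forall k, 0 < nu k, nu @ \oo --> (0 : R) &
        forall k, diffusive_at d E T (nu k) X].

(* Main.v *)
(* The system is a skew coupling of a standard map on M_1 with a monotone drift
   on M_2, repeated at a sequence of scales 1/N -> 0 which are separated in r_1
   by cutoffs flat outside annuli at distance ~ 1/N from r_1 = 0.

   At the scale N, u = - A cos(2 pi N theta_1) b(r_1) with b = 1 near the
   resonance omega_1 + r_1 = p/N, so that there Phi^u o T_0 is, up to a rational
   rotation, a standard map.  Flatness of b costs a factor exp(N^gamma), hence A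
   and the kick size are of order exp(- a N^gamma).  The standard map has, for
   every n, a symmetric periodic orbit which crawls from the elliptic to the
   hyperbolic point in n steps.  Its period q is as large as we want, but its
   point on the elliptic line remains at a distance >= A from the rest of the
   orbit, because one kick of size ~ A must be absorbed.  Hence a Gevrey bump f
   isolating this point has norm at most exp(c A^(-gamma)), doubly exponential
   in N^gamma and independent of q, and
   v = f(theta_1) b(r_1) cos(2 pi N theta_2) / (2 pi N q)
   is small as soon as q is doubly exponential.  Once per period v adds 1/q to
   r_2; since q times the frequency omega_2 + r_2 stays an integer, theta_2
   returns to the same phase and the kicks add up: r_2 grows like t / q^2
   forever, which yields a displacement E(2 nu) within the time E(nu). *)
From HB Require Import structures.
Require Import Defs.
From mathcomp Require Import all_boot all_order all_algebra.
From mathcomp Require Import generic_quotient ring_quotient.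
From mathcomp Require Import all_classical all_reals all_analysis.
From mathcomp Require Import ring lra zify.
Import Order.TTheory GRing.Theory Num.Theory.
Import numFieldNormedType.Exports.
Set Implicit Arguments.
Unset Strict Implicit.
Unset Printing Implicit Defensive.
Local Open Scope classical_set_scope.
Local Open Scope ring_scope.

(** * One-variable calculus *)

(** Both Hamiltonians are series of products of one-variable functions, each carried with all its
    derivatives; smoothness and Gevrey norms thus reduce to one-variable bounds
    [M * B ^ k * k! ^ alpha]. On a plateau the cutoff is constant, so each Hamiltonian depends on
    the angles alone: the field leaves the angles fixed, it is constant along the segment it spans,
    and the time-one map is an explicit translation in [r]. The drifting orbit is therefore given by
    formulas in terms of the orbit of the standard map. The doubling between [E(nu)] and [E(2 nu)]
    pays for every polynomial loss. Each point of the torus lies within [6/N] of a drifting orbit,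
    and [C] is tuned so that [E(12/N)] is exactly the bound [exp(exp(c N^gamma))] available for the
    period [q]. The waiting time, of order [q^2 E(12/N)], is then at most a fixed power of
    [E(12/N)], whereas [E(6/N)] is a power of it whose exponent tends to infinity with [N]. *)

Lemma is_derive_continuous (R : realType) (f : R -> R) (x d : R) :
  is_derive x 1 f d -> {for x, continuous f}.
Proof. by move=> [fx _]; exact/differentiable_continuous/derivable1_diffP. Qed.

Section DeriveLambda.
Variables (R : realType) (f g : R -> R) (x a b : R).
Hypotheses (fa : is_derive x 1 f a) (gb : is_derive x 1 g b).

Lemma derive_add : is_derive x 1 (fun t => f t + g t) (a + b).
Proof. exact: is_deriveD. Qed.

Lemma derive_sub : is_derive x 1 (fun t => f t - g t) (a - b).
Proof. exact: is_deriveB. Qed.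

Lemma derive_opp : is_derive x 1 (fun t => - f t) (- a).
Proof. exact: is_deriveN. Qed.

Lemma derive_mul : is_derive x 1 (fun t => f t * g t) (a * g x + f x * b).
Proof. by rewrite addrC [a * _]mulrC; exact: is_deriveM. Qed.

Lemma derive_scale (c : R) : is_derive x 1 (fun t => c * f t) (c * a).
Proof. exact: (is_deriveZ c). Qed.

End DeriveLambda.

Lemma derive_comp (R : realType) (f g : R -> R) (x a b : R) :
  is_derive (g x) 1 f a -> is_derive x 1 g b ->
  is_derive x 1 (fun t => f (g t)) (a * b).
Proof. exact: is_derive1_comp. Qed.

Lemma derive_linear (R : realType) (p x : R) : is_derive x 1 (fun t => p * t) p.
Proof.
rewrite -[X in is_derive _ _ _ X]mulr1.
exact: (derive_scale (is_derive_id x 1)).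
Qed.

Lemma derive_affine (R : realType) (p q x : R) :
  is_derive x 1 (fun t => p * t + q) p.
Proof.
rewrite -[X in is_derive _ _ _ X]addr0.
exact: derive_add (derive_linear p x) (is_derive_cst q x 1).
Qed.

Lemma derive_shift (R : realType) (c x : R) : is_derive x 1 (fun t => t + c) 1.
Proof.
rewrite -[X in is_derive _ _ _ X]addr0.
exact: derive_add (is_derive_id x 1) (is_derive_cst c x 1).
Qed.

Lemma mean_value (R : realType) (f df : R -> R) (a b : R) : a <= b ->
  (forall x : R, a <= x <= b -> is_derive x 1 f (df x)) ->
  exists2 c, a <= c <= b & f b - f a = df c * (b - a).
Proof.
move=> ab fdf.
have [||c cab E] := @MVT_segment R f df a b ab.
- by move=> x; rewrite in_itv /= => /andP[ax xb]; apply: fdf; rewrite !ltW.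
- apply: continuous_in_subspaceT => x; rewrite inE/= in_itv/= => xab.
  exact: is_derive_continuous (fdf x xab).
- by exists c => //; move: cab; rewrite in_itv.
Qed.

Lemma derive_ge0_le (R : realType) (f df : R -> R) (a b : R) : a <= b ->
  (forall x : R, a <= x <= b -> is_derive x 1 f (df x)) ->
  (forall x, a <= x <= b -> 0 <= df x) -> f a <= f b.
Proof.
move=> ab fdf df0; have [c cab E] := mean_value ab fdf.
by rewrite -subr_ge0 E mulr_ge0 ?df0 // subr_ge0.
Qed.

Lemma derive_lipschitz (R : realType) (f df : R -> R) (C : R) :
  (forall x : R, is_derive x 1 f (df x)) -> (forall x, `|df x| <= C) ->
  forall x y, `|f x - f y| <= C * `|x - y|.
Proof.
move=> fdf dfC x y; wlog yx : x y / y <= x => [W|].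
  have [/W//|/ltW/W] := leP y x.
  by rewrite distrC [`|x - _|]distrC.
have [c _ ->] := @mean_value _ f df y x yx (fun z _ => fdf z).
by rewrite normrM ler_wpM2r.
Qed.

(** An integral from [- T] is differentiated only to the right of [- T], so [T] is chosen larger
    than the absolute value of [t] and the value at 0 is subtracted. [PE] shows that the choice of
    [T] is immaterial, so a single [T] serves near a given point. *)
Lemma antiderivative (R : realType) (h : R -> R) : continuous h ->
  exists2 P : R -> R, P 0 = 0 & forall t : R, is_derive t 1 P (h t).
Proof.
move=> hc.
have [F FD] : exists F : R -> R -> R, forall T x : R,
    - T < x -> is_derive x 1 (F T) (h x).
  exists (fun T x => \int[@lebesgue_measure R]_(t in [set` `[-T, x]]) (h t))%R.
  move=> T x Tx; have xx : x < x + 1 by rewrite ltrDl.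
  have hi : (@lebesgue_measure R).-integrable `[- T, x + 1] (EFin \o h).
    apply: continuous_compact_integrable; first exact: segment_compact.
    exact: continuous_subspaceT.
  have [dF eF] := @continuous_FTC1_closed R h (- T) x (x + 1) xx hi Tx (hc x).
  by apply: DeriveDef; [exact: dF|rewrite -derive1E; exact: eF].
pose P (t : R) := F (`|t| + 1) t - F (`|t| + 1) 0.
have PE (T t : R) : `|t| < T -> P t = F T t - F T 0.
  move=> tT; have t0 := normr_ge0 t.
  pose D (x : R) := F (`|t| + 1) x - F T x.
  have DD (x : R) : - `|t| <= x -> is_derive x 1 D 0.
    move=> tx; rewrite -(subrr (h x)).
    by apply: derive_sub; apply: FD; lra.
  suff : D t = D 0 by rewrite /D /P; lra.
  have [t1|/ltW t1] := leP 0 t.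
    have [|c _] := @mean_value _ D (fun=> 0) 0 t t1; last by lra.
    by move=> x /andP[x0 _]; apply: DD; lra.
  have [|c _] := @mean_value _ D (fun=> 0) t 0 t1; last by lra.
  by move=> x /andP[x0 _]; apply: DD; move: x0; rewrite ler0_norm //; lra.
exists P; first by rewrite /P subrr.
move=> t; have tT : `|t| < `|t| + 1 by lra.
apply: (@near_eq_is_derive _ _ _ (fun x => F (`|t| + 1) x - F (`|t| + 1) 0)).
  near=> x; apply/esym/PE.
  near: x; apply: cvgr_lt tT; apply: cvg_norm; exact: cvg_id.
rewrite -[X in is_derive _ _ _ X]subr0.
apply: (@derive_sub R _ (fun=> F (`|t| + 1) 0)).
by apply: FD; have := ler_norm (- t); rewrite normrN; lra.
Unshelve. all: by end_near. Qed.

(** * Coordinates of row vectors, and limits with a geometric rate *)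

Lemma rV_norm_le (R : realType) (n : nat) (v : 'rV[R]_n) (C : R) : 0 <= C ->
  (forall i, `|v 0 i| <= C) -> `|v| <= C.
Proof.
move=> C0 vC; rewrite /Num.Def.normr/= mx_normrE bigmax_le // => -[i j] _ /=.
by rewrite [i]ord1.
Qed.

Lemma rV_coord_le (R : realType) (n : nat) (v : 'rV[R]_n) i : `|v 0 i| <= `|v|.
Proof. by rewrite [leRHS]/Num.Def.normr/= mx_normrE (le_bigmax _ _ (0, i)). Qed.

Lemma is_derive_rV (R : realType) (n : nat) (c : R -> 'rV[R]_n) (t : R)
    (d : 'rV[R]_n) :
  (forall i, is_derive t 1 (fun s => c s 0 i) (d 0 i)) -> is_derive t 1 c d.
Proof.
move=> cd; have dc : derivable c t 1.
  by apply/derivable_mxP => i j; rewrite [i]ord1; case: (cd j).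
apply: DeriveDef => //; rewrite derive_mx //; apply/rowP => i; rewrite mxE.
by case: (cd i).
Qed.

Lemma lipschitz_continuous (R : realType) (V : normedModType R) (f : V -> R)
    (K : R) :
  (forall s t, `|f s - f t| <= K * `|s - t|) -> continuous f.
Proof.
move=> fK x; apply/cvgrPdist_lt => e e0.
have K1 : 0 < `|K| + 1 by rewrite ltr_wpDl.
near=> t; apply: le_lt_trans (fK _ _) _.
apply: (@le_lt_trans _ _ ((`|K| + 1) * `|x - t|)).
  by apply: ler_wpM2r => //; have := ler_norm K; lra.
rewrite mulrC -ltr_pdivlMr //; near: t.
by apply: (@cvgr_dist_lt _ _ _ _ _ id) => //; rewrite divr_gt0.
Unshelve. all: by end_near. Qed.

Lemma le_geometric0 (R : realType) (y K : R) :
  (forall n, y <= K / 2 ^+ n) -> y <= 0.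
Proof.
move=> yK; rewrite leNgt; apply/negP => y0.
have [n Kn] : exists n : nat, K / y < n%:R.
  exists (Num.bound `|K / y|).
  exact: le_lt_trans (ler_norm _) (archi_boundP (normr_ge0 _)).
have n2 : n%:R <= 2 ^+ n :> R by rewrite -natrX ler_nat ltnW // ltn_expl.
have p0 : 0 < 2 ^+ n :> R by rewrite exprn_gt0.
have := yK n; rewrite ler_pdivlMr // => H.
move: Kn; rewrite ltr_pdivrMr // => Kn.
have : n%:R * y <= y * 2 ^+ n by rewrite mulrC ler_pM2l.
lra.
Qed.

(** Nested intervals: [e n] is twice the step bound, which makes [[u n - e n, u n + e n]] decrease.
    The limit is the supremum of the left ends and comes with its rate. *)
Lemma geometric_limit (R : realType) (u : nat -> R) (K : R) :
  (forall n, `|u n.+1 - u n| <= K / 2 ^+ n) ->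
  exists l, forall n, `|l - u n| <= 2 * K / 2 ^+ n.
Proof.
move=> uK; pose e n := 2 * K / 2 ^+ n.
have eS n : e n.+1 = K / 2 ^+ n.
  by rewrite /e exprS; field; rewrite expf_neq0.
have e2 n : e n = 2 * (K / 2 ^+ n) by rewrite /e mulrA.
have lo_mono m n : (m <= n)%N -> u m - e m <= u n - e n.
  elim: n => [|n IH]; first by rewrite leqn0 => /eqP ->.
  rewrite leq_eqVlt => /predU1P[->//|/IH]; rewrite eS !e2 => /le_trans; apply.
  by have := uK n; rewrite ler_norml; lra.
have hi_mono m n : (m <= n)%N -> u n + e n <= u m + e m.
  elim: n => [|n IH]; first by rewrite leqn0 => /eqP ->.
  rewrite leq_eqVlt => /predU1P[->//|/IH]; apply: le_trans; rewrite eS !e2.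
  by have := uK n; rewrite ler_norml; lra.
have e0 n : 0 <= e n by rewrite e2 mulr_ge0 // (le_trans _ (uK n)).
have lohi m n : u m - e m <= u n + e n.
  apply: le_trans (lo_mono _ _ (leq_maxl m n)) _.
  apply: le_trans (hi_mono _ _ (leq_maxr m n)).
  by have := e0 (maxn m n); lra.
pose S := range (fun n => u n - e n).
have Sub n : ubound S (u n + e n) by move=> _ [m _ <-].
exists (sup S) => n; rewrite ler_norml -/(e n); apply/andP; split.
  have : u n - e n <= sup S; last by lra.
  by apply: ub_le_sup; [exists (u 0 + e 0); exact: Sub|exists n].
have : sup S <= u n + e n; last by lra.
by apply: ge_sup (Sub n); exists (u 0 - e 0), 0%N.
Qed.

(* The weighted sup norm with weight [expR (- a * `|t|)] makes the integral
   operator contract by [a^-1]. *)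
Lemma antiderivative_bound (R : realType) (P h : R -> R) (C a : R) : 0 < a ->
  P 0 = 0 -> (forall t : R, is_derive t 1 P (h t)) ->
  (forall s, `|h s| <= C * expR (a * `|s|)) ->
  forall t, `|P t| <= C / a * expR (a * `|t|).
Proof.
move=> a0; have pos (Q g : R -> R) : Q 0 = 0 ->
    (forall t : R, is_derive t 1 Q (g t)) ->
    (forall s, `|g s| <= C * expR (a * `|s|)) ->
    forall t, 0 <= t -> `|Q t| <= C / a * expR (a * t).
  move=> Q0 Qg gC t t0.
  have C0 : 0 <= C / a.
    rewrite divr_ge0 ?(ltW a0) //; have := gC 0.
    by rewrite normr0 mulr0 expR0 mulr1; exact: le_trans (normr_ge0 _).
  have Ed (s : R) : is_derive s 1 (fun s => C / a * expR (a * s)) (C * expR (a * s)).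
    have -> : C * expR (a * s) = C / a * (expR (a * s) * a).
      by field; rewrite gt_eqF.
    apply: derive_scale; apply: (@derive_comp _ expR (fun s => a * s)).
    exact: derive_linear.
  have gb s : 0 <= s <= t -> `|g s| <= C * expR (a * s).
    by move=> /andP[s0 _]; rewrite -[X in expR (_ * X)](ger0_norm s0).
  have := @derive_ge0_le _ _ (fun s => C * expR (a * s) + g s) 0 t t0
    (fun s _ => derive_add (Ed s) (Qg s)).
  have := @derive_ge0_le _ _ (fun s => C * expR (a * s) - g s) 0 t t0
    (fun s _ => derive_sub (Ed s) (Qg s)).
  rewrite Q0 mulr0 expR0 ler_norml => H1 H2.
  have /H1 {}H1 : forall s, 0 <= s <= t -> 0 <= C * expR (a * s) - g s.
    by move=> s /gb; rewrite ler_norml; lra.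
  have /H2 {}H2 : forall s, 0 <= s <= t -> 0 <= C * expR (a * s) + g s.
    by move=> s /gb; rewrite ler_norml; lra.
  lra.
move=> P0 Ph hC t; have [t0|/ltW t0] := leP 0 t; first by rewrite (ger0_norm t0) (pos P h).
rewrite (ler0_norm t0) -{1}(opprK t).
apply: (pos (fun s => P (- s)) (fun s => - h (- s))) => //.
- by rewrite oppr0.
- move=> s; rewrite -mulrN1.
  exact: derive_comp (Ph (- s)) (derive_opp (is_derive_id s 1)).
- by move=> s; rewrite normrN -(normrN s).
- by rewrite oppr_ge0.
Qed.

(** * Ordinary differential equations *)

(* The Picard iteration is started at the tangent line [x + t *: X x], so that a
   line segment which happens to solve the equation on [0, 1] is reproduced by
   every iterate: no separate uniqueness theorem is needed. *)
Lemma picard_lindelof (R : realType) (N : nat) (X : 'rV[R]_N -> 'rV[R]_N)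
    (M Lam : R) :
  (forall x i, `|X x 0 i| <= M) -> 0 < Lam ->
  (forall x y, `|X x - X y| <= Lam * `|x - y|) ->
  forall x, exists c : R -> 'rV[R]_N,
    [/\ c 0 = x, forall t : R, is_derive t 1 c (X (c t)) &
        (forall t, 0 <= t <= 1 -> X (x + t *: X x) = X x) -> c 1 = x + X x].
Proof.
move=> XM Lam0 XL x; pose w := X x.
(* Nonnegativity of [M] is read off a coordinate, so dimension 0 is treated apart. *)
have [/eqP N0|N0] := posnP N.
  exists (fun=> x); split=> [//|t|_].
    by apply: is_derive_rV => i; have := ltn_ord i; rewrite [X in (_ < X)%N](eqP N0).
  by apply/rowP => i; have := ltn_ord i; rewrite [X in (_ < X)%N](eqP N0).
have M0 : 0 <= M by apply: le_trans (XM x (Ordinal N0)).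
(* Made total by the value 0 on discontinuous functions; the curves of the iteration are
   [M]-Lipschitz, so this case does not occur for them. *)
pose A (h : R -> R) : R -> R :=
  if pselect (continuous h) is left hc then s2val (cid2 (antiderivative hc))
  else fun=> 0.
have A0 h : A h 0 = 0.
  by rewrite /A; case: pselect => // hc; case: cid2.
have AD h : continuous h -> forall t : R, is_derive t 1 (A h) (h t).
  by rewrite /A; case: pselect => // hc _; case: cid2.
pose Pic (c : R -> 'rV[R]_N) t : 'rV[R]_N :=
  \row_i (x 0 i + A (fun s => X (c s) 0 i) t).
pose it n := iter n Pic (fun t => x + t *: w).
pose lip (c : R -> 'rV[R]_N) := forall s t, `|c s - c t| <= M * `|s - t|.
have XcL c i : lip c -> continuous (fun s => X (c s) 0 i).
  move=> cL; apply: (@lipschitz_continuous _ _ _ (Lam * M)) => s t.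
  have := rV_coord_le (X (c s) - X (c t)) i; rewrite !mxE => /le_trans; apply.
  by apply: le_trans (XL _ _) _; rewrite -mulrA ler_pM2l.
have PicD c i : lip c ->
    forall t : R, is_derive t 1 (fun s => Pic c s 0 i) (X (c t) 0 i).
  move=> cL t; rewrite -[X in is_derive _ _ _ X]add0r.
  have -> : (fun s => Pic c s 0 i) = fun s => x 0 i + A (fun s => X (c s) 0 i) s.
    by apply/funext => s; rewrite mxE.
  exact: derive_add (is_derive_cst _ _ _) (AD _ (XcL c i cL) t).
have PicL c : lip c -> lip (Pic c).
  move=> cL s t; apply: rV_norm_le => [|i]; first by rewrite mulr_ge0.
  rewrite mxE [X in _ + X]mxE.
  exact: (@derive_lipschitz _ _ (fun t => X (c t) 0 i) M (PicD c i cL)).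
have itL n : lip (it n).
  elim: n => [|n IH]; last exact: PicL.
  move=> s t; apply: rV_norm_le => [|i]; first by rewrite mulr_ge0.
  rewrite !mxE opprD addrACA subrr add0r -mulrBl normrM [leRHS]mulrC.
  by rewrite ler_wpM2l // /w XM.
(* With this weight the integral operator contracts by the factor 1/2. *)
pose a := 2 * Lam; have a0 : 0 < a by rewrite mulr_gt0.
pose E (t : R) := expR (a * `|t|).
have E1 (t : R) : 1 <= E t by rewrite -expR0 ler_expR mulr_ge0 // ltW.
have Eg0 (t : R) : 0 <= E t by rewrite (le_trans _ (E1 t)).
have contr c d K : 0 <= K -> lip c -> lip d ->
    (forall t, `|c t - d t| <= K * E t) ->
    forall t, `|Pic c t - Pic d t| <= K / 2 * E t.
  move=> K0 cL dL cd t; apply: rV_norm_le => [|i].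
    by rewrite !mulr_ge0 ?invr_ge0.
  have -> : K / 2 = Lam * K / a by rewrite /a; field; rewrite gt_eqF.
  rewrite mxE [X in _ + X]mxE.
  apply: (@antiderivative_bound R (fun s => Pic c s 0 i - Pic d s 0 i)
    (fun s => X (c s) 0 i - X (d s) 0 i)) => //.
  - by rewrite !mxE !A0 subrr.
  - by move=> s; apply: derive_sub; exact: PicD.
  - move=> s; have := rV_coord_le (X (c s) - X (d s)) i; rewrite !mxE.
    move=> /le_trans; apply; apply: le_trans (XL _ _) _.
    by rewrite -mulrA ler_pM2l.
pose K := 2 * M / a.
have K0 : 0 <= K by rewrite divr_ge0 ?mulr_ge0 // ltW.
have itS n t : `|it n.+1 t - it n t| <= K * E t / 2 ^+ n.
  elim: n t => [|n IH] t.
    rewrite expr0 divr1; apply: rV_norm_le => [|i]; first by rewrite mulr_ge0.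
    rewrite mxE [X in _ + X]mxE.
    apply: (@antiderivative_bound R (fun s => it 1 s 0 i - it 0 s 0 i)
      (fun s => X (it 0 s) 0 i - w 0 i)) => //.
    + by rewrite !mxE A0 mul0r subrr.
    + move=> s; apply: derive_sub; first exact: (PicD (it 0%N) i (itL 0%N) s).
      have -> : (fun s => it 0 s 0 i) = fun s => w 0 i * s + x 0 i.
        by apply/funext => r; rewrite !mxE addrC mulrC.
      exact: derive_affine.
    + move=> s; apply: (@le_trans _ _ (2 * M)).
        have := XM (it 0 s) i; have := XM x i; rewrite -/w !ler_norml; lra.
      by rewrite ler_peMr ?mulr_ge0 // -/(E s).
  have -> : K * E t / 2 ^+ n.+1 = (K / 2 ^+ n) / 2 * E t.
    by rewrite exprS; field; rewrite expf_neq0.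
  apply: (contr (it n.+1) (it n) _ _ (itL n.+1) (itL n)).
    by rewrite divr_ge0.
  by move=> s; rewrite mulrAC.
have lim_ex t i : exists l : R, forall n, `|l - it n t 0 i| <= 2 * (K * E t) / 2 ^+ n.
  apply: geometric_limit => n.
  by have := rV_coord_le (it n.+1 t - it n t) i; rewrite !mxE => /le_trans; apply.
pose c t : 'rV[R]_N := \row_i sval (cid (lim_ex t i)).
have cit n t : `|c t - it n t| <= 2 * K / 2 ^+ n * E t.
  have K2 : 0 <= 2 * K by exact: mulr_ge0.
  apply: rV_norm_le => [|i].
    by apply: mulr_ge0; [apply: divr_ge0 => //; exact: exprn_ge0|exact: Eg0].
  rewrite !mxE; case: cid => l /= /(_ n) /le_trans; apply.
  by rewrite le_eqVlt; apply/orP; left; apply/eqP; ring.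
have eqlim (u v : 'rV[R]_N) (C : R) : (forall n, `|u - v| <= C / 2 ^+ n) -> u = v.
  by move=> H; apply/eqP; rewrite -subr_eq0 -normr_le0; apply: (le_geometric0 H).
have cL : lip c.
  move=> s t; rewrite -subr_le0; apply: (@le_geometric0 _ _ (2 * K * E s + 2 * K * E t)) => n.
  have : `|c s - c t| <= `|c s - it n s| + `|it n s - it n t| + `|c t - it n t|.
    rewrite (distrC (c t)); apply: le_trans (ler_distD (it n t) _ _) _.
    by rewrite lerD2r ler_distD.
  have := cit n s; have := cit n t; have := itL n s t.
  have -> : (2 * K * E s + 2 * K * E t) / 2 ^+ n = 2 * K / 2 ^+ n * E s + 2 * K / 2 ^+ n * E t by ring.
  lra.
have cPic : c = Pic c.
  apply/funext => t; apply: (eqlim _ _ (2 * K * E t)) => n.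
  have H1 := cit n.+1 t.
  have H2 : `|Pic c t - it n.+1 t| <= 2 * K / 2 ^+ n / 2 * E t.
    apply: (contr c (it n) _ _ cL (itL n) (cit n) t).
    by apply: divr_ge0; [exact: mulr_ge0|exact: exprn_ge0].
  apply: le_trans (ler_distD (it n.+1 t) _ _) _.
  move: H1 H2; rewrite (distrC _ (Pic c t)).
  have -> : 2 * K / 2 ^+ n.+1 * E t = K * E t / 2 ^+ n.
    by rewrite exprS; field; rewrite expf_neq0.
  have -> : 2 * K / 2 ^+ n / 2 * E t = K * E t / 2 ^+ n.
    by field; rewrite expf_neq0.
  have -> : 2 * K * E t / 2 ^+ n = K * E t / 2 ^+ n + K * E t / 2 ^+ n by ring.
  lra.
have itline n : (forall t, 0 <= t <= 1 -> X (x + t *: X x) = X x) ->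
    forall t, 0 <= t <= 1 -> it n t = x + t *: w.
  move=> line; elim: n => [//|n IH] t /andP[t0 t1]; apply/rowP => i.
  have D (s : R) : is_derive s 1 (fun r => it n.+1 r 0 i - (w 0 i * r + x 0 i))
      (X (it n s) 0 i - w 0 i).
    by apply: derive_sub; [exact: (PicD (it n) i (itL n) s)|exact: derive_affine].
  have [s /andP[s0 st] E0] := mean_value t0 (fun s _ => D s).
  have s1 : 0 <= s <= 1 by rewrite s0 (le_trans st).
  move: E0; rewrite IH // line // subrr mul0r !mxE A0; lra.
exists c; split.
- by rewrite cPic; apply/rowP => i; rewrite mxE A0 addr0.
- by move=> t; apply: is_derive_rV => i; rewrite {1}cPic; exact: PicD.
- move=> line; apply: (eqlim _ _ (2 * K * E 1)) => n.
  have := itline n line 1; rewrite ler01 lexx scale1r => /(_ isT) <-.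
  apply: le_trans (cit n 1) _.
  by rewrite le_eqVlt; apply/orP; left; apply/eqP; ring.
Qed.

(** * A periodic orbit of the standard map *)

Lemma cos_turn_nat (R : realType) (x : R) (n : nat) :
  cos (2 * pi * (x + n%:R)) = cos (2 * pi * x).
Proof.
rewrite mulrDr; have -> : 2 * pi * n%:R = (pi *+ 2) *+ n :> R.
  by rewrite -[RHS]mulr_natr -[pi *+ 2]mulr_natl.
exact: (periodicn (@cosD2pi R)).
Qed.

Lemma sin_turn_nat (R : realType) (x : R) (n : nat) :
  sin (2 * pi * (x + n%:R)) = sin (2 * pi * x).
Proof.
rewrite mulrDr; have -> : 2 * pi * n%:R = (pi *+ 2) *+ n :> R.
  by rewrite -[RHS]mulr_natr -[pi *+ 2]mulr_natl.
exact: (periodicn (@sinD2pi R)).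
Qed.

Lemma cos_turn (R : realType) (x z : R) : z \is a Num.int ->
  cos (2 * pi * (x + z)) = cos (2 * pi * x).
Proof.
move=> /intrP[[n|n] ->]; first exact: cos_turn_nat.
by rewrite -(cos_turn_nat _ n.+1) NegzE mulrNz subrK.
Qed.

Lemma sin_turn (R : realType) (x z : R) : z \is a Num.int ->
  sin (2 * pi * (x + z)) = sin (2 * pi * x).
Proof.
move=> /intrP[[n|n] ->]; first exact: sin_turn_nat.
by rewrite -(sin_turn_nat _ n.+1) NegzE mulrNz subrK.
Qed.

Lemma sin_half_turn (R : realType) : sin (2 * pi * 2^-1) = 0 :> R.
Proof. by rewrite mulrAC divff // mul1r sinpi. Qed.

Lemma sin_turn_opp (R : realType) (x : R) :
  sin (2 * pi * (1 - x)) = - sin (2 * pi * x).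
Proof. by rewrite addrC -(mulr1n 1) sin_turn_nat mulrN sinN. Qed.

Lemma sin_turn_ge0 (R : realType) (x : R) : 0 <= x <= 2^-1 ->
  0 <= sin (2 * pi * x).
Proof.
move=> /andP[x0 x1]; apply: sin_ge0_pi.
have p0 : 0 < pi :> R by exact: pi_gt0.
apply/andP; split; first by rewrite !mulr_ge0 // ltW.
by rewrite mulrAC ger_pMl //; lra.
Qed.

(* On this range [4 pi x] is in [pi/2, 3 pi/2], so
   [sin (2 pi x) ^+ 2 = (1 - cos (4 pi x)) / 2 >= 1/2]. *)
Lemma sin_turn_ge_half (R : realType) (x : R) : 8^-1 <= x <= 3 / 8 ->
  2^-1 <= sin (2 * pi * x).
Proof.
move=> /andP[x0 x1]; have p0 : 0 < pi :> R by exact: pi_gt0.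
have s0 : 0 <= sin (2 * pi * x) by apply: sin_turn_ge0; lra.
have : 0 <= cos ((2 * pi * x) *+ 2 - pi).
  apply: cos_ge0_pihalf; apply/andP; split.
    have : pi * (8^-1) <= pi * x by rewrite ler_pM2l.
    lra.
  have : pi * x <= pi * (3 / 8) by rewrite ler_pM2l.
  lra.
rewrite cosB cospi sinpi mulr0 addr0 mulrN1 cos_mulr2n cos2sin2 => H.
rewrite leNgt; apply/negP => s1.
have : sin (2 * pi * x) ^+ 2 <= 2^-1 ^+ 2 by rewrite ler_pXn2r ?nnegrE // ltW.
lra.
Qed.

Lemma continuous_compose (R : realType) (f g : R -> R) :
  continuous f -> continuous g -> continuous (fun x => g (f x)).
Proof. by move=> cf cg x; apply: continuous_comp; [exact: cf|exact: cg]. Qed.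

Section Shooting.
Variables (R : realType) (K : R).
Hypothesis K0 : 0 < K.

(** The force is switched off outside [[0, 1/2]]. It is then never negative, a point that has passed
    1/2 moves on freely, and the initial velocity 1/2 overshoots, as the intermediate value theorem
    requires. A chain that is at 1/2 at time [n] has not left [[0, 1/2]], where the clamp does
    nothing, so it is a genuine piece of orbit of the standard map. *)
Let clamp (x : R) := Num.max 0 (Num.min x 2^-1).
Let kick (x : R) := K * sin (2 * pi * clamp x).

Fixpoint shoot (y : R) (j : nat) : R * R :=
  if j is i.+1 then
    let x := (shoot y i).1 + (shoot y i).2 in (x, (shoot y i).2 - kick x)
  else (0, y).

Let clampP (x : R) : 0 <= clamp x <= 2^-1.
Proof.
rewrite /clamp le_max lexx ge_max invr_ge0 ler0n ge_min lexx orbT.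
by [].
Qed.

Let clamp_id (x : R) : 0 <= x <= 2^-1 -> clamp x = x.
Proof. by move=> /andP[x0 x1]; rewrite /clamp min_l // max_r. Qed.

Let clamp_hi (x : R) : 2^-1 <= x -> clamp x = 2^-1.
Proof. by move=> x1; rewrite /clamp min_r // max_r. Qed.

Let clamp_lip (x y : R) : `|clamp x - clamp y| <= `|x - y|.
Proof.
have := ler_norm (x - y); have := ler_norm (y - x); rewrite (distrC y x).
rewrite /clamp /Order.max /Order.min.
by do !case: ifPn; rewrite -?leNgt ler_norml; lra.
Qed.

Let kick_ge0 x : 0 <= kick x.
Proof. by rewrite mulr_ge0 ?(ltW K0) // sin_turn_ge0 // clampP. Qed.

Let kick_hi x : 2^-1 <= x -> kick x = 0.
Proof. by move=> x1; rewrite /kick clamp_hi // sin_half_turn mulr0. Qed.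

Let clamp_continuous : continuous clamp.
Proof.
by apply: (@lipschitz_continuous _ _ _ 1) => s t; rewrite mul1r clamp_lip.
Qed.

Let kick_continuous : continuous kick.
Proof.
move=> x; apply: cvgM; first exact: cvg_cst.
apply: (@continuous_compose R (fun x => 2 * pi * clamp x) sin); last first.
  exact: continuous_sin.
by move=> z; apply: cvgM; [exact: cvg_cst|exact: clamp_continuous].
Qed.

Lemma shoot_continuous j : continuous (fun y => (shoot y j).1).
Proof.
suff [] : continuous (fun y => (shoot y j).1) /\
          continuous (fun y => (shoot y j).2) by [].
elim: j => [|j [c1 c2]]; first by split=> y; [exact: cvg_cst|exact: cvg_id].
have c3 : continuous (fun y => (shoot y j.+1).1).
  by move=> y; apply: cvgD; [exact: c1|exact: c2].
split=> // y; apply: cvgB; first exact: c2.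
exact: (continuous_compose c3 kick_continuous).
Qed.

Lemma shoot0 j : shoot 0 j = (0, 0).
Proof.
elim: j => [//|j /= ->]; rewrite /= addr0 /kick clamp_id ?lexx ?invr_ge0 ?ler0n //.
by rewrite mulr0 sin0 mulr0 subr0.
Qed.

Lemma shoot_half j : shoot 2^-1 j = (j%:R / 2, 2^-1).
Proof.
elim: j => [|j /= ->]; first by rewrite mul0r.
have e : j%:R / 2 + 2^-1 = j.+1%:R / 2 :> R by rewrite [j.+1%:R]mulrSr mulrDl mul1r.
rewrite /= e kick_hi ?subr0 // ler_peMl ?invr_ge0 ?ler0n // ler1n.
by [].
Qed.

Section Target.
Variables (n : nat) (y : R).
Hypotheses (n0 : (0 < n)%N) (y0 : 0 <= y) (yn : (shoot y n).1 = 2^-1).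
Let x j := (shoot y j).1.
Let v j := (shoot y j).2.

Let xS j : x j.+1 = x j + v j. Proof. by []. Qed.
Let vS j : v j.+1 = v j - kick (x j.+1). Proof. by []. Qed.

Let v_anti i j : (i <= j)%N -> v j <= v i.
Proof.
elim: j => [|j IH]; first by rewrite leqn0 => /eqP ->.
rewrite leq_eqVlt => /predU1P[->//|/IH]; rewrite vS.
by have := kick_ge0 (x j.+1); lra.
Qed.

(** The step that crosses 1/2 has positive velocity, and no kick acts beyond 1/2 to reduce it. *)
Let escape j : 2^-1 < x j -> 0 < v j.
Proof.
elim: j => [|j IH]; first by rewrite /x /=; lra.
move=> h; rewrite vS kick_hi ?(ltW h) // subr0.
by have [/IH//|hj] := ltP 2^-1 (x j); move: h; rewrite xS; lra.
Qed.

Let escaped i j : (i <= j)%N -> 2^-1 < x i -> 2^-1 < x j.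
Proof.
elim: j => [|j IH]; first by rewrite leqn0 => /eqP ->.
rewrite leq_eqVlt => /predU1P[->//|/IH h /h {h}] h; rewrite xS.
by have := escape h; lra.
Qed.

Let x_le_half j : (j <= n)%N -> x j <= 2^-1.
Proof.
move=> jn; rewrite leNgt; apply/negP => /(escaped jn).
by rewrite /x yn ltxx.
Qed.

(** Velocities never increase, so a negative one would carry the point downwards until time [n],
    strictly below a position that is at most 1/2, whereas it has to be at 1/2. *)
Let v_ge0 j : (j < n)%N -> 0 <= v j.
Proof.
move=> jn; rewrite leNgt; apply/negP => vj.
have down i : (j < i)%N -> x i < x j.
  elim: i => [//|i IH]; rewrite ltnS leq_eqVlt => /predU1P[<-|].
    by rewrite xS; lra.
  move=> ji; have := IH ji; rewrite xS; have := v_anti (ltnW ji); lra.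
have := down _ jn; rewrite {1}/x yn; have := x_le_half (ltnW jn); lra.
Qed.

Let x_mono i j : (i <= j)%N -> (j <= n)%N -> x i <= x j.
Proof.
elim: j => [|j IH]; first by rewrite leqn0 => /eqP ->.
rewrite leq_eqVlt => /predU1P[->//|ij] jn; apply: le_trans (IH ij (ltnW jn)) _.
by rewrite xS; have := v_ge0 jn; lra.
Qed.

Let x_ge0 j : (j <= n)%N -> 0 <= x j.
Proof. by move=> jn; apply: (@x_mono 0). Qed.

Lemma chain_range j : (j <= n)%N -> 0 <= x j <= 2^-1.
Proof. by move=> jn; rewrite x_ge0 ?x_le_half. Qed.

Lemma chain_step j : (j < n)%N -> x j <= x j.+1 <= x j + y.
Proof.
move=> jn; rewrite xS; have := v_ge0 jn; have := v_anti (leq0n j).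
by rewrite {2}/v /=; lra.
Qed.

Lemma chain_eq j : (j.+1 < n)%N ->
  x j.+2 - 2 * x j.+1 + x j = - K * sin (2 * pi * x j.+1).
Proof.
move=> jn; rewrite xS vS /kick clamp_id ?chain_range ?(ltnW jn) //.
rewrite xS; lra.
Qed.

Lemma chain_ge j : (0 < j)%N -> (j <= n)%N -> y <= x j.
Proof.
move=> j0 jn; have <- : x 1 = y by rewrite xS /x /v /= add0r.
exact: x_mono.
Qed.

(** If [y < 1/4], the chain cannot jump over the window [[1/8, 3/8]], where the sine is at least
    1/2. Its first kick there takes at least [K / 2] off a velocity that is at most [y] and must
    remain nonnegative. *)
Lemma chain_first_step : K <= 2^-1 -> K / 2 <= y.
Proof.
move=> K1; have [|y4] := leP (4^-1) y; first by lra.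
have ex : exists i, 8^-1 <= x i by exists n; rewrite /x yn; lra.
pose i := ex_minn ex; have [xi mini] : 8^-1 <= x i /\ forall m, 8^-1 <= x m -> (i <= m)%N.
  by rewrite /i; case: ex_minnP.
have i_n : (i <= n)%N by apply: mini; rewrite /x yn; lra.
case: (i) xi mini i_n => [|j] xj minj jn; first by move: xj; rewrite /x /=; lra.
have xj8 : x j < 8^-1 by rewrite ltNge; apply/negP => /minj; rewrite ltnn.
have /andP[_ xj1] := chain_step jn.
have jn' : (j.+1 < n)%N.
  rewrite ltn_neqAle jn andbT; apply/eqP => e.
  by move: xj1; rewrite e {1}/x yn; lra.
have := v_ge0 jn'; rewrite vS /kick clamp_id ?chain_range //.
have s : 2^-1 <= sin (2 * pi * x j.+1) by apply: sin_turn_ge_half; lra.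
have : K * 2^-1 <= K * sin (2 * pi * x j.+1) by rewrite ler_pM2l.
by have := v_anti (leq0n j); rewrite {2}/v /=; lra.
Qed.

End Target.

Lemma shoot_target n : (0 < n)%N ->
  exists2 y, 0 <= y <= 2^-1 & (shoot y n).1 = 2^-1.
Proof.
move=> n0; have h0 : 0 <= 2^-1 :> R by rewrite invr_ge0.
have [|||y yI yn] := @IVT R (fun y => (shoot y n).1) 0 2^-1 2^-1.
- exact: h0.
- by apply: continuous_subspaceT; exact: shoot_continuous.
- rewrite shoot0 shoot_half /=.
  have h : 2^-1 <= n%:R / 2 :> R by rewrite ler_peMl // ler1n.
  by rewrite ge_min h0 le_max h orbT.
- by exists y => //; move: yI; rewrite in_itv.
Qed.

End Shooting.

(* A symmetric periodic orbit of the standard map [x'' = - K sin (2 pi x)] of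
   rotation number [1 / (2 n)]: a chain joining the elliptic point 0 to the
   hyperbolic point 1/2 in [n] steps, continued by reflection. *)
Lemma standard_map_orbit (R : realType) (K : R) (n : nat) :
  0 < K -> K <= 2^-1 -> (0 < n)%N ->
  exists X : nat -> R,
    [/\ forall i, X (i * n.*2)%N = i%:R,
        forall j, X j <= X j.+1 <= X j + 2^-1,
        forall j, X j.+2 - 2 * X j.+1 + X j = - K * sin (2 * pi * X j.+1) &
        forall j, ~~ (n.*2 %| j)%N ->
          exists i : nat, K / 2 <= X j - i%:R <= 1 - K / 2].
Proof.
move=> K0 K1 n0; have [y /andP[y0 y1] yn] := shoot_target K n0.
pose x j := (shoot K y j).1.
have x0 : x 0%N = 0 by [].
have xn : x n = 2^-1 by exact: yn.
(* The second half of the turn is the image of the first under [x -> 1 - x] with time reversed, a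
   symmetry of the equation because the sine is odd about 1/2. *)
pose z r := if (r <= n)%N then x r else 1 - x (n.*2 - r)%N.
have zhi r : (n <= r)%N -> z r = 1 - x (n.*2 - r)%N.
  rewrite /z leq_eqVlt => /predU1P[<-|]; last by rewrite ltnNge => /negbTE ->.
  by rewrite leqnn -addnn addnK xn; lra.
have zlo r : (r <= n)%N -> z r = x r by rewrite /z => ->.
have n2 : (0 < n.*2)%N by rewrite double_gt0.
have z2n : z n.*2 = 1 by rewrite zhi ?subnn ?x0 ?subr0 // -addnn leq_addr.
pose X j := (j %/ n.*2)%:R + z (j %% n.*2)%N.
have XE i r : (r <= n.*2)%N -> X (i * n.*2 + r)%N = i%:R + z r.
  rewrite leq_eqVlt => /predU1P[->|rn].
    rewrite /X -mulSnr mulnK // modnMl zlo // x0 z2n addr0.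
    by rewrite -natr1.
  by rewrite /X divnMDl // divn_small // addn0 modnMDl modn_small.
have Xdiv j : j = (j %/ n.*2 * n.*2 + j %% n.*2)%N by exact: divn_eq.
have zstep r : (r < n.*2)%N -> z r <= z r.+1 <= z r + 2^-1.
  move=> rn; have [rn1|rn1] := ltnP r n.
    rewrite !zlo // ?(ltnW rn1) //.
    by have := chain_step K0 yn rn1; rewrite -/(x r) -/(x r.+1); lra.
  rewrite !zhi // ?(leq_trans rn1) //.
  pose m := (n.*2 - r.+1)%N.
  have em : (n.*2 - r)%N = m.+1 by rewrite /m; lia.
  have mn : (m < n)%N by rewrite /m; lia.
  rewrite em -/m; have := chain_step K0 yn mn.
  by rewrite -/(x m) -/(x m.+1); lra.
exists X; split.
- by move=> i; rewrite -[(i * _)%N]addn0 XE // zlo // x0 addr0.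
- move=> j; rewrite (Xdiv j); have rn := ltn_pmod j n2.
  by rewrite -addnS !XE // ?(ltnW rn) //; have := zstep _ rn; lra.
- move=> j; rewrite (Xdiv j); have rn := ltn_pmod j n2.
  move: (j %/ _)%N (j %% _)%N rn => i r rn; rewrite -!addnS.
  (* Junction of two turns: the middle point is an integer, where the force vanishes, and its
     neighbours are symmetric about it. *)
  have [rn1|rn1] := ltnP r.+1 n.*2; last first.
    have e : n.*2 = r.+1 by apply/eqP; rewrite eqn_leq rn1 rn.
    have -> : (i * n.*2 + r.+2)%N = (i.+1 * n.*2 + 1)%N by lia.
    have zr : z r = 1 - x 1 by rewrite zhi; [congr (1 - x _); lia|lia].
    have z1 : z r.+1 = 1 by rewrite -e.
    rewrite !XE ?(ltnW rn) // zr z1 zlo // [i.+1%:R]mulrSr.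
    have -> : sin (2 * pi * (i%:R + 1)) = 0 :> R.
      by rewrite -[i%:R + 1]add0r -mulrSr sin_turn_nat mulr0 sin0.
    lra.
  rewrite !XE ?(ltnW rn) // [i%:R + z r.+1]addrC sin_turn_nat.
  have sys : z r.+2 - 2 * z r.+1 + z r = - K * sin (2 * pi * z r.+1); last by lra.
  have [rn2|rn2] := ltnP r.+1 n.
    by rewrite !zlo ?(ltnW rn2) ?(ltnW (ltnW rn2)) //; exact: (chain_eq K0 yn).
  (* The hinge at 1/2: again no force and symmetric neighbours. *)
  have [rn3|rn3] := eqVneq r.+1 n.
    have z1 : z r.+1 = 2^-1 by rewrite rn3 zlo.
    have z2 : z r.+2 = 1 - x r by rewrite zhi; [congr (1 - x _); lia|lia].
    by rewrite z1 z2 sin_half_turn (zlo r) -?rn3 //; lra.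
  pose m := (n.*2 - r.+2)%N.
  have em : (n.*2 - r.+1)%N = m.+1 by rewrite /m; lia.
  have em2 : (n.*2 - r)%N = m.+2 by rewrite /m; lia.
  have mn : (m.+1 < n)%N by rewrite /m; lia.
  rewrite !zhi; try lia.
  rewrite em em2 -/m sin_turn_opp; have := chain_eq K0 yn mn.
  by rewrite -/(x m) -/(x m.+1) -/(x m.+2); lra.
- move=> j nj; exists (j %/ n.*2)%N; rewrite /X addrAC subrr add0r.
  move: nj; rewrite /dvdn -lt0n; have := ltn_pmod j n2.
  move: (j %% _)%N => r rn r0.
  have Ky := chain_first_step K0 yn K1.
  have [rn1|rn1] := leqP r n.
    rewrite zlo //; have := chain_range K0 yn rn1; have := chain_ge K0 yn r0 rn1.
    rewrite -/(x r); lra.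
  rewrite zhi ?(ltnW rn1) //; set m := (n.*2 - r)%N.
  have m0 : (0 < m)%N by rewrite /m; lia.
  have mn : (m <= n)%N by rewrite /m; lia.
  have := chain_range K0 yn mn; have := chain_ge K0 yn m0 mn.
  by rewrite -/(x m); lra.
Qed.

(** * Gevrey jets *)

(** Quadratic remainder estimates can be summed over a series; this converts the summed estimate
    into a derivative. *)
Lemma is_derive_quadratic (R : realType) (V : normedModType R) (f : V -> R)
    (x v : V) (d C : R) :
  (forall h : R, `|f (h *: v + x) - f x - h * d| <= C * h ^+ 2) ->
  is_derive x v f d.
Proof.
move=> fC; have C1 : 0 < `|C| + 1 by rewrite ltr_wpDl.
have cvgd : h^-1 *: (f (h *: v + x) - f x) @[h --> 0^'] --> d.
  apply/cvgrPdist_lt => e e0; near=> h.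
  have h0 : h != 0 by near: h; exact: nbhs_dnbhs_neq.
  have hp : 0 < `|h| by rewrite normr_gt0.
  have -> : d - h^-1 *: (f (h *: v + x) - f x) =
      - (h^-1 * (f (h *: v + x) - f x - h * d)).
    by rewrite /GRing.scale /=; field.
  rewrite normrN normrM normfV -ltr_pdivlMl ?invr_gt0 // invrK.
  apply: le_lt_trans (fC h) _; rewrite -real_normK ?num_real // expr2 mulrA.
  rewrite mulrC ltr_pM2l //; apply: (@le_lt_trans _ _ ((`|C| + 1) * `|h|)).
    by apply: ler_wpM2r => //; have := ler_norm C; lra.
  rewrite mulrC -ltr_pdivlMr //; near: h.
  by apply: dnbhs0_lt; rewrite divr_gt0.
by apply: DeriveDef; [apply/cvg_ex; exists d|exact: cvg_lim].
Unshelve. all: by end_near. Qed.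

Lemma derive_sum (R : realType) (n : nat) (h : nat -> R -> R) (dh : nat -> R) (x : R) :
  (forall i, (i < n)%N -> is_derive x 1 (h i) (dh i)) ->
  is_derive x 1 (fun t => \sum_(i < n) h i t) (\sum_(i < n) dh i).
Proof.
elim: n => [|n IH] hd.
  rewrite big_ord0; have -> : (fun t => \sum_(i < 0) h i t) = cst 0.
    by apply/funext => t; rewrite big_ord0.
  exact: is_derive_cst.
rewrite big_ord_recr /=.
have -> : (fun t => \sum_(i < n.+1) h i t) =
    fun t => \sum_(i < n) h i t + h n t.
  by apply/funext => t; rewrite big_ord_recr.
by apply: derive_add; [apply: IH => i ni; apply: hd; exact: ltnW|exact: hd].
Qed.

Definition leibniz (R : realType) (a b : nat -> R) (k : nat) : R :=
  \sum_(j < k.+1) 'C(k, j)%:R * a (k - j)%N * b j.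

(** Pascal's rule. The left-hand side is what one differentiation of each term of Leibniz' formula
    produces. *)
Lemma leibnizS (R : realType) (a b : nat -> R) (k : nat) :
  \sum_(j < k.+1) ('C(k, j)%:R * a (k - j).+1 * b j +
                   'C(k, j)%:R * a (k - j)%N * b j.+1) = leibniz a b k.+1.
Proof.
rewrite /leibniz big_split /= big_ord_recl [in RHS]big_ord_recl /= !bin0 !subn0.
rewrite -addrA; congr (_ + _); rewrite [in RHS]big_ord_recr /=.
rewrite [X in _ + X = _]big_ord_recr /= addrA; congr (_ + _); last first.
  by rewrite /bump /= add1n !binn !subnn.
rewrite -big_split /=; apply: eq_bigr => -[i ik] _ /=.
rewrite /bump /= add1n subSS binS natrD.
have -> : (k - i.+1).+1 = (k - i)%N by lia.
ring.
Qed.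

Definition jet (R : realType) (D : nat -> R -> R) : Prop :=
  forall k (x : R), is_derive x 1 (D k) (D k.+1 x).

(** [B] is an inverse radius, eventually fixed by [L] alone; the size of the function is measured by
    [M]. *)
Definition gevrey_jet (R : realType) (alpha B M : R) (D : nat -> R -> R) : Prop :=
  jet D /\ forall k x, `|D k x| <= M * B ^+ k * k`!%:R `^ alpha.

Section GevreyJet.
Variables (R : realType) (alpha : R).
Hypothesis alpha1 : 1 <= alpha.
Implicit Types (D : nat -> R -> R) (B M : R).

Lemma fact_powR_gt0 k : 0 < k`!%:R `^ alpha :> R.
Proof. by rewrite powR_gt0 // ltr0n fact_gt0. Qed.

Lemma gevrey_jet_ge0 B M D : gevrey_jet alpha B M D -> 0 <= M.
Proof.
move=> [_ /(_ 0 0)]; rewrite expr0 mulr1 fact0 powR1 mulr1.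
by apply: le_trans.
Qed.

Lemma gevrey_jetW B M B' M' D : 0 <= B -> B <= B' -> M <= M' ->
  gevrey_jet alpha B M D -> gevrey_jet alpha B' M' D.
Proof.
move=> B0 BB MM gD; have M0 := gevrey_jet_ge0 gD; case: gD => jD bD.
split=> // k x; apply: le_trans (bD k x) _.
apply: ler_wpM2r; first exact: ltW (fact_powR_gt0 k).
by apply: ler_pM => //; [exact: exprn_ge0|rewrite lerXn2r ?nnegrE // (le_trans B0)].
Qed.

Definition jet_one (k : nat) (x : R) : R := (k == 0%N)%:R.

Lemma gevrey_jet_one B : 0 <= B -> gevrey_jet alpha B 1 jet_one.
Proof.
move=> B0; split=> [k x|k x]; first exact: is_derive_cst.
rewrite /jet_one; case: k => [|k] /=.
  by rewrite normr1 expr0 fact0 powR1 !mulr1.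
by rewrite normr0 mul1r mulr_ge0 ?exprn_ge0 // ltW // fact_powR_gt0.
Qed.

Definition jet_mul D1 D2 (k : nat) (x : R) : R := leibniz (D1^~ x) (D2^~ x) k.

Lemma jet_jet_mul D1 D2 : jet D1 -> jet D2 -> jet (jet_mul D1 D2).
Proof.
move=> j1 j2 k x; rewrite /jet_mul -leibnizS.
apply: (@derive_sum R k.+1 (fun j t => 'C(k, j)%:R * D1 (k - j)%N t * D2 j t)
  (fun j => 'C(k, j)%:R * D1 (k - j).+1 x * D2 j x +
            'C(k, j)%:R * D1 (k - j)%N x * D2 j.+1 x)) => j _.
apply: derive_mul; last exact: j2.
by apply: derive_scale; exact: j1.
Qed.

(* [C(k, j) <= C(k, j) ^ alpha]: this is where [1 <= alpha] matters. *)
Lemma bin_fact_powR (k j : nat) : (j <= k)%N ->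
  'C(k, j)%:R * ((k - j)`!%:R `^ alpha * j`!%:R `^ alpha) <= k`!%:R `^ alpha :> R.
Proof.
move=> jk; rewrite -(bin_fact jk) [(j`! * _)%N]mulnC 2!natrM.
rewrite !powRM ?mulr_ge0 ?ler0n //; apply: ler_wpM2r.
  by rewrite mulr_ge0 ?powR_ge0.
by apply: le1r_powR; rewrite // ler1n bin_gt0.
Qed.

(** Each of the [k + 1] terms of Leibniz' formula is at most [M1 * M2 * B ^ k * k! ^ alpha]; their
    number, at most [2 ^ k], is absorbed by doubling [B]. *)
Lemma gevrey_jet_mul B M1 M2 D1 D2 : 0 <= B ->
  gevrey_jet alpha B M1 D1 -> gevrey_jet alpha B M2 D2 ->
  gevrey_jet alpha (2 * B) (M1 * M2) (jet_mul D1 D2).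
Proof.
move=> B0 g1 g2; have M10 := gevrey_jet_ge0 g1; have M20 := gevrey_jet_ge0 g2.
case: g1 g2 => j1 b1 [j2 b2]; split=> [|k x]; first exact: jet_jet_mul.
apply: le_trans (ler_norm_sum _ _ _) _.
apply: (@le_trans _ _ (\sum_(j < k.+1) (M1 * M2 * B ^+ k * k`!%:R `^ alpha))).
  apply: ler_sum => -[j /= jk] _; rewrite ltnS in jk.
  rewrite !normrM normr_nat.
  apply: (@le_trans _ _ ('C(k, j)%:R *
    (M1 * B ^+ (k - j) * (k - j)`!%:R `^ alpha) * (M2 * B ^+ j * j`!%:R `^ alpha))).
    by apply: ler_pM => //; apply: ler_wpM2l.
  rewrite -(subnK jk) exprD subnK //.
  rewrite [leLHS](_ : _ = M1 * M2 * (B ^+ (k - j) * B ^+ j) *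
    ('C(k, j)%:R * ((k - j)`!%:R `^ alpha * j`!%:R `^ alpha))); last by ring.
  apply: ler_wpM2l; last exact: bin_fact_powR.
  by rewrite mulr_ge0 ?mulr_ge0 ?exprn_ge0.
rewrite sumr_const card_ord -[leLHS]mulr_natl.
rewrite [leRHS](_ : _ = 2 ^+ k * (M1 * M2 * B ^+ k * k`!%:R `^ alpha)); last first.
  by rewrite exprMn; ring.
apply: ler_wpM2r; last by rewrite -natrX ler_nat ltn_expl.
by rewrite !mulr_ge0 ?exprn_ge0 // ltW // fact_powR_gt0.
Qed.

Definition jet_shift (c : R) D (k : nat) (x : R) : R := D k (x + c).

Lemma gevrey_jet_shift B M c D :
  gevrey_jet alpha B M D -> gevrey_jet alpha B M (jet_shift c D).
Proof.
move=> [jD bD]; split=> [k x|k x]; last exact: bD.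
rewrite -[X in is_derive _ _ _ X]mulr1.
exact: (@derive_comp R (D k) (fun t => t + c) x _ _ (jD k (x + c)) (derive_shift c x)).
Qed.

Definition jet_flip D (k : nat) (x : R) : R := (-1) ^+ k * D k (- x).

Lemma gevrey_jet_flip B M D :
  gevrey_jet alpha B M D -> gevrey_jet alpha B M (jet_flip D).
Proof.
move=> [jD bD]; split=> [k x|k x]; last first.
  by rewrite normrM normrX normrN1 expr1n mul1r.
rewrite [X in is_derive _ _ _ X](_ : _ = (-1) ^+ k * (D k.+1 (- x) * -1)); last first.
  by rewrite /jet_flip exprS; ring.
apply: derive_scale; 
exact: (@derive_comp R (D k) (fun t => - t) x _ _ (jD k (- x)) (derive_opp (is_derive_id x 1))).
Qed.

Definition jet_scale (c : R) D (k : nat) (x : R) : R := c * D k x.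

Lemma gevrey_jet_scale B M c D :
  gevrey_jet alpha B M D -> gevrey_jet alpha B (`|c| * M) (jet_scale c D).
Proof.
move=> [jD bD]; split=> [k x|k x]; first exact: derive_scale.
by rewrite normrM -!mulrA ler_wpM2l // !mulrA.
Qed.

Lemma leibniz0l (a b : nat -> R) k : (forall i, a i = 0) -> leibniz a b k = 0.
Proof. by move=> a0; rewrite /leibniz big1 // => i _; rewrite a0 mulr0 mul0r. Qed.

Lemma leibniz0r (a b : nat -> R) k : (forall i, b i = 0) -> leibniz a b k = 0.
Proof. by move=> b0; rewrite /leibniz big1 // => i _; rewrite b0 mulr0. Qed.

End GevreyJet.

(** * The flat function *)

Lemma near_gt (R : realType) (a x : R) : a < x -> \forall y \near x, a < y.
Proof. by move=> ax; exact: (@cvgr_gt _ _ _ _ id x cvg_id a ax). Qed.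

Lemma near_lt (R : realType) (a x : R) : x < a -> \forall y \near x, y < a.
Proof. by move=> ax; exact: (@cvgr_lt _ _ _ _ id x cvg_id a ax). Qed.

Lemma expR_ge_coeff (R : realType) (y : R) (k : nat) : 0 <= y ->
  y ^+ k <= k`!%:R * expR y.
Proof.
move=> y0; case: k => [|k]; first by rewrite expr0 fact0 mul1r (le_trans _ (expR_ge1Dx y)) ?lerDl.
rewrite mulrC -ler_pdivrMr ?ltr0n ?fact_gt0 //.
by apply: le_trans (expR_ge1Dxn k y0); rewrite lerDr.
Qed.

Definition exp_sum (R : realType) (y : R) (k : nat) : R :=
  \sum_(i < k.+1) y ^+ i / i`!%:R.

Lemma exp_sum_le (R : realType) (y : R) (k : nat) : 0 <= y -> exp_sum y k <= expR y.
Proof.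
move=> y0; have -> : exp_sum y k = series (exp_coeff y) k.+1.
  by rewrite /exp_sum seriesEord.
apply: nondecreasing_cvgn_le; last exact: is_cvg_series_exp_coeff.
by apply/nondecreasing_series => n _ _; exact: exp_coeff_ge0.
Qed.

Lemma exp_sumS (R : realType) (y : R) (k : nat) : 0 <= y ->
  y * exp_sum y k <= k.+1%:R * exp_sum y k.+1.
Proof.
move=> y0; rewrite {2}/exp_sum big_ord_recl mulrDr /exp_sum !mulr_sumr.
apply: ler_wpDl; first by rewrite mulr_ge0 // divr_ge0 // exprn_ge0.
apply: ler_sum => -[i /= ik] _; rewrite /bump /= add1n factS natrM exprS invfM.
have p : 0 <= y * (y ^+ i / i`!%:R) by rewrite mulr_ge0 // divr_ge0 // exprn_ge0.
rewrite [leRHS](_ : _ = k.+1%:R / i.+1%:R * (y * (y ^+ i / i`!%:R))); last by ring.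
by apply: ler_peMl => //; rewrite ler_pdivlMr ?ltr0n // mul1r ler_nat.
Qed.

Lemma exp_sum_mono (R : realType) (y : R) (j k : nat) : 0 <= y -> (j <= k)%N ->
  exp_sum y j <= exp_sum y k.
Proof.
move=> y0; elim: k => [|k IH]; first by rewrite leqn0 => /eqP ->.
rewrite leq_eqVlt => /predU1P[->//|/IH]; rewrite {2}/exp_sum => /le_trans; apply.
by rewrite [leRHS]big_ord_recr /= lerDl divr_ge0 ?exprn_ge0.
Qed.

Lemma geometric_quarter (R : realType) (k : nat) :
  \sum_(j < k) 4^-1 ^+ (k - j) <= 3^-1 :> R.
Proof.
have H : \sum_(j < k) 4^-1 ^+ (k - j) = 3^-1 - 3^-1 * 4^-1 ^+ k :> R.
  elim: k => [|k IH]; first by rewrite big_ord0 expr0 mulr1 subrr.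
  rewrite big_ord_recr /= subSnn expr1.
  rewrite (eq_bigr (fun j : 'I_k => 4^-1 * 4^-1 ^+ (k - j))); last first.
    by move=> -[j jk] _ /=; rewrite -exprS subSn // ltnW.
  by rewrite -mulr_sumr IH exprS; field.
by rewrite H lerBlDr lerDl mulr_ge0 ?exprn_ge0 // invr_ge0.
Qed.

Section FlatFunction.
Variables (R : realType) (s lam : R).
Hypotheses (s0 : 0 < s) (lam0 : 0 < lam).

(** For [f = exp (- phi)] with [phi x = lam * x ^ (- s)] one has [f' = psi f], where [psi = - phi'];
    this is the [m]-th derivative of [psi] on the positive axis. *)
Definition flat_psi (m : nat) (x : R) : R :=
  lam * s * (-1) ^+ m * \prod_(i < m) (s + 1 + i%:R) * x `^ (- (s + 1 + m%:R)).

Lemma flat_psiD (m : nat) (x : R) : 0 < x ->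
  is_derive x 1 (flat_psi m) (flat_psi m.+1 x).
Proof.
move=> x0; rewrite /flat_psi.
have -> : lam * s * (-1) ^+ m.+1 * \prod_(i < m.+1) (s + 1 + i%:R) *
    x `^ (- (s + 1 + m.+1%:R)) =
  (lam * s * (-1) ^+ m * \prod_(i < m) (s + 1 + i%:R)) *
    (- (s + 1 + m%:R) * x `^ (- (s + 1 + m%:R) - 1)).
  rewrite big_ord_recr exprS /= [m.+1%:R]mulrSr.
  have -> : - (s + 1 + (m%:R + 1)) = - (s + 1 + m%:R) - 1 by ring.
  ring.
exact: derive_scale (is_derive1_powR (- (s + 1 + m%:R)) x0) _.
Qed.

Let phi (x : R) := lam * x `^ (- s).

Lemma flat_phiD (x : R) : 0 < x ->
  is_derive x 1 (fun x => expR (- phi x)) (flat_psi 0 x * expR (- phi x)).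
Proof.
move=> x0; rewrite mulrC; apply: (@derive_comp R expR (fun x => - phi x)).
rewrite /flat_psi big_ord0 expr0 !mulr1 addr0.
have -> : lam * s * x `^ (- (s + 1)) = - (lam * (- s * x `^ (- s - 1))).
  by rewrite opprD; ring.
exact: derive_opp (derive_scale (is_derive1_powR (- s) x0) lam).
Qed.

(* All derivatives of [exp (- phi)] at [x > 0], computed from [f' = psi f] by
   Leibniz' formula. *)
Fixpoint flat_tab (x : R) (k : nat) : seq R :=
  if k is i.+1 then
    rcons (flat_tab x i)
      (leibniz (flat_psi ^~ x) (nth 0 (flat_tab x i)) i)
  else [:: expR (- phi x)].

Definition flat_der (k : nat) (x : R) : R := nth 0 (flat_tab x k) k.

Lemma size_flat_tab x k : size (flat_tab x k) = k.+1.
Proof. by elim: k => [//|k IH]; rewrite size_rcons IH. Qed.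

Lemma nth_flat_tab x k j : (j <= k)%N -> nth 0 (flat_tab x k) j = flat_der j x.
Proof.
elim: k => [|k IH]; first by rewrite leqn0 => /eqP ->.
rewrite leq_eqVlt => /predU1P[->//|jk]; rewrite /= nth_rcons size_flat_tab jk.
exact: IH.
Qed.

Lemma flat_derS k x : flat_der k.+1 x = leibniz (flat_psi ^~ x) (flat_der ^~ x) k.
Proof.
rewrite /flat_der /= nth_rcons size_flat_tab ltnn eqxx.
by apply: eq_bigr => -[j jk] _ /=; rewrite nth_flat_tab.
Qed.

Lemma flat_der_derive k (x : R) : 0 < x ->
  is_derive x 1 (flat_der k) (flat_der k.+1 x).
Proof.
move=> x0; elim/ltn_ind: k => -[|k] IH.
  have -> : flat_der 0 = fun x => expR (- phi x) by [].
  rewrite flat_derS /leibniz big_ord_recl big_ord0 addr0 bin0 mul1r subnn.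
  exact: flat_phiD.
have -> : flat_der k.+1 = fun x => leibniz (flat_psi ^~ x) (flat_der ^~ x) k.
  by apply/funext => y; rewrite flat_derS.
rewrite flat_derS -leibnizS.
apply: (@derive_sum R k.+1
  (fun j t => 'C(k, j)%:R * flat_psi (k - j)%N t * flat_der j t)
  (fun j => 'C(k, j)%:R * flat_psi (k - j).+1 x * flat_der j x +
            'C(k, j)%:R * flat_psi (k - j)%N x * flat_der j.+1 x)) => j jk.
apply: derive_mul; last exact: IH.
by apply: derive_scale; exact: flat_psiD.
Qed.

Lemma flat_psi_bound m x : 0 < x ->
  `|flat_psi m x| <= s * phi x * m`!%:R * (1 + s) ^+ m * x^-1 ^+ m.+1.
Proof.
move=> x0; have s1 : 0 < 1 + s by rewrite ltr_wpDl.
have P : \prod_(i < m) (s + 1 + i%:R) <= m`!%:R * (1 + s) ^+ m.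
  elim: m => [|m IH]; first by rewrite big_ord0 fact0 expr0 mulr1.
  rewrite big_ord_recr /= factS natrM exprS.
  rewrite [leRHS](_ : _ = (m`!%:R * (1 + s) ^+ m) * (m.+1%:R * (1 + s))); last by ring.
  apply: ler_pM => //.
  - by apply: prodr_ge0 => i _; rewrite !addr_ge0 // ltW.
  - by rewrite !addr_ge0 // ltW.
  - rewrite [m.+1%:R]mulrSr mulrDl mul1r mulrDr mulr1.
    have : 0 <= m%:R * s by rewrite mulr_ge0 // ltW.
    by lra.
have P0 : 0 <= \prod_(i < m) (s + 1 + i%:R).
  by apply: prodr_ge0 => i _; rewrite !addr_ge0 // ltW.
have E : x `^ (- (s + 1 + m%:R)) = x `^ (- s) * x^-1 ^+ m.+1.
  rewrite -addrA opprD powRD; last by rewrite (gt_eqF x0) implybT.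
  by rewrite [1 + _]addrC -mulrSr powR_invn ?exprVn // ltW.
have l0 := ltW lam0; have s0' := ltW s0.
rewrite /flat_psi E !normrM normrX normrN1 expr1n mulr1 !(ger0_norm P0).
rewrite (ger0_norm l0) (ger0_norm s0') !ger0_norm ?powR_ge0 ?exprn_ge0 ?invr_ge0 ?(ltW x0) //.
rewrite /phi.
rewrite [leLHS](_ : _ = (lam * s * x `^ (- s) * x^-1 ^+ m.+1) *
  \prod_(i < m) (s + 1 + i%:R)); last by ring.
rewrite [leRHS](_ : _ = (lam * s * x `^ (- s) * x^-1 ^+ m.+1) *
  (m`!%:R * (1 + s) ^+ m)); last by ring.
apply: ler_wpM2l => //.
by rewrite !mulr_ge0 ?powR_ge0 ?exprn_ge0 ?invr_ge0 ?(ltW x0).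
Qed.

Let K := 4 * (1 + s).
Let y x := 2 * s * phi x / K.

Let K0 : 0 < K. Proof. by rewrite /K mulr_gt0 // ltr_wpDl. Qed.

Let phi_ge0 x : 0 <= phi x.
Proof. by rewrite mulr_ge0 ?powR_ge0 // ltW. Qed.

Let y_ge0 x : 0 <= y x.
Proof.
exact: divr_ge0 (mulr_ge0 (mulr_ge0 (ler0n _ 2) (ltW s0)) (phi_ge0 x)) (ltW K0).
Qed.

(** Each use of [f' = psi f] brings a factor [phi x], unbounded near 0. The truncated exponential of
    [y x], a multiple of [phi x], collects these factors: by [exp_sumS], multiplying by [y x] raises
    its order by one at the price [k + 1], which turns [k!] into the next factorial. The 4 in [K]
    makes the Leibniz sum geometric. *)
Lemma flat_der_majorant k x : 0 < x ->
  `|flat_der k x| <= k`!%:R * (K / x) ^+ k * exp_sum (y x) k * expR (- phi x).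
Proof.
move=> x0; elim/ltn_ind: k => -[|k] IH.
  rewrite /flat_der /= ger0_norm ?expR_ge0 // fact0 expr0.
  by rewrite /exp_sum big_ord_recl big_ord0 expr0 fact0 divr1 addr0 !mul1r.
have u0 : 0 <= x^-1 by rewrite invr_ge0 ltW.
have s1 : 0 < 1 + s by rewrite ltr_wpDl.
have ex0 : 0 <= exp_sum (y x) k.
  by apply: sumr_ge0 => i _; rewrite divr_ge0 // exprn_ge0.
pose T := k`!%:R * s * phi x * x^-1 * (K / x) ^+ k * exp_sum (y x) k * expR (- phi x).
have T0 : 0 <= T.
  by rewrite /T !mulr_ge0 ?powR_ge0 ?(ltW lam0) ?exprn_ge0 ?divr_ge0 ?expR_ge0 ?(ltW K0) ?(ltW s0) ?(ltW x0).
rewrite flat_derS; apply: le_trans (ler_norm_sum _ _ _) _.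
apply: (@le_trans _ _ (\sum_(j < k.+1) 4^-1 ^+ (k - j) * T)).
  apply: ler_sum => -[j /= jk] _; rewrite ltnS in jk.
  rewrite 2!normrM normr_nat.
  have := flat_psi_bound (k - j) x0; have := IH j jk.
  set a := `|flat_der j x|; set b := `|flat_psi _ x| => ha hb.
  have hh : b * a <= (s * phi x * (k - j)`!%:R * (1 + s) ^+ (k - j) * x^-1 ^+ (k - j).+1) *
     (j`!%:R * (K / x) ^+ j * exp_sum (y x) k * expR (- phi x)).
    apply: ler_pM => //; rewrite ?normr_ge0 //; apply: le_trans ha _.
    apply: ler_wpM2r; first exact: expR_ge0.
    apply: ler_wpM2l; last exact: exp_sum_mono.
    by rewrite mulr_ge0 ?exprn_ge0 ?divr_ge0 ?(ltW K0) ?(ltW x0).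
  rewrite -[leLHS]mulrA; apply: le_trans (ler_wpM2l (ler0n R 'C(k, j)) hh) _.
  rewrite le_eqVlt; apply/orP; left; apply/eqP; rewrite /T -(bin_fact jk) !natrM.
  have -> : (K / x) ^+ k = (K / x) ^+ (k - j) * (K / x) ^+ j by rewrite -exprD subnK.
  have -> : 4^-1 ^+ (k - j) = (1 + s) ^+ (k - j) * K^-1 ^+ (k - j) :> R.
    by rewrite -exprMn /K; congr (_ ^+ _); field; rewrite gt_eqF.
  rewrite (exprMn (k - j) K x^-1).
  have e : K ^+ (k - j) * K^-1 ^+ (k - j) = 1.
    by rewrite -exprMn mulfV ?expr1n // gt_eqF.
  rewrite exprS.
  transitivity ((K ^+ (k - j) * K^-1 ^+ (k - j)) * ('C(k, j)%:R *
     (s * phi x * (k - j)`!%:R * (1 + s) ^+ (k - j) * (x^-1 * x^-1 ^+ (k - j)) *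
     (j`!%:R * (K / x) ^+ j * exp_sum (y x) k * expR (- phi x))))).
    by rewrite e mul1r.
  ring.
rewrite -mulr_suml big_ord_recr /= subnn expr0.
apply: (@le_trans _ _ (2 * T)).
  by apply: ler_wpM2r => //; have := geometric_quarter R k; lra.
have -> : 2 * T = k`!%:R * (K / x) ^+ k.+1 * expR (- phi x) * (y x * exp_sum (y x) k).
  by rewrite /T /y exprS; field; rewrite !gt_eqF.
rewrite factS natrM.
rewrite [leRHS](_ : _ = k`!%:R * (K / x) ^+ k.+1 * expR (- phi x) *
  (k.+1%:R * exp_sum (y x) k.+1)); last by ring.
apply: ler_wpM2l; last exact: exp_sumS.
by rewrite !mulr_ge0 ?exprn_ge0 ?divr_ge0 ?expR_ge0 ?(ltW K0) ?(ltW x0).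
Qed.

(** The truncated exponential is at most [exp (y x)], and [y x <= phi x / 2]; half of the decay is
    left to pay for the powers of [1 / x]. *)
Lemma flat_der_bound k x : 0 < x ->
  `|flat_der k x| <= k`!%:R * (K / x) ^+ k * expR (- phi x / 2).
Proof.
move=> x0; apply: le_trans (flat_der_majorant k x0) _; rewrite -mulrA.
apply: ler_wpM2l.
  by rewrite !mulr_ge0 ?exprn_ge0 ?divr_ge0 ?expR_ge0 ?(ltW K0) ?(ltW x0).
apply: (@le_trans _ _ (expR (y x) * expR (- phi x))).
  by apply: ler_wpM2r; [exact: expR_ge0|exact: exp_sum_le].
rewrite -expRD ler_expR.
have s1 : 0 < 1 + s by rewrite ltr_wpDl.
have : y x <= phi x / 2; last by lra.
rewrite /y /K ler_pdivrMr ?mulr_gt0 //.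
have := phi_ge0 x; have : 0 <= s * phi x by rewrite mulr_ge0 // ltW.
lra.
Qed.

(* [t ^ k exp (- s t) <= k! / s ^ k] at [t = phi x / 2], raised to the power
   [1 / s]. *)
Lemma inv_pow_bound k x : 0 < x ->
  x^-1 ^+ k * expR (- phi x / 2) <=
  k`!%:R `^ s^-1 * ((2 / (s * lam)) `^ s^-1) ^+ k.
Proof.
move=> x0; pose t := s * phi x / 2.
have t0 : 0 <= t by rewrite divr_ge0 // mulr_ge0 // ltW.
have H : (t ^+ k) `^ s^-1 <= (k`!%:R * expR t) `^ s^-1.
  apply: ge0_ler_powR; rewrite ?nnegrE ?invr_ge0 ?(ltW s0) ?exprn_ge0 //.
  exact: expR_ge_coeff.
have sn : s != 0 by rewrite gt_eqF.
have u0 : 0 < x^-1 by rewrite invr_gt0.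
have phiE : phi x = lam * x^-1 `^ s.
  by rewrite /phi -[in RHS](powR_inv1 (ltW x0)) -powRrM mulN1r.
move: H; rewrite powRM ?expR_ge0 // -expRM.
have -> : t * s^-1 = phi x / 2 by rewrite /t; field.
have -> : (t ^+ k) `^ s^-1 = x^-1 ^+ k * ((s * lam / 2) `^ s^-1) ^+ k.
  rewrite -exprMn -!powR_mulrn ?powR_ge0 // -?powRrM.
    rewrite mulrC powRrM; congr (_ `^ _).
    rewrite /t phiE; have -> : s * (lam * x^-1 `^ s) / 2 = (x^-1 `^ s) * (s * lam / 2) by ring.
    rewrite powRM ?powR_ge0 //; last by rewrite divr_ge0 // mulr_ge0 // ltW.
    by rewrite -powRrM mulfV // powRr1 // ltW.
  by rewrite mulr_ge0 ?powR_ge0 // ltW.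
move=> H.
have c0 : 0 < s * lam / 2 by rewrite divr_gt0 // mulr_gt0.
have -> : (2 / (s * lam)) `^ s^-1 = ((s * lam / 2) `^ s^-1)^-1.
  have -> : 2 / (s * lam) = (s * lam / 2)^-1 by field; rewrite !gt_eqF.
  by rewrite -powRN -(powR_inv1 (ltW c0)) -powRrM mulN1r.
rewrite [X in _ <= _ * X]exprVn ler_pdivlMr ?exprn_gt0 ?powR_gt0 //.
have -> : - phi x / 2 = - (phi x / 2) by rewrite mulNr.
rewrite expRN mulrAC ler_pdivrMr ?expR_gt0 //.
Qed.

End FlatFunction.

Section FlatJet.
Variables (R : realType) (s : R).
Hypothesis s0 : 0 < s.

Definition flat_jet (lam : R) (k : nat) (x : R) : R :=
  if 0 < x then flat_der s lam k x else 0.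

Section Fixed.
Variable lam : R.
Hypothesis lam0 : 0 < lam.
Let K := 4 * (1 + s).
Let G := (2 / (s * lam)) `^ s^-1.

Let K0 : 0 < K. Proof. by rewrite /K mulr_gt0 // ltr_wpDl. Qed.

(** The surplus factor [x ^ i] serves differentiability at 0, where [i = 2] is used; [i = 0] gives
    the uniform bound. *)
Let flat_der_inv i k x : 0 < x -> `|flat_der s lam k x| <=
  k`!%:R * K ^+ k * ((k + i)`!%:R `^ s^-1 * G ^+ (k + i)) * x ^+ i.
Proof.
move=> x0; apply: le_trans (flat_der_bound s0 lam0 k x0) _.
have := inv_pow_bound s0 lam0 (k + i) x0; rewrite -/G => H.
have xn : x != 0 by rewrite gt_eqF.
have -> : (4 * (1 + s) / x) ^+ k = K ^+ k * x^-1 ^+ (k + i) * x ^+ i.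
  by rewrite exprMn exprD -!mulrA -[in RHS]exprMn mulVf // expr1n mulr1.
rewrite [leLHS](_ : _ = k`!%:R * K ^+ k * (x^-1 ^+ (k + i) *
  expR (- (lam * x `^ (- s)) / 2)) * x ^+ i); last by ring.
apply: ler_wpM2r; first by rewrite exprn_ge0 // ltW.
by apply: ler_wpM2l => //; rewrite mulr_ge0 // exprn_ge0 // ltW.
Qed.

Lemma jet_flat_jet : jet (flat_jet lam).
Proof.
move=> k x; have [x0|x0|->] := ltgtP x 0.
- have E : flat_jet lam k.+1 x = 0 by rewrite /flat_jet ltNge ltW.
  rewrite E; apply: (@near_eq_is_derive _ _ _ (cst 0)) => //.
  near=> y; rewrite /flat_jet ltNge ltW //=.
  by near: y; exact: near_lt.
- have E : flat_jet lam k.+1 x = flat_der s lam k.+1 x by rewrite /flat_jet x0.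
  rewrite E; apply: (@near_eq_is_derive _ _ _ (flat_der s lam k)).
    near=> y; rewrite /flat_jet ifT //.
    by near: y; exact: near_gt.
  exact: flat_der_derive.
have E : flat_jet lam k.+1 0 = 0 by rewrite /flat_jet ltxx.
rewrite E; pose C := k`!%:R * K ^+ k * ((k + 2)`!%:R `^ s^-1 * G ^+ (k + 2)).
have C0 : 0 <= C.
  by rewrite !mulr_ge0 ?exprn_ge0 ?powR_ge0 ?(ltW K0).
apply: (@is_derive_quadratic _ _ _ _ _ _ C) => h.
rewrite mulr0 subr0 addr0 [h *: 1]mulr1 /flat_jet ltxx subr0.
have [h0|h0] := ltP 0 h; first exact: flat_der_inv.
by rewrite normr0 mulr_ge0 // sqr_ge0.
Unshelve. all: by end_near. Qed.

Lemma flat_jet_bound k x : `|flat_jet lam k x| <=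
  (K * G) ^+ k * k`!%:R `^ (1 + s^-1).
Proof.
have Fk : k`!%:R != 0 :> R by rewrite pnatr_eq0 -lt0n fact_gt0.
rewrite /flat_jet; case: ifPn => [x0|_]; last first.
  by rewrite normr0 mulr_ge0 ?powR_ge0 // exprn_ge0 // mulr_ge0 ?powR_ge0 ?(ltW K0).
apply: le_trans (flat_der_inv 0 k x0) _; rewrite addn0 expr0 mulr1.
have -> : k`!%:R `^ (1 + s^-1) = k`!%:R * k`!%:R `^ s^-1 :> R.
  by rewrite powRD ?Fk ?implybT // powRr1.
rewrite [(K * G) ^+ k]exprMn.
by rewrite le_eqVlt; apply/orP; left; apply/eqP; ring.
Qed.

End Fixed.

(** The larger [lam], the flatter the function and the smaller the inverse radius in
    [flat_jet_bound]; [lam] is solved from the requirement that the latter equal [B]. *)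
Lemma flat_jet_gevrey (B : R) : 0 < B ->
  exists2 lam, 0 < lam & gevrey_jet (1 + s^-1) B 1 (flat_jet lam).
Proof.
move=> B0; pose K := 4 * (1 + s); have K0 : 0 < K by rewrite mulr_gt0 // ltr_wpDl.
pose lam := 2 / (s * (B / K) `^ s).
have p0 : 0 < (B / K) `^ s by rewrite powR_gt0 // divr_gt0.
have lam0 : 0 < lam by rewrite divr_gt0 // mulr_gt0.
exists lam => //; split=> [|k x]; first exact: jet_flat_jet.
apply: le_trans (flat_jet_bound lam0 k x) _.
have -> : 2 / (s * lam) = (B / K) `^ s.
  by rewrite /lam; field; rewrite !gt_eqF.
rewrite -powRrM mulfV ?gt_eqF // powRr1 ?divr_ge0 ?(ltW B0) ?(ltW K0) //.
have -> : 4 * (1 + s) * (B / K) = B by rewrite -/K mulrC divfK // gt_eqF.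
by rewrite mul1r.
Qed.

(** The flat function of the signed distances to the two ends [- sig] and [sig], multiplied. Its
    small value at the centre is the price of localisation. *)
Definition flat_bump (lam sig : R) : nat -> R -> R :=
  jet_mul (jet_shift sig (flat_jet lam)) (jet_flip (jet_shift sig (flat_jet lam))).

Section Bump.
Variables (lam B : R).
Hypotheses (lam0 : 0 < lam) (B0 : 0 < B).
Hypothesis gF : gevrey_jet (1 + s^-1) B 1 (flat_jet lam).
Variable sig : R.
Hypothesis sig0 : 0 < sig.

Let alpha1 : 1 <= 1 + s^-1. Proof. by rewrite lerDl invr_ge0 ltW. Qed.

Lemma flat_bump_gevrey : gevrey_jet (1 + s^-1) (2 * B) 1 (flat_bump lam sig).
Proof.
rewrite -[X in gevrey_jet _ _ X](mulr1 1); apply: gevrey_jet_mul => //.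
- exact: ltW.
- exact: gevrey_jet_shift.
- by apply: gevrey_jet_flip; exact: gevrey_jet_shift.
Qed.

Lemma flat_bump_out k x : sig <= `|x| -> flat_bump lam sig k x = 0.
Proof.
rewrite /flat_bump /jet_mul ler_normr => /orP[h|h].
  by apply: leibniz0r => i; rewrite /jet_flip /jet_shift /flat_jet ltNge ifF ?mulr0 //; apply/negbTE; rewrite negbK; lra.
by apply: leibniz0l => i; rewrite /jet_shift /flat_jet ltNge ifF //; apply/negbTE; rewrite negbK; lra.
Qed.

Lemma flat_bumpE x :
  flat_bump lam sig 0 x = flat_jet lam 0 (x + sig) * flat_jet lam 0 (- x + sig).
Proof.
rewrite /flat_bump /jet_mul /leibniz big_ord_recl big_ord0 bin0 addr0 mul1r.
by rewrite /jet_shift /jet_flip expr0 mul1r.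
Qed.

Lemma flat_jet0_ge0 x : 0 <= flat_jet lam 0 x.
Proof. by rewrite /flat_jet; case: ifP => // _; exact: expR_ge0. Qed.

Lemma flat_jet0E x : 0 < x -> flat_jet lam 0 x = expR (- (lam * x `^ (- s))).
Proof. by rewrite /flat_jet => ->. Qed.

Lemma flat_bump_ge0 x : 0 <= flat_bump lam sig 0 x.
Proof. by rewrite flat_bumpE mulr_ge0 ?flat_jet0_ge0. Qed.

Lemma flat_bump_center : flat_bump lam sig 0 0 = expR (- (2 * lam * sig `^ (- s))).
Proof.
by rewrite flat_bumpE oppr0 !add0r flat_jet0E // -expRD; congr expR; ring.
Qed.

Lemma flat_bump_critical : flat_bump lam sig 1 0 = 0.
Proof.
rewrite /flat_bump /jet_mul /leibniz !big_ord_recl big_ord0 /bump /=.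
rewrite /jet_shift /jet_flip oppr0 !add0r !expr0 !expr1 bin0 binn subnn subn0.
ring.
Qed.

Lemma flat_bump_half x : - (sig / 2) <= x <= sig / 2 ->
  expR (- (2 * lam * (sig / 2) `^ (- s))) <= flat_bump lam sig 0 x.
Proof.
move=> /andP[x1 x2]; have h0 : 0 < sig / 2 by rewrite divr_gt0.
have H y : sig / 2 <= y -> expR (- (lam * (sig / 2) `^ (- s))) <= flat_jet lam 0 y.
  move=> hy; have y0 : 0 < y by exact: lt_le_trans hy.
  rewrite flat_jet0E // ler_expR lerN2 ler_pM2l // !powRN lef_pV2 ?posrE ?powR_gt0 //.
  by apply: ge0_ler_powR; rewrite ?nnegrE // ltW.
rewrite flat_bumpE; have -> : - (2 * lam * (sig / 2) `^ (- s)) =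
  - (lam * (sig / 2) `^ (- s)) - (lam * (sig / 2) `^ (- s)) by ring.
by rewrite expRD ler_pM ?expR_ge0 // H //; lra.
Qed.

(** A normalised primitive of the bump. [I] bounds the integral from below: the middle half of the
    support has length [sig], and there each factor of the bump is at least its value at [sig / 2].
    Integrating once gains [1 / (2 * B)]; the summand 1 covers order 0. *)
Lemma flat_step : exists D : nat -> R -> R,
  let I := sig * expR (- (2 * lam * (sig / 2) `^ (- s))) in
  [/\ gevrey_jet (1 + s^-1) (2 * B) (1 + (2 * B * I)^-1) D,
      forall k x, x <= - sig -> D k x = 0 &
      forall k x, sig <= x -> D k x = (k == 0%N)%:R].
Proof.
have [jb bb] := flat_bump_gevrey; set b := flat_bump lam sig in jb bb *.
have b0c : continuous (b 0%N) by move=> x; apply: is_derive_continuous (jb 0%N x).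
have [P P0 PD] := antiderivative b0c.
pose I := sig * expR (- (2 * lam * (sig / 2) `^ (- s))); rewrite /= -/I.
have I0 : 0 < I by rewrite mulr_gt0 ?expR_gt0.
have BI0 : 0 < 2 * B * I by rewrite mulr_gt0 // mulr_gt0.
have Pmono x y : x <= y -> P x <= P y.
  move=> xy; apply: (derive_ge0_le xy (fun z _ => PD z)) => z _.
  exact: flat_bump_ge0.
have b_out k x : sig <= `|x| -> b k x = 0 by exact: flat_bump_out.
have Plo x : x <= - sig -> P x = P (- sig).
  move=> xs; have [c /andP[_ cs] E] := mean_value xs (fun z _ => PD z).
  move: E; rewrite b_out; first by rewrite mul0r; lra.
  by rewrite ler_normr; apply/orP; right; lra.
have Phi x : sig <= x -> P x = P sig.
  move=> xs; have [c /andP[cs _] E] := mean_value xs (fun z _ => PD z).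
  move: E; rewrite b_out; first by rewrite mul0r; lra.
  by rewrite ler_normr cs.
pose J := P sig - P (- sig).
have IJ : I <= J.
  have h : - (sig / 2) <= sig / 2 by rewrite lerNl -subr_ge0 opprK addr_ge0 // divr_ge0 // ltW.
  have [c hc E] := mean_value h (fun z _ => PD z).
  have b1 := flat_bump_half hc.
  apply: (@le_trans _ _ (P (sig / 2) - P (- (sig / 2)))); last first.
    by rewrite /J lerB // Pmono //; lra.
  by rewrite E opprK -splitr [leRHS]mulrC; apply: ler_wpM2l => //; exact: ltW.
have J0 : 0 < J by exact: lt_le_trans IJ.
pose D k x := if k is i.+1 then J^-1 * b i x else J^-1 * (P x - P (- sig)).
exists D; split.
- split=> [[|k] x|[|k] x].
  + apply: derive_scale; rewrite -[X in is_derive _ _ _ X]subr0.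
    exact: derive_sub (PD x) (is_derive_cst (P (- sig)) x 1).
  + by apply: derive_scale; exact: jb.
  + rewrite expr0 fact0 powR1 !mulr1 /D ger0_norm; last first.
      rewrite mulr_ge0 ?invr_ge0 ?(ltW J0) // subr_ge0.
      have [xs|/ltW] := leP x (- sig); first by rewrite Plo.
      exact: Pmono.
    apply: (@le_trans _ _ 1); last by rewrite lerDl invr_ge0 (ltW BI0).
    rewrite [leLHS]mulrC ler_pdivrMr // mul1r /J lerD2r.
    have [xs|/ltW] := leP sig x; first by rewrite Phi.
    exact: Pmono.
  + rewrite /D normrM ger0_norm ?invr_ge0 ?(ltW J0) //.
    have := bb k x; rewrite mul1r => H.
    have f1 : k`!%:R `^ (1 + s^-1) <= k.+1`!%:R `^ (1 + s^-1) :> R.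
      apply: ge0_ler_powR; rewrite ?nnegrE ?ler0n ?ler_nat //.
        by rewrite (le_trans _ alpha1).
      by rewrite factS leq_pmull.
    have BB : 0 < 2 * B by rewrite mulr_gt0.
    apply: (@le_trans _ _ (I^-1 * ((2 * B) ^+ k * k.+1`!%:R `^ (1 + s^-1)))).
      apply: ler_pM => //; first by rewrite invr_ge0 ltW.
        by rewrite lef_pV2 ?posrE.
      by apply: le_trans H _; apply: ler_wpM2l => //; rewrite exprn_ge0 // ltW.
    have -> : I^-1 * ((2 * B) ^+ k * k.+1`!%:R `^ (1 + s^-1)) =
        (2 * B * I)^-1 * (2 * B) ^+ k.+1 * k.+1`!%:R `^ (1 + s^-1).
      by rewrite exprS; field; rewrite !gt_eqF.
    apply: ler_wpM2r; first exact: powR_ge0.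
    apply: ler_wpM2r; first by rewrite exprn_ge0 // ltW.
    by rewrite lerDr.
- move=> [|k] x xs; rewrite /D; first by rewrite Plo // subrr mulr0.
  by rewrite b_out ?mulr0 // ler_normr; apply/orP; right; lra.
- move=> [|k] x xs; rewrite /D; first by rewrite Phi // mulVf // gt_eqF.
  by rewrite b_out ?mulr0 // ler_normr xs.
Qed.

End Bump.
End FlatJet.

(** * Plateaus, bumps and cosines *)

Definition jet_periodize (R : realType) (D : nat -> R -> R) (k : nat) (x : R) : R :=
  D k (x - (Num.floor (x + 2^-1))%:~R).

Section Periodize.
Variables (R : realType) (D : nat -> R -> R) (sig : R).
Hypotheses (sig1 : sig < 2^-1) (D_out : forall k x, sig <= `|x| -> D k x = 0).

Let round (x : R) : R := (Num.floor (x + 2^-1))%:~R.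

Let roundP x : - 2^-1 <= x - round x < 2^-1.
Proof.
have := floor_itv (x + 2^-1); rewrite /round => /andP[]; rewrite intrD1; lra.
Qed.

Let round_int x : round x \is a Num.int. Proof. exact: intr_int. Qed.

(** If [m] is not the integer selected by rounding, both translates of [x] lie outside the support.
    The integer may thus be kept fixed on a neighbourhood when differentiating, in spite of the
    jumps of the rounding. *)
Lemma jet_periodizeE k (m x : R) : m \is a Num.int -> `|x - m| < 1 - sig ->
  jet_periodize D k x = D k (x - m).
Proof.
move=> mi xm; rewrite /jet_periodize -/(round x).
have [->//|d] := eqVneq (round x) m.
have : 1 <= `|round x - m|.
  by apply: norm_intr_ge1; rewrite ?rpredB // subr_eq0.
have := roundP x; have := ler_distD x (round x) m.
have r1 : `|x - round x| <= 2^-1 by have := roundP x; rewrite ler_norml; lra.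
rewrite (distrC (round x) x) => h1 h2 h3.
by rewrite !D_out //; have := sig1; lra.
Qed.

Lemma jet_jet_periodize : jet D -> jet (jet_periodize D).
Proof.
move=> jD k x; have xm : `|x - round x| < 1 - sig.
  apply: (@le_lt_trans _ _ (2^-1)); last by have := sig1; lra.
  by have := roundP x; rewrite ler_norml; lra.
rewrite (@jet_periodizeE _ (round x)) //.
apply: (@near_eq_is_derive _ _ _ (fun y => D k (y + - round x))).
  near=> y; rewrite (@jet_periodizeE _ (round x)) //.
  near: y; apply: (@cvgr_lt _ _ _ _ (fun y => `|y - round x|)) xm.
  by apply: cvg_norm; apply: cvgB; [exact: cvg_id|exact: cvg_cst].
rewrite -[X in is_derive _ _ _ X]mulr1.
exact: (@derive_comp R (D k) (fun y => y + - round x) x _ _ (jD k _) (derive_shift _ x)).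
Unshelve. all: by end_near. Qed.

Lemma jet_periodize_period k x z : z \is a Num.int ->
  jet_periodize D k (x + z) = jet_periodize D k x.
Proof.
move=> /intrP[m ->]; rewrite /jet_periodize.
have -> : x + m%:~R + 2^-1 = (x + 2^-1) + m%:~R by rewrite addrAC.
rewrite floorDrz ?intr_int // intrKfloor rmorphD /=.
by congr (D k _); ring.
Qed.

Lemma jet_periodize_out k x :
  (forall z : R, z \is a Num.int -> sig <= `|x - z|) -> jet_periodize D k x = 0.
Proof. by move=> xz; apply: D_out; exact: xz. Qed.

End Periodize.

Section Profiles.
Variables (R : realType) (alpha B : R).
Hypotheses (alpha1 : 1 < alpha) (B0 : 0 < B).
Let s := (alpha - 1)^-1.
Let s0 : 0 < s. Proof. by rewrite invr_gt0 subr_gt0. Qed.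
Let alphaE : alpha = 1 + s^-1. Proof. by rewrite invrK addrC subrK. Qed.

(** Division by the central value costs [exp (2 * lam * sig ^ (- s))]. The vanishing derivative at
    the integers will keep [r_1] unchanged when [r_2] is kicked. *)
Lemma bump_jet : exists2 c : R, 0 < c & forall sig : R, 0 < sig -> sig < 2^-1 ->
  exists D : nat -> R -> R,
    [/\ gevrey_jet alpha B (expR (c * sig `^ (- s))) D,
        forall k x z, z \is a Num.int -> D k (x + z) = D k x,
        D 0 0 = 1, D 1 0 = 0 &
        forall k x, (forall z : R, z \is a Num.int -> sig <= `|x - z|) ->
          D k x = 0].
Proof.
have B2 : 0 < B / 2 by rewrite divr_gt0.
have [lam lam0 gF] := flat_jet_gevrey s0 B2.
exists (2 * lam) => [|sig sig0 sig1]; first by rewrite mulr_gt0.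
pose b := flat_bump s lam sig.
have b_out k x : sig <= `|x| -> b k x = 0 by exact: flat_bump_out.
have gb : gevrey_jet alpha B 1 b.
  have := flat_bump_gevrey s0 B2 gF sig.
  by rewrite -alphaE; have -> : 2 * (B / 2) = B by field.
pose M := expR (2 * lam * sig `^ (- s)).
exists (jet_scale M (jet_periodize b)); split.
- rewrite -/M -[M in gevrey_jet _ _ M _](ger0_norm (expR_ge0 _)) -[`|M|]mulr1.
  apply: gevrey_jet_scale.
  case: gb => jb bb; split; first exact: (jet_jet_periodize sig1 b_out jb).
  by move=> k x; exact: bb.
- by move=> k x z zi; rewrite /jet_scale (jet_periodize_period b).
- rewrite /jet_scale (@jet_periodizeE _ b sig sig1 b_out _ 0) ?subr0 ?normr0 //; last by lra.
  by rewrite /b flat_bump_center // /M -expRD subrr expR0.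
- rewrite /jet_scale (@jet_periodizeE _ b sig sig1 b_out _ 0) ?subr0 ?normr0 //; last by lra.
  by rewrite /b flat_bump_critical mulr0.
- by move=> k x xz; rewrite /jet_scale (@jet_periodize_out _ b sig) ?mulr0.
Qed.

Lemma natr_le_expR (N : nat) : (0 < N)%N -> N%:R <= expR (s^-1 * N%:R `^ s) :> R.
Proof.
move=> N0; have n0 : 0 < N%:R :> R by rewrite ltr0n.
rewrite -[leLHS]lnK ?posrE // ler_expR -(ler_pM2l s0) mulrA mulfV ?gt_eqF // mul1r.
rewrite -ln_powR; have p0 : 0 < N%:R `^ s :> R by rewrite powR_gt0.
rewrite -ler_expR lnK ?posrE //.
by apply: le_trans (expR_ge1Dx _); rewrite lerDr.
Qed.

Lemma natr_powR_ge1 (N : nat) : (0 < N)%N -> 1 <= N%:R `^ s :> R.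
Proof. by move=> N0; rewrite -[leLHS](powRr0 N%:R) ler_powR ?ler1n // ltW. Qed.

(** An ascending step centred at [rho - sig] times a descending one centred at [rho + 3 * sig], both
    of half-width [sig = 1 / (4 N)]. The start from [B / 4] anticipates two doublings, one in the
    step and one in the product. *)
Lemma plateau_jet : exists2 c : R, 0 < c & forall (N : nat) (rho : R), (0 < N)%N ->
  exists D : nat -> R -> R,
    [/\ gevrey_jet alpha B (expR (c * N%:R `^ s)) D,
        forall k x, rho <= x <= rho + (2 * N%:R)^-1 -> D k x = (k == 0%N)%:R &
        forall k x, x <= rho - (2 * N%:R)^-1 \/ rho + N%:R^-1 <= x -> D k x = 0].
Proof.
have B4 : 0 < B / 4 by rewrite divr_gt0.
have [lam lam0 gF] := flat_jet_gevrey s0 B4.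
pose c1 := 2 * lam * 8 `^ s.
have c10 : 0 < c1 by rewrite !mulr_gt0 // powR_gt0.
(* [8 / B] comes from normalising the step, [c1] from its flatness, [s^-1] from
   [N <= exp (s^-1 N^s)]; the outer 2 counts the two steps. *)
pose c := 2 * (8 / B + (c1 + s^-1)).
exists c => [|N rho N0].
  rewrite mulr_gt0 // addr_gt0 ?divr_gt0 //.
  by rewrite addr_gt0 // invr_gt0.
have n0 : 0 < N%:R :> R by rewrite ltr0n.
pose sig : R := (4 * N%:R)^-1; have sig0 : 0 < sig by rewrite invr_gt0 mulr_gt0.
have [D] := flat_step s0 lam0 B4 gF sig0; set I := sig * _ => /=.
rewrite -alphaE; have -> : 2 * (B / 4) = B / 2 by field.
move=> [gD Dlo Dhi]; set M := 1 + _ in gD.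
have N1 := natr_powR_ge1 N0.
have I0 : 0 < I by rewrite mulr_gt0 ?expR_gt0.
have M0 : 0 <= M 
  by rewrite addr_ge0 // invr_ge0 mulr_ge0 ?(ltW I0) // divr_ge0 // ltW.
have sigE : (sig / 2) `^ (- s) = 8 `^ s * N%:R `^ s.
  have n8 : 0 <= 8 * N%:R :> R by rewrite mulr_ge0.
  have -> : sig / 2 = (8 * N%:R)^-1 by rewrite /sig; field; rewrite gt_eqF.
  by rewrite -powRM // -(powR_inv1 n8) -powRrM mulN1r opprK.
have Mle : M <= expR (c / 2 * N%:R `^ s).
  have IE : (B / 2 * I)^-1 = 8 / B * N%:R * expR (c1 * N%:R `^ s).
    rewrite /I sigE expRN /sig; have -> : 2 * lam * (8 `^ s * N%:R `^ s) = c1 * N%:R `^ s by rewrite /c1; ring.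
    by have := expR_gt0 (c1 * N%:R `^ s) => e0; field; rewrite !gt_eqF.
  have h1 : 1 + 8 / B * N%:R * expR (c1 * N%:R `^ s) <=
      (1 + 8 / B) * expR ((c1 + s^-1) * N%:R `^ s).
    pose Y := N%:R `^ s : R; rewrite -/Y; have Y0 : 0 <= Y by exact: powR_ge0.
    have -> : (1 + 8 / B) * expR ((c1 + s^-1) * Y) =
        expR (c1 * Y) * expR (s^-1 * Y) + 8 / B * expR (s^-1 * Y) * expR (c1 * Y).
      by rewrite (mulrDl c1) expRD; ring.
    apply: lerD.
      rewrite -expRD -[leLHS]expR0 ler_expR -mulrDl mulr_ge0 //.
      by rewrite addr_ge0 ?(ltW c10) // invr_ge0 ltW.
    apply: ler_wpM2r; first exact: expR_ge0.
    by apply: ler_wpM2l (natr_le_expR N0); rewrite divr_ge0 // ltW.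
  rewrite /M IE; apply: le_trans h1 _.
  have -> : c / 2 * N%:R `^ s = 8 / B * N%:R `^ s + (c1 + s^-1) * N%:R `^ s.
    by rewrite -mulrDl /c [2 * _]mulrC mulfK.
  rewrite expRD; apply: ler_wpM2r; first exact: expR_ge0.
  apply: le_trans (expR_ge1Dx _) _; rewrite ler_expR.
  by rewrite ler_peMr // divr_ge0 ?(ltW B0).
pose D1 := jet_shift (sig - rho) D.
pose D2 := jet_flip (jet_shift (rho + 3 * sig) D).
have B20 : 0 <= B / 2 by rewrite divr_ge0 ?(ltW B0).
have sE : (2 * N%:R)^-1 = 2 * sig by rewrite /sig; field; rewrite gt_eqF.
have sE4 : N%:R^-1 = 4 * sig by rewrite /sig; field; rewrite gt_eqF.
exists (jet_mul D1 D2); rewrite sE sE4; split.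
- have g1 : gevrey_jet alpha (B / 2) M D1 by exact: gevrey_jet_shift.
  have g2 : gevrey_jet alpha (B / 2) M D2.
    by apply: gevrey_jet_flip; exact: gevrey_jet_shift.
  have := gevrey_jet_mul (ltW alpha1) B20 g1 g2.
  have -> : 2 * (B / 2) = B by field.
  apply: gevrey_jetW; [exact: ltW|exact: lexx|].
  have -> : c * N%:R `^ s = c / 2 * N%:R `^ s + c / 2 * N%:R `^ s by field.
  by rewrite expRD; apply: ler_pM.
- move=> k x /andP[x1 x2]; rewrite /jet_mul.
  have d1 i : D1 i x = (i == 0%N)%:R by rewrite /D1 /jet_shift Dhi //; lra.
  have d2 i : D2 i x = (i == 0%N)%:R.
    rewrite /D2 /jet_flip /jet_shift Dhi; last by lra.
    by case: i => [|i]; rewrite ?expr0 ?mul1r ?mulr0.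
  rewrite /leibniz big_ord_recl big1 ?addr0 => [|i _]; last by rewrite d2 mulr0.
  by rewrite d1 d2 mulr1 bin0 mul1r subn0.
- move=> k x [xs|xs]; rewrite /jet_mul.
    by apply: leibniz0l => i; rewrite /D1 /jet_shift Dlo //; lra.
  by apply: leibniz0r => i; rewrite /D2 /jet_flip /jet_shift Dlo ?mulr0 //; lra.
Qed.

(** With [y ^ alpha] proportional to the frequency, [y ^ k <= k! exp y] raised to the power [alpha]
    gives the constant [exp (alpha * y)]; here [y] grows like [N ^ (1 / alpha)], which is at most
    [N ^ s]. *)
Lemma cos_jet : exists2 c : R, 0 < c & forall N : nat, (0 < N)%N ->
  exists D : nat -> R -> R,
    [/\ gevrey_jet alpha B (expR (c * N%:R `^ s)) D,
        forall k x z, z \is a Num.int -> D k (x + z) = D k x,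
        forall x, D 0%N x = cos (2 * pi * (N%:R * x)) &
        forall x, D 1%N x = - (2 * pi * N%:R) * sin (2 * pi * (N%:R * x))].
Proof.
have p0 : 0 < pi :> R by exact: pi_gt0.
have a0 : 0 < alpha by exact: lt_trans alpha1.
pose w := 2 * pi / B; have w0 : 0 < w by rewrite !mulr_gt0 // invr_gt0.
pose c := alpha * w `^ alpha^-1.
exists c => [|N N0]; first by rewrite mulr_gt0 // powR_gt0.
have n0 : 0 < N%:R :> R by rewrite ltr0n.
pose D k (x : R) : R := (2 * pi * N%:R) ^+ k *
  cos (2 * pi * (N%:R * x) + k%:R * (pi / 2)).
have W0 : 0 <= 2 * pi * N%:R :> R by rewrite !mulr_ge0 // ltW.
exists D; split.
- split=> [k x|k x].
    rewrite /D exprS; have -> : k.+1%:R * (pi / 2) = k%:R * (pi / 2) + pi / 2 :> R.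
      by rewrite [k.+1%:R]mulrSr; ring.
    rewrite addrA cosDpihalf.
    rewrite [X in is_derive _ _ _ X](_ : _ = (2 * pi * N%:R) ^+ k *
      (- sin (2 * pi * (N%:R * x) + k%:R * (pi / 2)) * (2 * pi * N%:R))); last by ring.
    apply: derive_scale.
    apply: (@derive_comp R cos (fun t => 2 * pi * (N%:R * t) + k%:R * (pi / 2))).
    under eq_fun do rewrite mulrA.
    exact: derive_affine.
  rewrite /D normrM (ger0_norm (exprn_ge0 k W0)).
  apply: (@le_trans _ _ ((2 * pi * N%:R) ^+ k)).
    by rewrite ler_piMr ?exprn_ge0 // cos_max.
  have -> : (2 * pi * N%:R) ^+ k = (w * N%:R) ^+ k * B ^+ k.
    by rewrite -exprMn; congr (_ ^+ _); rewrite /w; field; rewrite gt_eqF.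
  rewrite [leRHS]mulrAC; apply: ler_wpM2r; first by rewrite exprn_ge0 // ltW.
  have wN0 : 0 <= w * N%:R by rewrite mulr_ge0 // ltW.
  pose y := (w * N%:R) `^ alpha^-1.
  have y0 : 0 <= y by exact: powR_ge0.
  have -> : (w * N%:R) ^+ k = (y ^+ k) `^ alpha.
    rewrite -!powR_mulrn // /y -!powRrM; congr (_ `^ _).
    by field; rewrite gt_eqF.
  have H : (y ^+ k) `^ alpha <= (k`!%:R * expR y) `^ alpha.
    apply: ge0_ler_powR; rewrite ?nnegrE ?exprn_ge0 ?(ltW a0) //.
    exact: expR_ge_coeff.
  apply: le_trans H _; rewrite powRM ?expR_ge0 // -expRM mulrC.
  apply: ler_wpM2r; first exact: powR_ge0.
  rewrite ler_expR /c mulrC -mulrA; apply: ler_wpM2l; first exact: ltW.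
  rewrite /y powRM //; last exact: ltW.
  apply: ler_wpM2l; first exact: powR_ge0.
  apply: ler_powR; first by rewrite ler1n.
  by rewrite /s lef_pV2 ?posrE ?subr_gt0 //; have := alpha1; lra.
- move=> k x z zi; rewrite /D; congr (_ * _).
  have -> : 2 * pi * (N%:R * (x + z)) + k%:R * (pi / 2) =
     2 * pi * ((N%:R * x + k%:R / 4) + N%:R * z) by field.
  rewrite cos_turn; first by congr cos; field.
  by rewrite rpredM ?natr_int.
- by move=> x; rewrite /D expr0 mul1r mul0r addr0.
- move=> x; rewrite /D expr1 mul1r cosDpihalf; ring.
Qed.

End Profiles.

(** * Sums of tensor products *)

Definition sumr (R : realType) (a : nat -> R) : R := limn (series a).

Section Sumr.
Variables (R : realType) (c : nat -> R) (S : R).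
Hypothesis cS : forall n, \sum_(k < n) c k <= S.

Definition dominated (a : nat -> R) := exists2 w, 0 <= w & forall k, `|a k| <= c k * w.

Lemma dominated_cvg a : dominated a -> cvgn (series a).
Proof.
move=> [w w0 ac]; apply: normed_cvg; apply: nondecreasing_is_cvgn.
  by apply: nondecreasing_series => k _ _ /=.
exists (S * w) => _ [n _ <-]; have -> : [normed series a] n = \sum_(k < n) `|a k| by exact: big_mkord.
apply: le_trans (ler_wpM2r w0 (cS n)).
by rewrite mulr_suml; apply: ler_sum => i _; exact: ac.
Qed.

Lemma sumr_bound a w : 0 <= w -> (forall k, `|a k| <= c k * w) ->
  `|sumr a| <= S * w.
Proof.
move=> w0 ac; have ca : cvgn (series a) by apply: dominated_cvg; exists w.
have H n : `|series a n| <= S * w.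
  rewrite seriesEord; apply: le_trans (ler_norm_sum _ _ _) _.
  apply: le_trans (ler_wpM2r w0 (cS n)).
  by rewrite mulr_suml; apply: ler_sum => i _; exact: ac.
rewrite ler_norml /sumr; apply/andP; split.
  apply: limr_ge => //; near=> n.
  by have := H n; rewrite ler_norml => /andP[].
apply: limr_le => //; near=> n.
by have := H n; rewrite ler_norml => /andP[].
Unshelve. all: by end_near. Qed.

Lemma sumrD a b : dominated a -> dominated b ->
  sumr (fun k => a k + b k) = sumr a + sumr b.
Proof.
by move=> da db; exact: (lim_seriesD (dominated_cvg da) (dominated_cvg db)).
Qed.

Lemma sumrZ a h : dominated a -> sumr (fun k => h * a k) = h * sumr a.
Proof. by move=> da; rewrite /sumr -[RHS](lim_seriesZ h (dominated_cvg da)). Qed.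

Lemma dominatedD a b : dominated a -> dominated b ->
  dominated (fun k => a k + b k).
Proof.
move=> [w w0 aw] [z z0 bz]; exists (w + z) => [|k]; first exact: addr_ge0.
by rewrite mulrDr; apply: le_trans (ler_normD _ _) _; apply: lerD.
Qed.

Lemma dominatedZ a h : dominated a -> dominated (fun k => h * a k).
Proof.
move=> [w w0 aw]; exists (`|h| * w) => [|k]; first exact: mulr_ge0.
by rewrite normrM mulrCA ler_wpM2l.
Qed.

End Sumr.

Lemma sumr_single (R : realType) (a : nat -> R) (k0 : nat) :
  (forall k, k != k0 -> a k = 0) -> sumr a = a k0.
Proof.
move=> a0; rewrite /sumr; apply: cvg_lim => //; apply: cvg_near_cst.
near=> n; rewrite seriesEord.
have kn : (k0 < n)%N by near: n; exact: nbhs_infty_gt.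
rewrite /= (bigD1 (Ordinal kn)) //= big1 ?addr0 // => i ik.
by apply: a0; apply: contra ik => /eqP e; apply/eqP/val_inj.
Unshelve. all: by end_near. Qed.

Lemma sumr0 (R : realType) (a : nat -> R) : (forall k, a k = 0) -> sumr a = 0.
Proof. by move=> a0; rewrite (@sumr_single _ a 0%N) // a0. Qed.

Section JetTaylor.
Variables (R : realType) (D : nat -> R -> R).
Hypothesis jD : jet D.

Lemma jet_lipschitz k C : (forall x, `|D k.+1 x| <= C) ->
  forall x h, `|D k (h + x) - D k x| <= C * `|h|.
Proof.
move=> DC x h; have := derive_lipschitz (jD k) DC (h + x) x.
by rewrite addrK.
Qed.

Lemma jet_taylor k C : (forall x, `|D k.+2 x| <= C) ->
  forall x h, `|D k (h + x) - D k x - h * D k.+1 x| <= C * h ^+ 2.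
Proof.
move=> DC x h.
have C0 : 0 <= C by apply: le_trans (DC 0).
have main (c : R) : `|c - x| <= `|h| -> D k (h + x) - D k x = D k.+1 c * h ->
    `|D k (h + x) - D k x - h * D k.+1 x| <= C * h ^+ 2.
  move=> ch ->; rewrite [h * _]mulrC -mulrBl normrM.
  have := derive_lipschitz (jD k.+1) DC c x => H.
  rewrite -real_normK ?num_real // expr2 mulrA; apply: ler_wpM2r => //.
  by apply: le_trans H _; apply: ler_wpM2l.
have [h0|/ltW h0] := leP 0 h.
  have xh : x <= h + x by rewrite lerDr.
  have [c /andP[c1 c2]] := mean_value xh (fun z _ => jD k z).
  rewrite addrK => E; apply: (main c) => //.
  by rewrite (ger0_norm h0) ger0_norm; lra.
have xh : h + x <= x by rewrite gerDr.
have [c /andP[c1 c2]] := mean_value xh (fun z _ => jD k z) => E.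
apply: (main c); first by rewrite (ler0_norm h0) ler0_norm; lra.
by rewrite -[LHS]opprB E; ring.
Qed.

End JetTaylor.

(** The passage from [x] to [y] changes one coordinate at a time. *)
Lemma coord_lipschitz (R : realType) (N : nat) (G : 'rV[R]_N -> R) (C : R) :
  0 <= C ->
  (forall (x : 'rV[R]_N) i h, `|G (h *: delta_mx 0 i + x) - G x| <= C * `|h|) ->
  forall x y, `|G x - G y| <= N%:R * C * `|x - y|.
Proof.
move=> C0 GC x y.
pose z m : 'rV[R]_N := \row_i (if (i < m)%N then y 0 i else x 0 i).
have H m : (m <= N)%N -> `|G x - G (z m)| <= m%:R * C * `|x - y|.
  elim: m => [|m IH] mN.
    have -> : z 0%N = x by apply/rowP => i; rewrite mxE.
    by rewrite subrr normr0 !mul0r.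
  pose i := Ordinal mN.
  have E : z m.+1 = (y 0 i - x 0 i) *: delta_mx 0 i + z m.
    apply/rowP => j; rewrite !mxE ltnS leq_eqVlt eqxx /=.
    have [->|ji] := eqVneq j i; first by rewrite eqxx /= ltnn mulr1 subrK.
    have -> : (j == m :> nat) = false by apply/negbTE.
    by rewrite mulr0 add0r.
  apply: le_trans (ler_distD (G (z m)) _ _) _.
  rewrite [m.+1%:R]mulrSr !mulrDl mul1r; apply: lerD; first by apply: IH; exact: ltnW.
  rewrite E distrC; apply: le_trans (GC _ _ _) _; apply: ler_wpM2l => //.
  by rewrite distrC; have := rV_coord_le (x - y) i; rewrite !mxE.
have -> : y = z N by apply/rowP => i; rewrite mxE ltn_ord.
have := H N (leqnn N); congr (_ <= _ * `|_ - _|).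
by apply/rowP => i; rewrite mxE ltn_ord.
Qed.

Section TensorSum.
Variables (R : realType) (N : nat) (alpha B S : R).
Variables (F : nat -> 'I_N -> nat -> R -> R) (M : nat -> 'I_N -> R) (c : nat -> R).
Hypothesis B0 : 0 < B.
Hypothesis gF : forall k i, gevrey_jet alpha B (M k i) (F k i).
Hypothesis cM : forall k, \prod_(i < N) M k i <= c k.
Hypothesis cS : forall n, \sum_(k < n) c k <= S.
Implicit Types (l : 'I_N -> nat) (x : 'rV[R]_N).

Definition tensor k l x : R := \prod_(i < N) F k i (l i) (x 0 i).
(** For each order [l], the series of the [l]-th derivatives of the terms; it will turn out to be
    the [l]-th derivative of the sum. *)
Definition tensor_sum l x : R := sumr (fun k => tensor k l x).

Definition weight1 (j : nat) : R := B ^+ j * j`!%:R `^ alpha.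
Definition weight l : R := \prod_(i < N) weight1 (l i).
Definition incr i l : 'I_N -> nat := fun j => (l j + (j == i))%N.

Lemma weight1_ge0 j : 0 <= weight1 j.
Proof. by rewrite mulr_ge0 ?powR_ge0 // exprn_ge0 // ltW. Qed.

Lemma weight_ge0 l : 0 <= weight l.
Proof. by apply: prodr_ge0 => i _; exact: weight1_ge0. Qed.

Let M0 k i : 0 <= M k i. Proof. exact: gevrey_jet_ge0 (gF k i). Qed.

Lemma factor_bound k i j (t : R) : `|F k i j t| <= M k i * weight1 j.
Proof. by case: (gF k i) => _ /(_ j t); rewrite mulrA. Qed.

Lemma tensor_majorant k l (a : 'I_N -> R) :
  (forall i, `|a i| <= M k i * weight1 (l i)) ->
  `|\prod_(i < N) a i| <= c k * weight l.
Proof.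
move=> aM; rewrite normr_prod.
apply: le_trans (ler_wpM2r (weight_ge0 l) (cM k)).
rewrite -big_split /=; apply: ler_prod => i _; rewrite normr_ge0; exact: aM.
Qed.

Lemma tensor_bound k l x : `|tensor k l x| <= c k * weight l.
Proof. by apply: tensor_majorant => i; exact: factor_bound. Qed.

Lemma tensor_dominated l x : dominated c (fun k => tensor k l x).
Proof. by exists (weight l) => [|k]; [exact: weight_ge0|exact: tensor_bound]. Qed.

Lemma tensor_sum_bound l x : `|tensor_sum l x| <= S * weight l.
Proof. by apply: (sumr_bound cS (weight_ge0 l)) => k; exact: tensor_bound. Qed.

Let move_coord (x : 'rV[R]_N) i h j :
  (h *: delta_mx 0 i + x) 0 j = if j == i then h + x 0 i else x 0 j.
Proof.
rewrite !mxE eqxx /=; case: eqVneq => [->|_]; first by rewrite mulr1.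
by rewrite mulr0 add0r.
Qed.

Let tensorD1 k l x i :
  tensor k l x = F k i (l i) (x 0 i) * \prod_(j < N | j != i) F k j (l j) (x 0 j).
Proof. by rewrite /tensor (bigD1 i). Qed.

Let tensor_moved k l x i h : tensor k l (h *: delta_mx 0 i + x) =
  F k i (l i) (h + x 0 i) * \prod_(j < N | j != i) F k j (l j) (x 0 j).
Proof.
rewrite (tensorD1 _ _ _ i) move_coord eqxx; congr (_ * _).
by apply: eq_bigr => j ji; rewrite move_coord (negbTE ji).
Qed.

Let tensor_incr k l x i : tensor k (incr i l) x =
  F k i (l i).+1 (x 0 i) * \prod_(j < N | j != i) F k j (l j) (x 0 j).
Proof.
rewrite (tensorD1 _ _ _ i) /incr eqxx addn1; congr (_ * _).
by apply: eq_bigr => j ji; rewrite (negbTE ji) addn0.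
Qed.

(** Moving one coordinate changes one factor only: [a] stands for its increment or Taylor remainder,
    and [l'] raises its order by the number of derivatives spent. *)
Let replaced_bound k l l' x i (a K : R) : 0 <= K ->
  (forall j, j != i -> l' j = l j) -> `|a| <= M k i * weight1 (l' i) * K ->
  `|a * \prod_(j < N | j != i) F k j (l j) (x 0 j)| <= c k * (weight l' * K).
Proof.
move=> K0 ll aK; rewrite mulrA normrM normr_prod.
apply: (@le_trans _ _ ((M k i * weight1 (l' i) * K) *
    \prod_(j < N | j != i) (M k j * weight1 (l' j)))).
  apply: ler_pM => //; first by apply: prodr_ge0.
  by apply: ler_prod => j ji; rewrite normr_ge0 ll //=; exact: factor_bound.
rewrite mulrAC; apply: ler_wpM2r => //.
rewrite -(bigD1 i (P := xpredT) (F := fun j => M k j * weight1 (l' j))) //=.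
apply: le_trans (ler_wpM2r (weight_ge0 l') (cM k)).
by rewrite -big_split.
Qed.

Lemma tensor_sum_lipschitz1 l x i h :
  `|tensor_sum l (h *: delta_mx 0 i + x) - tensor_sum l x| <=
  S * weight (incr i l) * `|h|.
Proof.
have -> : tensor_sum l (h *: delta_mx 0 i + x) - tensor_sum l x =
    sumr (fun k => tensor k l (h *: delta_mx 0 i + x) + -1 * tensor k l x).
  have d y := tensor_dominated l y; have dN := dominatedZ (-1) (d x).
  by rewrite (sumrD cS (d _) dN) (sumrZ cS (-1) (d x)) mulN1r.
rewrite -mulrA; apply: (sumr_bound cS) => [|k].
  by rewrite mulr_ge0 ?weight_ge0.
rewrite mulN1r tensor_moved (tensorD1 _ _ _ i) -mulrBl.
apply: replaced_bound => // [j ji|]; first by rewrite /incr (negbTE ji) addn0.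
apply: jet_lipschitz => [|y]; first by case: (gF k i).
by rewrite /incr eqxx addn1; exact: factor_bound.
Qed.

(** Each term has a Taylor remainder bounded through two further derivatives in direction [i]; these
    bounds are summable, so the remainder of the sum is quadratic as well. *)
Lemma tensor_sum_derive l x i :
  is_derive x (delta_mx 0 i) (tensor_sum l) (tensor_sum (incr i l) x).
Proof.
apply: (@is_derive_quadratic _ _ _ _ _ _ (S * weight (incr i (incr i l)))) => h.
have -> : tensor_sum l (h *: delta_mx 0 i + x) - tensor_sum l x -
      h * tensor_sum (incr i l) x =
    sumr (fun k => tensor k l (h *: delta_mx 0 i + x) +
      (-1 * tensor k l x + (- h) * tensor k (incr i l) x)).
  have d := tensor_dominated; have d1 := dominatedZ (-1) (d l x).
  have d2 := dominatedZ (- h) (d (incr i l) x).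
  rewrite (sumrD cS (d _ _) (dominatedD d1 d2)) (sumrD cS d1 d2).
  by rewrite (sumrZ cS (-1) (d l x)) (sumrZ cS (- h) (d (incr i l) x)) mulN1r mulNr addrA.
rewrite -mulrA; apply: (sumr_bound cS) => [|k].
  by rewrite mulr_ge0 ?weight_ge0 ?sqr_ge0.
rewrite tensor_incr tensor_moved (tensorD1 _ _ _ i).
set P := \prod_(_ < _ | _) _.
have -> : F k i (l i) (h + x 0 i) * P + (-1 * (F k i (l i) (x 0 i) * P) +
     - h * (F k i (l i).+1 (x 0 i) * P)) =
  (F k i (l i) (h + x 0 i) - F k i (l i) (x 0 i) - h * F k i (l i).+1 (x 0 i)) * P.
  by ring.
apply: replaced_bound; first exact: sqr_ge0.
  by move=> j ji; rewrite /incr (negbTE ji) !addn0.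
apply: jet_taylor => [|y]; first by case: (gF k i).
by rewrite /incr eqxx !addn1; exact: factor_bound.
Qed.

Lemma partial_tensor_sum l i : partial i (tensor_sum l) = tensor_sum (incr i l).
Proof. by apply/funext => x; rewrite /partial; case: (tensor_sum_derive l x i). Qed.

Lemma tensor_sum_lipschitz l : exists2 C : R, 0 <= C &
  forall x y, `|tensor_sum l x - tensor_sum l y| <= C * `|x - y|.
Proof.
have S0 : 0 <= S by have := cS 0; rewrite big_ord0.
pose C := \sum_(i < N) S * weight (incr i l).
have C0 : 0 <= C by apply: sumr_ge0 => i _; rewrite mulr_ge0 ?weight_ge0.
exists (N%:R * C) => [|x y]; first by rewrite mulr_ge0.
apply: coord_lipschitz => // {x y} x i h.
apply: le_trans (tensor_sum_lipschitz1 l x i h) _; apply: ler_wpM2r => //.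
rewrite /C (bigD1 i) //= lerDl; apply: sumr_ge0 => j _.
by rewrite mulr_ge0 ?weight_ge0.
Qed.

Lemma tensor_sum_continuous l : continuous (tensor_sum l).
Proof.
have [C _ CL] := tensor_sum_lipschitz l.
exact: lipschitz_continuous CL.
Qed.

Lemma iter_partial_tensor_sum (s : seq 'I_N) :
  iter_partial s (tensor_sum (fun=> 0%N)) = tensor_sum (fun i => count_mem i s).
Proof.
elim: s => [//|i s IH]; rewrite /= IH partial_tensor_sum; congr tensor_sum.
by apply/funext => j; rewrite /incr /= addnC eq_sym.
Qed.

Lemma mpartial_tensor_sum (l : multi_index N) :
  mpartial l (tensor_sum (fun=> 0%N)) = tensor_sum l.
Proof.
rewrite /mpartial iter_partial_tensor_sum; congr tensor_sum; apply/funext => i.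
rewrite count_flatten -map_comp sumnE big_map big_enum /= (bigD1 i) //= count_nseq /=.
rewrite eqxx mul1n big1 ?addn0 // => j ji.
by rewrite count_nseq /= (negbTE ji).
Qed.

Lemma tensor_sum_smooth : smooth (tensor_sum (fun=> 0%N)).
Proof.
move=> s; rewrite iter_partial_tensor_sum; split.
  exact: tensor_sum_continuous.
by move=> i x; case: (tensor_sum_derive (fun i => count_mem i s) x i).
Qed.

End TensorSum.

(** * The Gevrey norm of a tensor sum *)

Lemma powR_prod (R : realType) (I : finType) (f : I -> R) (a : R) :
  (forall i, 0 <= f i) -> (\prod_i f i) `^ a = \prod_i (f i) `^ a.
Proof.
move=> f0; have [] : 0 <= \prod_i f i /\ (\prod_i f i) `^ a = \prod_i (f i) `^ a => //.
apply: (big_ind2 (fun x y => 0 <= x /\ x `^ a = y)) => [|x1 x2 y1 y2 [x10 <-] [y10 <-]|i _].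
- by rewrite powR1.
- by rewrite mulr_ge0 ?powRM.
- by rewrite f0.
Qed.

Lemma sum_half_pow (R : realType) (m : nat) : \sum_(j < m) 2^-1 ^+ j <= 2 :> R.
Proof.
have -> : \sum_(j < m) 2^-1 ^+ j = 2 - 2 * 2^-1 ^+ m :> R.
  elim: m => [|m IH]; first by rewrite big_ord0 expr0 mulr1 subrr.
  by rewrite big_ord_recr /= IH exprS; field.
by rewrite gerBl mulr_ge0 // exprn_ge0 // invr_ge0.
Qed.

Lemma sum_multi_index_box (R : realType) (N m : nat) :
  \sum_(g : {ffun 'I_N -> 'I_m}) \prod_(i < N) 2^-1 ^+ (g i) <= 2 ^+ N :> R.
Proof.
rewrite -(bigA_distr_bigA (fun (i : 'I_N) (j : 'I_m) => 2^-1 ^+ j)) /=.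
rewrite prodr_const card_ord lerXn2r ?nnegrE //; last exact: sum_half_pow.
by apply: sumr_ge0 => i _; rewrite exprn_ge0 // invr_ge0.
Qed.

Lemma sum_uniq_image_le (R : realType) (I : finType) (T : eqType) (h : I -> T)
    (f : T -> R) (s : seq T) : uniq s -> (forall x, 0 <= f x) ->
  (forall x, x \in s -> exists i, h i = x) ->
  \sum_(x <- s) f x <= \sum_(i : I) f (h i).
Proof.
move=> us f0 hs.
have -> : \sum_(x <- s) f x = \sum_(x <- undup (map h (enum I)) | x \in s) f x.
  rewrite -[RHS]big_filter; apply: perm_big; apply: uniq_perm => //.
    by rewrite filter_uniq // undup_uniq.
  move=> x; rewrite mem_filter mem_undup; case xs : (x \in s) => //=.
  have [i <-] := hs x xs; apply/esym/mapP; exists i => //.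
  by rewrite mem_enum.
have -> : \sum_(i : I) f (h i) = \sum_(x <- map h (enum I)) f x.
  by rewrite big_map big_enum.
rewrite big_mkcond /=.
apply: (@le_trans _ _ (\sum_(x <- undup (map h (enum I))) f x)).
  by apply: ler_sum => x _; case: ifP.
elim: (map h (enum I)) => [|x r IH]; first by rewrite !big_nil.
rewrite /= [leRHS]big_cons; case: ifP => _; first by rewrite ler_wpDl.
by rewrite big_cons lerD2l.
Qed.

(** A finite set of multi-indices lies in a box, over which the sum of products is a product of [N]
    partial geometric series, each at most 2. *)
Lemma esum_multi_index (R : realType) (N : nat) (S : R) : 0 <= S ->
  (\esum_(l in [set: multi_index N]) (S * \prod_(i < N) 2^-1 ^+ (l i))%:E <=
   (S * 2 ^+ N)%:E)%E.
Proof.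
move=> S0; apply: ge_ereal_sup => _ [A [finA _] <-].
rewrite fsbig_finite //= sumEFin lee_fin -mulr_sumr ler_wpM2l //.
pose m := (\max_(l <- finmap.enum_fset (fset_set A)) \max_(i < N) (l i)).+1.
pose h (g : {ffun 'I_N -> 'I_m}) : multi_index N := [ffun i => val (g i)].
apply: le_trans (sum_multi_index_box R N m).
have -> : \sum_(g : {ffun 'I_N -> 'I_m}) \prod_(i < N) 2^-1 ^+ (g i) =
   \sum_(g : {ffun 'I_N -> 'I_m}) \prod_(i < N) 2^-1 ^+ (h g i) :> R.
  by apply: eq_bigr => g _; apply: eq_bigr => i _; rewrite ffunE.
apply: (sum_uniq_image_le (h := h) (f := fun l : multi_index N => \prod_(i < N) 2^-1 ^+ (l i))).
- exact: finmap.fset_uniq.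
- by move=> l; apply: prodr_ge0 => i _; rewrite exprn_ge0 // invr_ge0.
- move=> l lA; have lm i : (l i < m)%N.
    rewrite ltnS; apply: leq_trans (leq_bigmax_seq _ lA _) => //.
    exact: leq_bigmax.
  by exists [ffun i => Ordinal (lm i)]; apply/ffunP => i; rewrite !ffunE.
Qed.

(** With this [B], the weight in the norm times the bound on the [l]-th derivative is [S] times the
    product of the [2 ^ (- l_i)]. *)
Lemma gevrey_norm_tensor_sum (R : realType) (N : nat) (D : Type)
    (p : 'rV[R]_N -> D) (alpha L S : R) (f : D -> R)
    (F : nat -> 'I_N -> nat -> R -> R) (M : nat -> 'I_N -> R) (c : nat -> R) :
  0 < L -> let B := (2 * L `^ alpha)^-1 in
  (forall k i, gevrey_jet alpha B (M k i) (F k i)) ->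
  (forall k, \prod_(i < N) M k i <= c k) ->
  (forall n, \sum_(k < n) c k <= S) ->
  f \o p = tensor_sum F (fun=> 0%N) ->
  (gevrey_norm p alpha L f <= (S * 2 ^+ N)%:E)%E.
Proof.
move=> L0 B gF cM cS fE.
have La : 0 < L `^ alpha by rewrite powR_gt0.
have B0 : 0 < B by rewrite invr_gt0 mulr_gt0.
have S0 : 0 <= S by have := cS 0; rewrite big_ord0.
apply: le_trans (esum_multi_index N S0); apply: le_esum => l _.
rewrite fE (mpartial_tensor_sum B0 gF cM cS).
have sup_le : (sup_norm (tensor_sum F l) <= (S * weight alpha B l)%:E)%E.
  apply: ge_ereal_sup => _ [x _ <-]; rewrite lee_fin.
  exact: (tensor_sum_bound B0 gF cM cS).
have a0 : 0 <= L `^ ((mi_size l)%:R * alpha) / (mi_fact l)%:R `^ alpha.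
  by rewrite divr_ge0 ?powR_ge0.
apply: le_trans (lee_wpmul2l _ sup_le) _; first by rewrite lee_fin.
rewrite -EFinM lee_fin.
have -> : L `^ ((mi_size l)%:R * alpha) = \prod_(i < N) (L `^ alpha) ^+ (l i).
  by rewrite mulrC powRrM powR_mulrn ?powR_ge0 // /mi_size -expr_sum.
have -> : (mi_fact l)%:R `^ alpha = \prod_(i < N) (l i)`!%:R `^ alpha :> R.
  by rewrite /mi_fact natr_prod powR_prod.
rewrite -prodf_div mulrCA /weight -big_split /=.
rewrite le_eqVlt; apply/orP; left; apply/eqP; congr (_ * _).
apply: eq_bigr => i _; rewrite /weight1.
have f0 : (l i)`!%:R `^ alpha != 0 :> R by rewrite gt_eqF // fact_powR_gt0.
have -> : 2^-1 = L `^ alpha * B by rewrite /B; field; rewrite gt_eqF.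
by rewrite exprMn; field.
Qed.

(** * Hamiltonian flows on the phase space *)

Definition annulus_repr (R : realType) (z : annulus R) : 'rV[R]_2 :=
  \row_(j < 2) [:: repr z.1; z.2]`_j.

Definition phase_repr (R : realType) (z : phase_space R) : 'rV[R]_4 :=
  \row_(j < 4) [:: repr z.1.1; z.1.2; repr z.2.1; z.2.2]`_j.

Section Covering.
Variable R : realType.

Lemma to_circle_repr (a : circle R) : to_circle (repr a) = a.
Proof. exact: reprK. Qed.

Lemma annulus_reprK (z : annulus R) : annulus_cover (annulus_repr z) = z.
Proof. by rewrite /annulus_cover !mxE /= to_circle_repr; case: z => a b. Qed.

Lemma phase_reprK (z : phase_space R) : phase_cover (phase_repr z) = z.
Proof. by rewrite /phase_cover !mxE /= !to_circle_repr; case: z => [[a b] [d e]]. Qed.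

Definition phase_lattice (v : 'rV[R]_4) : Prop :=
  [/\ v 0 0 \is a Num.int, v 0 1 = 0, v 0 2 \is a Num.int & v 0 3 = 0].

Lemma phase_cover_eq (x y : 'rV[R]_4) :
  phase_cover x = phase_cover y <-> phase_lattice (x - y).
Proof.
rewrite /phase_cover /phase_lattice !mxE; split.
  by move=> [/to_circleP ? -> /to_circleP ? ->]; split=> //; rewrite subrr.
move=> [/to_circleP -> /eqP + /to_circleP -> /eqP].
by rewrite !subr_eq0 => /eqP -> /eqP ->.
Qed.

Lemma phase_cover_add (x v : 'rV[R]_4) : phase_lattice v ->
  phase_cover (x + v) = phase_cover x.
Proof. by move=> lv; apply/phase_cover_eq; rewrite addrAC subrr add0r. Qed.

Lemma annulus_descend (G : 'rV[R]_2 -> R) :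
  (forall x y : 'rV[R]_2, x 0 0 - y 0 0 \is a Num.int -> x 0 1 = y 0 1 -> G x = G y) ->
  (fun z => G (annulus_repr z)) \o @annulus_cover R = G.
Proof.
move=> Gper; apply/funext => x /=; have := annulus_reprK (annulus_cover x).
rewrite {1 3}/annulus_cover => -[/to_circleP e0 e1].
exact: Gper.
Qed.

Lemma phase_descend (G : 'rV[R]_4 -> R) :
  (forall x v, phase_lattice v -> G (x + v) = G x) ->
  (fun z => G (phase_repr z)) \o @phase_cover R = G.
Proof.
move=> Gper; apply/funext => x /=.
have /phase_cover_eq/(Gper x) := phase_reprK (phase_cover x).
by rewrite addrC subrK.
Qed.

End Covering.

Section HamiltonianFlow.
Variables (R : realType) (H : phase_space R -> R) (M Lam : R).
Let G := H \o @phase_cover R.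
Let X := ham_field G.
Hypothesis XM : forall x i, `|X x 0 i| <= M.
Hypothesis Lam0 : 0 < Lam.
Hypothesis XL : forall x y, `|X x - X y| <= Lam * `|x - y|.

Let X_lattice x v : phase_lattice v -> X (x + v) = X x.
Proof.
move=> lv; have P i : partial i G (x + v) = partial i G x.
  have GE y : G (y + v) = G y by rewrite /G /= phase_cover_add.
  rewrite /partial /derive; set f := (X in lim (X @ _)); set g := (X in _ = lim (X @ _)).
  suff -> : f = g by [].
  by apply/funext => h; rewrite /f /g /= addrA !GE.
by rewrite /X /ham_field !P.
Qed.

(** The equation is solved upstairs from one chosen representative. Since the field is invariant
    under the lattice, the translated curve is a solution through any other lift. *)
Lemma time_one_map_exists : exists2 Phi, is_time_one_map H Phi &
  forall x, (forall t, 0 <= t <= 1 -> X (x + t *: X x) = X x) ->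
    Phi (phase_cover x) = phase_cover (x + X x).
Proof.
have /choice[c cP] := picard_lindelof XM Lam0 XL.
pose phi t z := phase_cover (c (phase_repr z) t).
exists (phi 1) => [|x line].
  exists phi => // x; pose x0 := phase_repr (phase_cover x); pose v := x - x0.
  have lv : phase_lattice v by apply/phase_cover_eq; rewrite phase_reprK.
  have [c0 dc _] := cP x0; exists (fun t => c x0 t + v); split.
  - by rewrite c0 addrC subrK.
  - move=> t; rewrite -/G -/X (X_lattice _ lv) -[X in is_derive _ _ _ X]addr0.
    exact: is_deriveD (dc t) (is_derive_cst v t 1).
  - by move=> t; rewrite phase_cover_add.
pose x0 := phase_repr (phase_cover x); pose v := x0 - x.
have lv : phase_lattice v by apply/phase_cover_eq; rewrite phase_reprK.
have x0E : x0 = x + v by rewrite addrC subrK.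
rewrite /phi -/x0; have [_ _ ->] := cP x0.
  by rewrite x0E (X_lattice _ lv) [x + v + _]addrAC (phase_cover_add _ lv).
by move=> t t01; rewrite x0E (X_lattice _ lv) [x + v + _]addrAC (X_lattice _ lv) line.
Qed.

End HamiltonianFlow.

(** * The drifting orbit *)

Section Distance.
Variable R : realType.

Lemma circle_dist_le (x y : R) : circle_dist (to_circle x) (to_circle y) <= `|x - y|.
Proof.
apply: ge_inf; last by exists x, y.
by exists 0 => _ [? [? [_ _ ->]]].
Qed.

Lemma circle_dist_ge0 (a b : circle R) : 0 <= circle_dist a b.
Proof.
apply: lb_le_inf.
  by exists `|repr a - repr b|, (repr a), (repr b); rewrite !to_circle_repr.
by move=> _ [? [? [_ _ ->]]].
Qed.

Lemma phase_dist_ge (z w : phase_space R) : `|z.2.2 - w.2.2| <= phase_dist z w.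
Proof.
rewrite -sqrtr_sqr /phase_dist ler_sqrt.
  by rewrite lerDr !addr_ge0 ?sqr_ge0.
by rewrite !addr_ge0 ?sqr_ge0.
Qed.

Lemma phase_dist_le (x y : 'rV[R]_4) (d : R) : 0 <= d ->
  (x 0 0 - y 0 0) ^+ 2 + (x 0 1 - y 0 1) ^+ 2 +
  (x 0 2 - y 0 2) ^+ 2 + (x 0 3 - y 0 3) ^+ 2 <= d ^+ 2 ->
  phase_dist (phase_cover x) (phase_cover y) <= d.
Proof.
move=> d0 H; rewrite -(ger0_norm d0) -sqrtr_sqr /phase_dist ler_sqrt ?sqr_ge0 //=.
have sq (a b : R) : circle_dist (to_circle a) (to_circle b) ^+ 2 <= (a - b) ^+ 2.
  rewrite -[leRHS]real_normK ?num_real // ler_pXn2r ?nnegrE //.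
    exact: circle_dist_le.
  exact: circle_dist_ge0.
by apply: le_trans H; rewrite !lerD.
Qed.

End Distance.

Definition row4 (R : realType) (a b d e : R) : 'rV[R]_4 := \row_(j < 4) [:: a; b; d; e]`_j.

Section Drift.
Variables (R : realType) (omega : R * R) (N n : nat) (K rho : R) (p : int).
Hypotheses (N0 : (0 < N)%N) (n0 : (0 < n)%N) (Nn : (N %| n)%N).
Hypotheses (K0 : 0 < K) (K1 : K <= 2^-1).
Hypothesis rhoE : omega.1 + rho = p%:~R / N%:R.
Hypotheses (rho0 : 0 <= rho) (rho1 : rho <= 2 / N%:R).
(** Up to integers, [N * theta_1] follows the lift [X] of the standard orbit. Since [N] divides [n],
    the rotation by [p / N] closes up after the [2 n] steps of a turn, and [theta_1] meets an
    integer only after a multiple of [N] turns. *)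
Let q := (n.*2 * N)%N.
Let plateau (r : R) := rho <= r <= rho + (2 * N%:R)^-1.
Variables Phi_u Phi_v : phase_space R -> phase_space R.
Hypothesis Phi_uE : forall t1 r1 t2 r2 : R,
  let r1' := r1 - K / N%:R * sin (2 * pi * (N%:R * t1)) in
  plateau r1 -> plateau r1' ->
  Phi_u (phase_cover (row4 t1 r1 t2 r2)) = phase_cover (row4 t1 r1' t2 r2).
Hypothesis Phi_v_far : forall t1 r1 t2 r2 : R, plateau r1 ->
  (forall z : R, z \is a Num.int -> K / (2 * N%:R) <= `|t1 - z|) ->
  Phi_v (phase_cover (row4 t1 r1 t2 r2)) = phase_cover (row4 t1 r1 t2 r2).
Hypothesis Phi_v_near : forall t1 r1 t2 r2 : R, plateau r1 -> t1 \is a Num.int ->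
  Phi_v (phase_cover (row4 t1 r1 t2 r2)) =
  phase_cover (row4 t1 r1 t2 (r2 + q%:R^-1 * sin (2 * pi * (N%:R * t2)))).
Let T := Phi_v \o Phi_u \o T0 omega.

Let nr0 : 0 < N%:R :> R. Proof. by rewrite ltr0n. Qed.
Let q0 : (0 < q)%N. Proof. by rewrite muln_gt0 double_gt0 n0 N0. Qed.
Let qr0 : 0 < q%:R :> R. Proof. by rewrite ltr0n. Qed.

Section Orbit.
Variables (X : nat -> R) (m i : int).
Hypothesis X_turn : forall i, X (i * n.*2)%N = i%:R.
Hypothesis X_step : forall j, X j <= X j.+1 <= X j + 2^-1.
Hypothesis X_eq : forall j,
  X j.+2 - 2 * X j.+1 + X j = - K * sin (2 * pi * X j.+1).
Hypothesis X_far : forall j, ~~ (n.*2 %| j)%N ->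
  exists i : nat, K / 2 <= X j - i%:R <= 1 - K / 2.

Let theta j : R := (X j + j%:R * p%:~R) / N%:R.
Let r j : R := rho + (X j.+1 - X j) / N%:R.
(** The frequency [omega_2 + r_2], constant during a period and equal to an integer over [q]. A full
    period advances [theta_2] by an integer, which [theta2] discards through [j %% q]; hence at
    every kick [N * theta_2] is 1/4 modulo 1, where the sine is 1. *)
Let slope j : R := (m%:~R + (j %/ q)%:R) / q%:R.
Let theta2 j : R := (4^-1 + i%:~R) / N%:R + (j %% q)%:R * slope j.
Let r2 j : R := slope j - omega.2.

Definition drift_orbit j : phase_space R :=
  phase_cover (row4 (theta j) (r j) (theta2 j) (r2 j)).

Let N_theta j : N%:R * theta j = X j + j%:R * p%:~R.
Proof. by rewrite /theta mulrC divfK // gt_eqF. Qed.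

Let nat_int (k : nat) : k%:R \is a @Num.int R. Proof. exact: natr_int. Qed.
Let int_int (k : int) : k%:~R \is a @Num.int R. Proof. exact: intr_int. Qed.

Let r_plateau j : plateau (r j).
Proof.
have /andP[x1 x2] := X_step j; rewrite /plateau /r invfM; apply/andP; split.
  by rewrite lerDl divr_ge0 ?subr_ge0.
by rewrite lerD2l ler_pM2r ?invr_gt0 //; lra.
Qed.

Let theta_int k : theta (k * q)%N \is a Num.int.
Proof.
rewrite /theta; have -> : (k * q = (k * N) * n.*2)%N by rewrite /q; lia.
rewrite X_turn; have -> : ((k * N)%:R + (k * N * n.*2)%:R * p%:~R) / N%:R =
   k%:R + (k * n.*2)%:R * p%:~R :> R.
  by rewrite !natrM; field; rewrite gt_eqF.
by rewrite rpredD // rpredM.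
Qed.

(** Measured on [N * theta_1]: off the turning times [X] stays [K / 2] away from the integers. At a
    turning time that is not a multiple of [q], [N * theta_1] is an integer not divisible by [N], so
    it is at distance at least 1 from [N * z]. *)
Let theta_far j (z : R) : ~~ (q %| j)%N -> z \is a Num.int ->
  K / (2 * N%:R) <= `|theta j - z|.
Proof.
move=> qj zi; have k0 := K0; have k1 := K1.
suff H : K / 2 <= `|N%:R * theta j - N%:R * z|.
  rewrite -(ler_pM2l nr0) -[X in X * `|_|](ger0_norm (ltW nr0)) -normrM mulrBr.
  by apply: le_trans H; rewrite le_eqVlt; apply/orP; left; apply/eqP; field; rewrite gt_eqF.
rewrite N_theta.
have [dj|/X_far[i' /andP[h1 h2]]] := boolP (n.*2 %| j)%N; last first.
  pose w : R := N%:R * z - j%:R * p%:~R - i'%:R.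
  have wi : w \is a Num.int by rewrite !rpredB // rpredM.
  have -> : X j + j%:R * p%:~R - N%:R * z = (X j - i'%:R) - w by rewrite /w; ring.
  have [w1|w1] := leP w 0.
    by rewrite ger0_norm; lra.
  have : 1 <= `|w| by apply: norm_intr_ge1 => //; rewrite gt_eqF.
  rewrite (ger0_norm (ltW w1)) => w2.
  by rewrite ler0_norm; lra.
case/dvdnP: dj qj => k -> qk; rewrite X_turn.
have [n' nE] := dvdnP Nn.
pose w : R := z - (k * n' * 2)%:R * p%:~R.
have wi : w \is a Num.int by rewrite rpredB // rpredM.
have -> : k%:R + (k * n.*2)%:R * p%:~R - N%:R * z = k%:R - N%:R * w.
  by rewrite /w nE -muln2 !natrM; ring.
have ki : k%:R - N%:R * w \is a Num.int by rewrite rpredB // rpredM.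
have : k%:R - N%:R * w != 0.
  apply: contra qk => /eqP; case/intrP: wi => w' ->.
  move/eqP; rewrite subr_eq0 => /eqP kw.
  have : k = (N%:Z * w') :> int.
    by apply: (@intr_inj R); rewrite rmorphM /= -!pmulrn.
  move=> kz; rewrite /q [(k * _)%N]mulnC dvdn_pmul2l ?double_gt0 //.
  apply/dvdnP; exists (absz w'); rewrite mulnC -[LHS](absz_nat k) kz abszM.
  by rewrite absz_nat.
move=> /(norm_intr_ge1 ki); lra.
Qed.

Lemma drift_orbit_step j : T (drift_orbit j) = drift_orbit j.+1.
Proof.
have qn : q%:R != 0 :> R by rewrite gt_eqF.
rewrite /T /=.
have -> : T0 omega (drift_orbit j) =
    phase_cover (row4 (theta j.+1) (r j) (theta2 j + slope j) (r2 j)).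
  rewrite /T0 /drift_orbit /phase_cover !mxE /= -!to_circleD.
  congr ((to_circle _, _), (to_circle _, _)).
    (* The resonance enters here: [omega_1 + r_1] is [p / N] plus the increment of [X] divided by
       [N]. *)
    rewrite /r; have -> : rho = p%:~R / N%:R - omega.1 by rewrite -rhoE; ring.
    by rewrite /theta [j.+1%:R]mulrSr; field; rewrite gt_eqF.
  by rewrite /r2; ring.
have rE : r j - K / N%:R * sin (2 * pi * (N%:R * theta j.+1)) = r j.+1.
  rewrite N_theta sin_turn ?rpredM // /r.
  have -> : K / N%:R * sin (2 * pi * X j.+1) = (K * sin (2 * pi * X j.+1)) / N%:R by ring.
  have -> : K * sin (2 * pi * X j.+1) = - (X j.+2 - 2 * X j.+1 + X j) by have := X_eq j; lra.
  by field; rewrite gt_eqF.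
rewrite Phi_uE ?rE ?r_plateau //.
have [/dvdnP[k jk]|qj] := boolP (q %| j.+1)%N; last first.
  rewrite Phi_v_far ?r_plateau //; last by move=> z; exact: theta_far.
  have [e1 e2] : (j.+1 %/ q = j %/ q)%N /\ (j.+1 %% q = (j %% q).+1)%N.
    have := divn_eq j q; have := ltn_pmod j q0 => h1 h2.
    have h3 : ((j %% q).+1 < q)%N.
      rewrite ltn_neqAle h1 andbT; apply: contra qj => /eqP e.
      by rewrite h2 -addnS e -mulSnr dvdn_mull.
    move: (j %/ q)%N (j %% q)%N h1 h2 h3 => a b h1 -> h3.
    by rewrite -addnS divnMDl // modnMDl divn_small // modn_small // addn0.
  rewrite /drift_orbit /theta2 /r2 /slope e1 e2; congr (phase_cover (row4 _ _ _ _)).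
  by rewrite [(_.+1)%:R]mulrSr; ring.
have k0 : (0 < k)%N by case: k jk.
have [e1 [e2 [e3 e4]]] : [/\ (j %/ q).+1 = k, (j %% q).+1 = q, j.+1 %/ q = k & j.+1 %% q = 0]%N.
  have -> : (j = k.-1 * q + q.-1)%N by nia.
  have qq : (q.-1 < q)%N by rewrite prednK.
  rewrite divnMDl // modnMDl divn_small // modn_small // addn0 !prednK //.
  by rewrite -addnS prednK // -mulSnr prednK // mulnK // modnMl.
rewrite Phi_v_near ?r_plateau ?jk ?theta_int //.
have jq : (j %% q)%:R + 1 = q%:R :> R by rewrite -mulrSr e2.
have jk' : (j %/ q)%:R + 1 = k%:R :> R by rewrite -mulrSr e1.
have th2 : theta2 j + slope j =
    (4^-1 + i%:~R) / N%:R + (m%:~R + (j %/ q)%:R).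
  rewrite /theta2 -addrA -{2}[slope j]mul1r -mulrDl jq /slope.
  by rewrite [q%:R * _]mulrC divfK.
have -> : sin (2 * pi * (N%:R * (theta2 j + slope j))) = 1.
  have -> : N%:R * (theta2 j + slope j) =
      4^-1 + (i%:~R + N%:R * (m%:~R + (j %/ q)%:R)).
    by rewrite th2; field; rewrite gt_eqF.
  rewrite sin_turn; last by rewrite rpredD // rpredM // rpredD.
  by rewrite -[RHS](@sin_pihalf R); congr sin; field.
rewrite mulr1 /drift_orbit -jk; apply/phase_cover_eq; rewrite /phase_lattice !mxE /=.
split; rewrite ?subrr ?rpred0 //.
  rewrite th2 /theta2 e4 mul0r addr0 addrAC subrr add0r.
  by rewrite rpredD.
by rewrite /r2 /slope e3 -jk'; field.
Qed.

End Orbit.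

Let floor_near (x : R) : `|(Num.floor x)%:~R - x| <= 1.
Proof.
have /andP[] := floor_itv x; rewrite rmorphD /= => h1 h2.
by rewrite ler_norml; lra.
Qed.

(** The orbit is adapted to [z]: [m] puts the initial [r_2] between 0 and [1 / q], [j0] selects
    among the [N] turning times of a period one with [theta_1] within [1 / N] of that of [z], and
    [i] then brings [theta_2] within [1 / N]. After [w] periods [r_2] has gained [w / q]. *)
Lemma drift (z : phase_space R) : @torus0 R z ->
  exists2 zh, phase_dist zh z <= 6 / N%:R &
    forall w : nat, w%:R / q%:R <= phase_dist (iter (q * w) T zh) z.
Proof.
move=> [z1 z2]; have [X [X_turn X_step X_eq X_far]] := standard_map_orbit K0 K1 n0.
have [x zE] : exists x : 'rV[R]_4, z = phase_cover x.
  by exists (phase_repr z); rewrite phase_reprK.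
have x1 : x 0 1 = 0 by rewrite -z1 zE.
have x3 : x 0 3 = 0 by rewrite -z2 zE.
have nr := nr0; have qr := qr0.
have nn : N%:R != 0 :> R by rewrite gt_eqF.
have qn : q%:R != 0 :> R by rewrite gt_eqF.
pose m : int := Num.floor (q%:R * omega.2) + 1.
have [m0 m1] : 0 <= m%:~R / q%:R - omega.2 /\ m%:~R / q%:R - omega.2 <= q%:R^-1.
  have /andP[] := floor_itv (q%:R * omega.2); rewrite -/m => h1 h2.
  have h3 : m%:~R <= q%:R * omega.2 + 1 by rewrite /m rmorphD /= lerD2r.
  rewrite subr_ge0 ler_pdivlMr // mulrC (ltW h2) lerBlDr ler_pdivrMr //.
  by rewrite mulrDl mulVf // [omega.2 * _]mulrC addrC.
pose f := Num.floor (N%:R * x 0 0).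
(* A turning time can match the residue of [f] modulo [N]; the quotient [a] counts full rotations
   and is removed by the lattice vector [v]. *)
have [i0 i0N [a fE]] : exists2 i0 : nat, (i0 < N)%N & exists a : int, f = a * N%:Z + i0%:Z.
  exists (absz (f %% N%:Z)%Z).
    rewrite -ltz_nat gez0_abs ?modz_ge0 ?eqz_nat -?lt0n //.
    by rewrite ltz_pmod.
  exists (f %/ N%:Z)%Z; rewrite gez0_abs ?modz_ge0 ?eqz_nat -?lt0n //.
  exact: divz_eq.
pose j0 := (i0 * n.*2)%N.
have j0q : (j0 < q)%N by rewrite /j0 /q mulnC ltn_pmul2l ?double_gt0.
pose i := Num.floor (N%:R * (x 0 2 - j0%:R * (m%:~R / q%:R)) - 4^-1).
pose P := drift_orbit X m i.
have stepP := drift_orbit_step m i X_turn X_step X_eq X_far.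
have iterP j t : iter t T (P j) = P (j + t)%N.
  elim: t => [|t IH]; first by rewrite addn0.
  by rewrite iterS IH stepP addnS.
exists (P j0) => [|w].
  have [n' nE] := dvdnP Nn.
  pose v : 'rV[R]_4 := row4 (- (i0 * n' * 2)%:R * p%:~R + a%:~R) 0 0 0.
  have lv : phase_lattice v.
    rewrite /phase_lattice !mxE /=; split; rewrite ?rpred0 //.
    by rewrite rpredD ?rpredM ?rpredN ?natr_int ?intr_int.
  rewrite zE /P /drift_orbit -(phase_cover_add _ lv); apply: phase_dist_le.
    by rewrite divr_ge0.
  rewrite !mxE /= x1 x3 !subr0 addr0 !divn_small // !modn_small // !addr0.
  have u0 : 0 < N%:R^-1 :> R by rewrite invr_gt0.
  have sq (y C : R) : 0 <= C -> `|y| <= C -> y ^+ 2 <= C ^+ 2.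
    move=> C0 yC; rewrite -[y ^+ 2]real_normK ?num_real // ler_pXn2r ?nnegrE //.
  have d0 : `|(X j0 + j0%:R * p%:~R) / N%:R + (- (i0 * n' * 2)%:R * p%:~R + a%:~R) -
      x 0 0| <= N%:R^-1.
    have := floor_near (N%:R * x 0 0); rewrite -/f fE => H.
    rewrite -(ler_pM2l nr) -[X in X * `|_|](ger0_norm (ltW nr)) -normrM divff //.
    apply: le_trans H; rewrite le_eqVlt; apply/orP; left; apply/eqP; congr `|_|.
    rewrite rmorphD rmorphM /= -!pmulrn X_turn /j0 nE -muln2 !natrM.
    by field.
  have d1 : `|rho + (X j0.+1 - X j0) / N%:R| <= 3 * N%:R^-1.
    have /andP[h1 h2] := X_step j0; have h3 : 0 <= (X j0.+1 - X j0) / N%:R.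
      by rewrite divr_ge0 // subr_ge0.
    have h4 : (X j0.+1 - X j0) / N%:R <= 1 / N%:R by rewrite ler_pM2r //; lra.
    have h5 := rho0; have h6 := rho1.
    by rewrite ger0_norm; [lra|exact: addr_ge0].
  have d2 : `|(4^-1 + i%:~R) / N%:R + j0%:R * (m%:~R / q%:R) - x 0 2| <= N%:R^-1.
    have := floor_near (N%:R * (x 0 2 - j0%:R * (m%:~R / q%:R)) - 4^-1); rewrite -/i => H.
    rewrite -(ler_pM2l nr) -[X in X * `|_|](ger0_norm (ltW nr)) -normrM divff //.
    apply: le_trans H; rewrite le_eqVlt; apply/orP; left; apply/eqP; congr `|_|.
    by field; rewrite qn.
  have d3 : `|m%:~R / q%:R - omega.2| <= N%:R^-1.
    rewrite ger0_norm //; apply: le_trans m1 _; rewrite lef_pV2 ?posrE //.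
    by rewrite ler_nat /q leq_pmull ?double_gt0.
  (* The squares of the four bounds add up to [12 / N ^ 2], below [36 / N ^ 2]. *)
  have := sq _ _ (ltW u0) d0; have := sq _ _ (ltW u0) d2; have := sq _ _ (ltW u0) d3.
  have h3 : 0 <= 3 * N%:R^-1 :> R by rewrite mulr_ge0 // ltW.
  have := sq _ _ h3 d1.
  have : 0 <= N%:R^-1 ^+ 2 :> R by exact: sqr_ge0.
  rewrite !exprMn; set U := N%:R^-1 ^+ 2; lra.
rewrite iterP; apply: le_trans (phase_dist_ge _ _).
rewrite z2 subr0 /P /drift_orbit /phase_cover /= !mxE /=.
have -> : ((j0 + q * w) %/ q = w)%N by rewrite addnC mulnC divnMDl // divn_small // addn0.
rewrite mulrDl; have := ler_norm (m%:~R / q%:R + w%:R / q%:R - omega.2).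
by apply: le_trans; lra.
Qed.

End Drift.

(** * The data of one scale *)

(* Data attached to one scale of size [1 / sc_N]: the perturbations are
   [sc_u (theta_1) sc_w (r_1)] and
   [sc_v (theta_1) sc_w (r_1) sc_g (theta_2)], with Gevrey bounds [sc_Mu], ...;
   [2 * sc_n] steps of the standard map of parameter [sc_K] turn once, and the
   resonant annulus is [r_1 = sc_rho], of rotation number [sc_p / sc_N]. *)
Record scale (R : realType) := Scale {
  sc_N : nat;
  sc_n : nat;
  sc_p : int;
  sc_K : R;
  sc_rho : R;
  sc_u : nat -> R -> R;
  sc_w : nat -> R -> R;
  sc_v : nat -> R -> R;
  sc_g : nat -> R -> R;
  sc_Mu : R;
  sc_Mw : R;
  sc_Mv : R;
  sc_Mg : R
}.

Definition sc_q (R : realType) (D : scale R) : nat := ((sc_n D).*2 * sc_N D)%N.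

Definition sc_plateau (R : realType) (D : scale R) (r : R) : Prop :=
  sc_rho D <= r <= sc_rho D + (2 * (sc_N D)%:R)^-1.

Record scale_spec (R : realType) (alpha B w1 c : R) (D : scale R) : Prop := ScaleSpec {
  sc_N_gt0 : (0 < sc_N D)%N;
  sc_n_gt0 : (0 < sc_n D)%N;
  sc_N_dvd : (sc_N D %| sc_n D)%N;
  sc_K_gt0 : 0 < sc_K D;
  sc_K_le : sc_K D <= 2^-1;
  sc_rhoE : w1 + sc_rho D = (sc_p D)%:~R / (sc_N D)%:R;
  sc_rho_gt : (sc_N D)%:R^-1 < sc_rho D;
  sc_rho_le : sc_rho D <= 2 / (sc_N D)%:R;
  sc_q_le : (sc_q D)%:R <= expR (expR (c * (sc_N D)%:R `^ (alpha - 1)^-1));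
  sc_u_gevrey : gevrey_jet alpha B (sc_Mu D) (sc_u D);
  sc_w_gevrey : gevrey_jet alpha B (sc_Mw D) (sc_w D);
  sc_v_gevrey : gevrey_jet alpha B (sc_Mv D) (sc_v D);
  sc_g_gevrey : gevrey_jet alpha B (sc_Mg D) (sc_g D);
  sc_u_small : sc_Mu D * sc_Mw D <= expR (- (sc_N D)%:R `^ (alpha - 1)^-1);
  sc_v_small : sc_Mv D * sc_Mw D * sc_Mg D <= expR (- (sc_N D)%:R `^ (alpha - 1)^-1);
  sc_u_period : forall k x z, z \is a Num.int -> sc_u D k (x + z) = sc_u D k x;
  sc_v_period : forall k x z, z \is a Num.int -> sc_v D k (x + z) = sc_v D k x;
  sc_g_period : forall k x z, z \is a Num.int -> sc_g D k (x + z) = sc_g D k x;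
  sc_w_plateau : forall k x, sc_plateau D x -> sc_w D k x = (k == 0%N)%:R;
  sc_w_out : forall k x, x <= sc_rho D - (2 * (sc_N D)%:R)^-1 \/
    sc_rho D + (sc_N D)%:R^-1 <= x -> sc_w D k x = 0;
  sc_u_kick : forall x,
    sc_u D 1 x = sc_K D / (sc_N D)%:R * sin (2 * pi * ((sc_N D)%:R * x));
  sc_v_int : forall z, z \is a Num.int -> sc_v D 0 z = 1 /\ sc_v D 1 z = 0;
  sc_v_far : forall k x, (forall z, z \is a Num.int ->
    sc_K D / (2 * (sc_N D)%:R) <= `|x - z|) -> sc_v D k x = 0;
  sc_g_kick : forall x,
    sc_g D 1 x = - ((sc_q D)%:R^-1 * sin (2 * pi * ((sc_N D)%:R * x)))
}.

Lemma expR16_ge (R : realType) : 16 <= expR 16 :> R.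
Proof. by have := expR_ge1Dx (16 : R); lra. Qed.

Lemma scale_exists (R : realType) (alpha B w1 : R) : 1 < alpha -> 0 < B ->
  exists2 c : R, 0 < c & forall N : nat, (0 < N)%N ->
    exists2 D : scale R, sc_N D = N & scale_spec alpha B w1 c D.
Proof.
move=> alpha1 B0; set s := (alpha - 1)^-1.
have s0 : 0 < s by rewrite invr_gt0 subr_gt0.
have p0 : 0 < pi :> R by exact: pi_gt0.
have p2 : 2 <= pi :> R by exact: pi_ge2.
have p4 : pi < 4 :> R by have := @pihalf_lt2 R; lra.
have [cc cc0 cosP] := cos_jet alpha1 B0.
have [cp cp0 platP] := plateau_jet alpha1 B0.
have [cb cb0 bumpP] := bump_jet alpha1 B0.
rewrite -/s in cosP platP bumpP.
(* [cc + cp + 1] makes [u] smaller than [exp (- Y)] in spite of its cosine and cutoff;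
   [2 * s^-1 + 16] keeps [K], which carries a factor [N ^ 2], below 1/2. *)
pose a := cc + cp + 1 + 2 * s^-1 + 16.
have si0 : 0 < s^-1 by rewrite invr_gt0.
have a0 : 0 < a by rewrite /a; lra.
pose e1 := 16 + 2 * s^-1 + 1 + cc + cp.
pose e2 := cb * 4 `^ s.
have e10 : 0 < e1 by rewrite /e1; lra.
have e20 : 0 < e2 by rewrite mulr_gt0 // powR_gt0.
(* The period will satisfy [q <= exp (e1 * Y + e2 * exp (a * s * Y))], where [e1] gathers the simple
   exponentials and [e2] comes from the norm of the bump. *)
pose c := a * s + 1 + e1 + e2.
have as0 : 0 < a * s by rewrite mulr_gt0.
exists c => [|N N0]; first by rewrite /c; lra.
have n0 : 0 < N%:R :> R by rewrite ltr0n.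
have n1 : 1 <= N%:R :> R by rewrite ler1n.
pose Y : R := N%:R `^ s.
have Y1 : 1 <= Y by exact: natr_powR_ge1.
have Y0 : 0 < Y by lra.
have NY : N%:R <= expR (s^-1 * Y) by exact: natr_le_expR.
have NY2 : N%:R ^+ 2 <= expR (2 * s^-1 * Y).
  have -> : 2 * s^-1 * Y = s^-1 * Y + s^-1 * Y by ring.
  by rewrite expRD expr2 ler_pM.
have [Cj [gC perC C0 C1]] := cosP N N0.
(* The offset 2 gives [1 / N < rho <= 2 / N], which keeps the support of the cutoff in [r_1 > 0]. *)
pose p := Num.floor (N%:R * w1) + 2.
pose rho : R := p%:~R / N%:R - w1.
have [Pj [gP Pplat Pout]] := platP N rho N0.
pose A := expR (- (a * Y)).
have A0 : 0 < A by exact: expR_gt0.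
(* Forced by the kick: the derivative of [- A cos (2 pi N x)] must be [(K / N) sin (2 pi N x)]. *)
pose K := 2 * pi * N%:R ^+ 2 * A.
have K0 : 0 < K by rewrite !mulr_gt0 // exprn_gt0.
have KA : A <= K / (2 * N%:R).
  have -> : K / (2 * N%:R) = pi * N%:R * A by rewrite /K; field; rewrite gt_eqF.
  by rewrite ler_peMl ?(ltW A0) //; have := ler_pM (ler0n R 2) (ler0n R 1) p2 n1; lra.
have A1 : A <= 1 by rewrite -expR0 ler_expR oppr_le0 mulr_ge0 // ltW.
have K1 : K <= 2^-1.
  have h16 := @expR16_ge R.
  have hA : A * (N%:R ^+ 2 * 16) <= 1.
    apply: (@le_trans _ _ (A * (expR (2 * s^-1 * Y) * expR (16 * Y)))).
      apply: ler_wpM2l; first exact: ltW.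
      apply: ler_pM => //.
      by apply: le_trans h16 _; rewrite ler_expR; lra.
    rewrite /A -!expRD -[leRHS]expR0 ler_expR /a.
    have := mulr_gt0 cc0 Y0; have := mulr_gt0 cp0 Y0; lra.
  have : K <= 8 * (A * N%:R ^+ 2).
    rewrite /K; have -> : 2 * pi * N%:R ^+ 2 * A = 2 * pi * (A * N%:R ^+ 2) by ring.
    by apply: ler_wpM2r; [rewrite mulr_ge0 ?exprn_ge0 // ltW|lra].
  have : A * (N%:R ^+ 2 * 16) = 2 * (8 * (A * N%:R ^+ 2)) by ring.
  lra.
(* Inside the gap [K / (2 N)] that the orbit leaves free, and below 1/2. *)
pose sig := A / 4.
have sig0 : 0 < sig by rewrite divr_gt0.
have sig1 : sig < 2^-1 by rewrite /sig; lra.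
have [Bj [gB perB B00 B10 Bout]] := bumpP sig sig0 sig1.
set Mb := expR (cb * _) in gB.
have Mb1 : 1 <= Mb by rewrite -expR0 ler_expR mulr_ge0 ?powR_ge0 // ltW.
have MbE : Mb = expR (e2 * expR (a * s * Y)).
  rewrite /Mb /e2 -mulrA; congr (expR (_ * _)).
  have sigi : sig = (4 * expR (a * Y))^-1.
    rewrite /sig /A expRN; have := expR_gt0 (a * Y); move: (expR _) => E E0.
    by field; rewrite gt_eqF.
  have h4 : 0 <= 4 * expR (a * Y) by rewrite mulr_ge0 ?expR_ge0.
  rewrite sigi -(powR_inv1 h4) -powRrM mulN1r opprK powRM ?expR_ge0 // -expRM.
  by congr (_ * expR _); ring.
(* What the factor [1 / q] in [v] has to compensate: the norms of cosine, cutoff and bump, and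
   [exp Y] for the smallness [exp (- Y)]. *)
pose Q := expR ((1 + cc + cp) * Y) * Mb.
have Q1 : 1 <= Q.
  have h1 : 1 <= expR ((1 + cc + cp) * Y).
    rewrite -expR0 ler_expR; apply: mulr_ge0 (ltW Y0).
    by rewrite !addr_ge0 // ltW.
  by rewrite -[leLHS](mulr1 1); exact: (ler_pM ler01 ler01 h1 Mb1).
pose n' := (Num.truncn Q).+1.
have Q0 : 0 <= Q by lra.
have [n'Q Qn'] : n'%:R <= Q + 1 /\ Q <= n'%:R.
  have /andP[h1 h2] := truncn_itv Q0.
  by rewrite {2}/n' (ltW h2) /n' mulrSr lerD2r.
pose n := (N * n')%N.
have n'0 : (0 < n')%N by rewrite -(ltr0n R); lra.
have nn0 : (0 < n)%N by rewrite muln_gt0 N0.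
pose q := (n.*2 * N)%N.
have qE : q%:R = 2 * N%:R ^+ 2 * n'%:R :> R.
  by rewrite /q /n -muln2 !natrM; ring.
have N21 : 1 <= N%:R ^+ 2 :> R by rewrite exprn_ege1.
have qQ : Q <= q%:R.
  rewrite qE; apply: le_trans Qn' _; rewrite ler_peMl //; lra.
have q0 : 0 < q%:R :> R by lra.
(* The derivative of [delta * cos (2 pi N x)] then has amplitude [1 / q]. *)
pose delta : R := (2 * pi * N%:R * q%:R)^-1.
have delta0 : 0 < delta by rewrite invr_gt0 !mulr_gt0.
have deltaQ : delta * Q <= 1.
  rewrite /delta mulrC ler_pdivrMr ?mulr_gt0 // mul1r; apply: le_trans qQ _.
  rewrite ler_peMl ?(ltW q0) //.
  have := ler_pM (ler0n R 2) (ler0n R 1) p2 n1; lra.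
have rhoE : w1 + rho = p%:~R / N%:R by rewrite /rho; ring.
have rho_gt : N%:R^-1 < rho.
  have /andP[_ h] := floor_itv (N%:R * w1).
  rewrite /rho ltrBrDr ltr_pdivlMr // mulrDl mulVf ?gt_eqF // [w1 * _]mulrC.
  by move: h; rewrite /p !rmorphD /=; lra.
have rho_le : rho <= 2 / N%:R.
  have /andP[h _] := floor_itv (N%:R * w1).
  rewrite /rho lerBlDr ler_pdivrMr // mulrDl divfK ?gt_eqF // [w1 * _]mulrC.
  by rewrite /p rmorphD /=; lra.
have q_le : q%:R <= expR (expR (c * Y)).
  have q4 : q%:R <= 4 * N%:R ^+ 2 * Q.
    rewrite qE; have h := ler_wpM2l (exprn_ge0 2 (ltW n0)) n'Q.
    have h2 := ler_wpM2l (exprn_ge0 2 (ltW n0)) Q1.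
    move: h h2; rewrite mulrDr !mulr1; lra.
  apply: le_trans q4 _.
  have h4 : 4 <= expR (16 * Y) by apply: le_trans (expR_ge1Dx _); lra.
  apply: (@le_trans _ _ (expR (16 * Y) * expR (2 * s^-1 * Y) * Q)).
    apply: ler_wpM2r; first exact: Q0.
    exact: ler_pM (ler0n R 4) (exprn_ge0 2 (ltW n0)) h4 NY2.
  rewrite /Q MbE mulrA -!expRD ler_expR.
  have -> : 16 * Y + 2 * s^-1 * Y + (1 + cc + cp) * Y = e1 * Y by rewrite /e1; ring.
  have hY : Y <= expR Y by have := expR_ge1Dx Y; lra.
  have asY : 0 <= a * s * Y by rewrite mulr_ge0 ?(ltW as0) ?(ltW Y0).
  apply: (@le_trans _ _ ((e1 + e2) * expR ((a * s + 1) * Y))).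
    rewrite (mulrDl e1); apply: lerD.
      apply: ler_wpM2l; first exact: ltW.
      by apply: le_trans hY _; rewrite ler_expR (mulrDl (a * s)) mul1r lerDr.
    apply: ler_wpM2l; first exact: ltW.
    by rewrite ler_expR (mulrDl (a * s)) mul1r lerDl ltW.
  have -> : c * Y = (e1 + e2) * Y + (a * s + 1) * Y by rewrite /c; ring.
  rewrite expRD; apply: ler_wpM2r; first exact: expR_ge0.
  have e12 : 0 <= e1 + e2 by rewrite addr_ge0 ?(ltW e10) ?(ltW e20).
  have : (e1 + e2) <= (e1 + e2) * Y by rewrite ler_peMr.
  by have := expR_ge1Dx ((e1 + e2) * Y); lra.
have gu : gevrey_jet alpha B (A * expR (cc * Y)) (jet_scale (- A) Cj).
  by have := gevrey_jet_scale (- A) gC; rewrite normrN (ger0_norm (ltW A0)).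
have gg : gevrey_jet alpha B (delta * expR (cc * Y)) (jet_scale delta Cj).
  by have := gevrey_jet_scale delta gC; rewrite (ger0_norm (ltW delta0)).
have u_small : A * expR (cc * Y) * expR (cp * Y) <= expR (- Y).
  rewrite /A -!expRD ler_expR /a.
  have := mulr_gt0 si0 Y0; lra.
have v_small : Mb * expR (cp * Y) * (delta * expR (cc * Y)) <= expR (- Y).
  have -> : Mb * expR (cp * Y) * (delta * expR (cc * Y)) = delta * Q * expR (- Y).
    have -> : Q = expR (cp * Y) * expR (cc * Y) * expR Y * Mb.
      rewrite /Q; have -> : (1 + cc + cp) * Y = cp * Y + cc * Y + Y by ring.
      by rewrite !expRD.
    rewrite expRN; have := expR_gt0 Y.
    move: (expR (cp * Y)) (expR (cc * Y)) (expR Y) (Mb) (delta) => b1 b2 b3 b4 b5 b30.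
    by field; rewrite gt_eqF.
  by rewrite ler_piMl ?expR_ge0.
have perS e k x z : z \is a Num.int -> jet_scale e Cj k (x + z) = jet_scale e Cj k x.
  by move=> zi; rewrite /jet_scale perC.
have u_kick x : jet_scale (- A) Cj 1 x = K / N%:R * sin (2 * pi * (N%:R * x)).
  rewrite /jet_scale C1 /K; move: (sin _) (A) => b1 b2.
  by field; rewrite gt_eqF.
have g_kick x : jet_scale delta Cj 1 x = - (q%:R^-1 * sin (2 * pi * (N%:R * x))).
  rewrite /jet_scale C1 /delta; have := p0; have := q0.
  move: (sin _) => b1; move: (q%:R : R) (@pi R) => b2 b3 b20 b30.
  by field; rewrite !gt_eqF.
have v_int z : z \is a Num.int -> Bj 0%N z = 1 /\ Bj 1%N z = 0.
  by move=> zi; rewrite -[z]add0r !perB.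
have v_far k x : (forall z, z \is a Num.int -> K / (2 * N%:R) <= `|x - z|) -> Bj k x = 0.
  move=> xz; apply: Bout => z /xz; apply: le_trans; apply: le_trans KA.
  by rewrite /sig ler_piMr ?(ltW A0) //; lra.
exists (@Scale R N n p K rho (jet_scale (- A) Cj) Pj Bj (jet_scale delta Cj)
  (A * expR (cc * Y)) (expR (cp * Y)) Mb (delta * expR (cc * Y))); first by [].
apply: ScaleSpec.
- exact: N0.
- exact: nn0.
- exact: dvdn_mulr.
- exact: K0.
- exact: K1.
- exact: rhoE.
- exact: rho_gt.
- exact: rho_le.
- exact: q_le.
- exact: gu.
- exact: gP.
- exact: gB.
- exact: gg.
- exact: u_small.
- exact: v_small.
- exact: perS.
- exact: perB.
- exact: perS.
- exact: Pplat.
- exact: Pout.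
- exact: u_kick.
- exact: v_int.
- exact: v_far.
- exact: g_kick.
Qed.

(** * Superposition of the scales *)

Lemma prod_ord2 (R : realType) (f : 'I_2 -> R) : \prod_(i < 2) f i = f 0 * f 1.
Proof. by rewrite !big_ord_recl big_ord0 mulr1; congr (f _ * f _); exact/val_inj. Qed.

Lemma prod_ord4 (R : realType) (f : 'I_4 -> R) :
  \prod_(i < 4) f i = f 0 * f 1 * f 2 * f 3.
Proof.
rewrite !big_ord_recl big_ord0 mulr1 !mulrA.
by congr (f _ * f _ * f _ * f _); exact/val_inj.
Qed.

Definition tensor_field (R : realType) (F : nat -> 'I_4 -> nat -> R -> R)
    (x : 'rV[R]_4) : 'rV[R]_4 :=
  let D i := tensor_sum F (incr i (fun=> 0%N)) x in
  row4 (D 1) (- D 0) (D 3) (- D 2).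

(** Every derivative of a tensor sum is bounded and Lipschitz, so the field has a complete flow. At
    [t = 0] the condition on [X] says that it is the field at [x]. *)
Lemma tensor_sum_time_one (R : realType) (alpha B S : R)
    (F : nat -> 'I_4 -> nat -> R -> R) (M : nat -> 'I_4 -> R) (c : nat -> R)
    (H : phase_space R -> R) : 0 < B ->
  (forall k i, gevrey_jet alpha B (M k i) (F k i)) ->
  (forall k, \prod_(i < 4) M k i <= c k) ->
  (forall n, \sum_(k < n) c k <= S) ->
  H \o @phase_cover R = tensor_sum F (fun=> 0%N) ->
  exists2 Phi, is_time_one_map H Phi &
  forall x X, (forall t, 0 <= t <= 1 -> tensor_field F (x + t *: X) = X) ->
    Phi (phase_cover x) = phase_cover (x + X).
Proof.
move=> B0 gF cM cS HE; pose D i x := tensor_sum F (incr i (fun=> 0%N)) x.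
pose X := tensor_field F.
have XE : ham_field (H \o @phase_cover R) = X.
  apply/funext => x; rewrite /ham_field HE !(partial_tensor_sum B0 gF cM cS).
  by apply/rowP => j; rewrite !mxE.
have S0 : 0 <= S by have := cS 0; rewrite big_ord0.
pose W (i : 'I_4) := S * weight alpha B (incr i (fun=> 0%N)).
have W0 i : 0 <= W i by rewrite mulr_ge0 // weight_ge0.
have DW i x : `|D i x| <= \sum_j W j.
  apply: le_trans (tensor_sum_bound B0 gF cM cS _ _) _.
  by rewrite (bigD1 i) //= lerDl; apply: sumr_ge0.
have /choice[C CP] : forall i, exists Ci : R, 0 <= Ci /\
    forall x y, `|D i x - D i y| <= Ci * `|x - y|.
  move=> i.
  by have [Ci C0 CL] := tensor_sum_lipschitz B0 gF cM cS (incr i (fun=> 0%N)); exists Ci.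
pose Lam := \sum_j C j + 1.
have Lam0 : 0 < Lam by rewrite ltr_wpDl // sumr_ge0 // => i _; case: (CP i).
have DL i x y : `|D i x - D i y| <= Lam * `|x - y|.
  apply: le_trans (proj2 (CP i) x y) _; apply: ler_wpM2r => //.
  rewrite /Lam (bigD1 i) //= -addrA lerDl addr_ge0 // sumr_ge0 // => j _.
  by case: (CP j).
have XM x j : `|X x 0 j| <= \sum_j W j.
  by rewrite mxE; case: j => -[|[|[|[|//]]]] jl /=; rewrite ?normrN; exact: DW.
have XL x y : `|X x - X y| <= Lam * `|x - y|.
  apply: rV_norm_le => [|j]; first by rewrite mulr_ge0 // ltW.
  rewrite !mxE; case: j => -[|[|[|[|//]]]] jl /=; rewrite -?opprD ?normrN; exact: DL.
rewrite -XE in XM XL; have [Phi PhiT PhiE] := time_one_map_exists XM Lam0 XL.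
exists Phi => // x Y line; have XY : X x = Y.
  by rewrite -(line 0) ?lexx ?ler01 // scale0r addr0.
by have := PhiE x; rewrite XE XY; apply.
Qed.

(** Variables beyond the list get the constant factor 1, so that one list describes [u] both on
    [M_1] and on the product. *)
Definition jets (R : realType) (N : nat) (Ds : seq (nat -> R -> R)) (i : 'I_N) :
  nat -> R -> R := nth (@jet_one R) Ds i.

Definition bounds (R : realType) (N : nat) (Ms : seq R) (i : 'I_N) : R := nth 1 Ms i.

Section Assembly.
Variables (R : realType) (alpha B c S : R) (omega : R * R) (sc : nat -> scale R).
Hypothesis B0 : 0 < B.
Hypothesis spec : forall k, scale_spec alpha B omega.1 c (sc k).
Hypothesis growth : forall j k, (j < k)%N -> (16 * sc_N (sc j) <= sc_N (sc k))%N.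
Let ck k := expR (- (sc_N (sc k))%:R `^ (alpha - 1)^-1).
Hypothesis cS : forall n, \sum_(k < n) ck k <= S.

Definition u_jets N k := @jets R N [:: sc_u (sc k); sc_w (sc k)].
Definition v_jets k := @jets R 4 [:: sc_v (sc k); sc_w (sc k); sc_g (sc k)].
Definition u_bounds N k := @bounds R N [:: sc_Mu (sc k); sc_Mw (sc k)].
Definition v_bounds k := @bounds R 4 [:: sc_Mv (sc k); sc_Mw (sc k); sc_Mg (sc k)].

Lemma u_jets_gevrey N k i : gevrey_jet alpha B (@u_bounds N k i) (@u_jets N k i).
Proof.
rewrite /u_bounds /u_jets /bounds /jets.
case: i => -[|[|i]] il /=; [exact: sc_u_gevrey|exact: sc_w_gevrey|].
by rewrite !nth_default //; exact: gevrey_jet_one (ltW B0).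
Qed.

Lemma v_jets_gevrey k i : gevrey_jet alpha B (@v_bounds k i) (@v_jets k i).
Proof.
rewrite /v_bounds /v_jets /bounds /jets.
case: i => -[|[|[|i]]] il /=; [exact: sc_v_gevrey|exact: sc_w_gevrey|exact: sc_g_gevrey|].
by rewrite !nth_default //; exact: gevrey_jet_one (ltW B0).
Qed.

Lemma u2_bounds k : \prod_(i < 2) @u_bounds 2 k i <= ck k.
Proof. by rewrite prod_ord2; exact: sc_u_small (spec k). Qed.

Lemma u4_bounds k : \prod_(i < 4) @u_bounds 4 k i <= ck k.
Proof. by rewrite prod_ord4 /u_bounds /bounds /= !mulr1; exact: sc_u_small (spec k). Qed.

Lemma v4_bounds k : \prod_(i < 4) @v_bounds k i <= ck k.
Proof. by rewrite prod_ord4 /v_bounds /bounds /= !mulr1; exact: sc_v_small (spec k). Qed.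

Lemma w_out_le0 k l r : r <= 0 -> sc_w (sc k) l r = 0.
Proof.
move=> r0; apply: (sc_w_out (spec k)); left.
have N0 : 0 < (sc_N (sc k))%:R :> R by rewrite ltr0n (sc_N_gt0 (spec k)).
have := sc_rho_gt (spec k); rewrite invfM.
have : 0 < (sc_N (sc k))%:R^-1 :> R by rewrite invr_gt0.
lra.
Qed.

(* The plateau of a scale [N] lies in [[1/N, 5/(2N)]] and the support of [sc_w]
   in [[1/(2N), 3/N]]; consecutive scales are separated by a factor 16. *)
Lemma w_out_plateau j k l r : j != k -> sc_plateau (sc k) r -> sc_w (sc j) l r = 0.
Proof.
move=> jk; have sj := spec j; have sk := spec k.
have gj := sc_rho_gt sj; have gk := sc_rho_gt sk.
have lj := sc_rho_le sj; have lk := sc_rho_le sk.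
have Nj : 0 < (sc_N (sc j))%:R :> R by rewrite ltr0n (sc_N_gt0 sj).
have Nk : 0 < (sc_N (sc k))%:R :> R by rewrite ltr0n (sc_N_gt0 sk).
have inv16 i i' : (i < i')%N -> 0 < (sc_N (sc i'))%:R :> R ->
    0 < (sc_N (sc i))%:R :> R ->
    16 * (sc_N (sc i'))%:R^-1 <= (sc_N (sc i))%:R^-1 :> R.
  move=> ii p0 p1; rewrite -[leRHS]mul1r ler_pdivlMr // mulrAC ler_pdivrMr // mul1r.
  by rewrite -natrM ler_nat; exact: growth.
have pj : 0 < (sc_N (sc j))%:R^-1 :> R by rewrite invr_gt0.
have pk : 0 < (sc_N (sc k))%:R^-1 :> R by rewrite invr_gt0.
rewrite /sc_plateau invfM => /andP[r1 r2].
apply: (sc_w_out sj); rewrite invfM.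
move: jk; rewrite neq_ltn => /orP[/inv16|/inv16]; move=> /(_ _ _) H.
  by left; have := H Nk Nj; lra.
by right; have := H Nj Nk; lra.
Qed.

Definition the_u (z : annulus R) : R :=
  tensor_sum (@u_jets 2) (fun=> 0%N) (annulus_repr z).

Definition the_v (z : phase_space R) : R :=
  tensor_sum v_jets (fun=> 0%N) (phase_repr z).

Lemma the_uE : the_u \o @annulus_cover R = tensor_sum (@u_jets 2) (fun=> 0%N).
Proof.
apply: annulus_descend => x y xy e; congr sumr; apply/funext => k.
rewrite /tensor !prod_ord2 e; congr (_ * _); rewrite /u_jets /jets /=.
by rewrite -(subrK (y 0 0) (x 0 0)) addrC (sc_u_period (spec k)).
Qed.

Lemma the_u4E : (the_u \o fst) \o @phase_cover R = tensor_sum (@u_jets 4) (fun=> 0%N).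
Proof.
apply/funext => x /=.
have -> : (to_circle (x 0 0), x 0 1) =
    annulus_cover (\row_(j < 2) [:: x 0 0; x 0 1]`_j) by rewrite /annulus_cover !mxE.
have /(congr1 (fun f => f (\row_(j < 2) [:: x 0 0; x 0 1]`_j))) /= -> := the_uE.
congr sumr; apply/funext => k.
by rewrite /tensor prod_ord2 prod_ord4 !mxE /u_jets /jets /= !mulr1.
Qed.

Lemma the_vE : the_v \o @phase_cover R = tensor_sum v_jets (fun=> 0%N).
Proof.
apply: phase_descend => x v [v0 v1 v2 v3]; congr sumr; apply/funext => k.
rewrite /tensor !prod_ord4 !mxE v1 v3 !addr0 /v_jets /jets /=.
by rewrite (sc_v_period (spec k)) // (sc_g_period (spec k)).
Qed.

Lemma u_flat (l : multi_index 2) (x : 'rV[R]_2) : x 0 1 = 0 -> mpartial l (the_u \o @annulus_cover R) x = 0.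
Proof.
move=> x1; rewrite the_uE (mpartial_tensor_sum B0 (@u_jets_gevrey 2) u2_bounds cS).
apply: sumr0 => k; rewrite /tensor prod_ord2 x1 /u_jets /jets /=.
by rewrite w_out_le0 ?mulr0.
Qed.

Lemma v_flat (l : multi_index 4) (x : 'rV[R]_4) : x 0 1 = 0 -> mpartial l (the_v \o @phase_cover R) x = 0.
Proof.
move=> x1; rewrite the_vE (mpartial_tensor_sum B0 v_jets_gevrey v4_bounds cS).
apply: sumr0 => k; rewrite /tensor prod_ord4 x1 /v_jets /jets /=.
by rewrite w_out_le0 ?mulr0 ?mul0r.
Qed.

(** On a plateau the other scales vanish together with their derivatives, and the cutoff is 1 with
    vanishing derivatives; the angular factor remains. *)
Lemma u_tensor_sum k l (x : 'rV[R]_4) : sc_plateau (sc k) (x 0 1) ->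
  tensor_sum (@u_jets 4) l x = sc_u (sc k) (l 0) (x 0 0) *
    (l 1 == 0%N)%:R * (l 2 == 0%N)%:R * (l 3 == 0%N)%:R.
Proof.
move=> pl; rewrite /tensor_sum (@sumr_single _ _ k) => [|j jk].
  by rewrite /tensor prod_ord4 /u_jets /jets /= (sc_w_plateau (spec k)).
by rewrite /tensor prod_ord4 /u_jets /jets /= (w_out_plateau _ jk pl) mulr0 !mul0r.
Qed.

Lemma v_tensor_sum k l (x : 'rV[R]_4) : sc_plateau (sc k) (x 0 1) ->
  tensor_sum v_jets l x = sc_v (sc k) (l 0) (x 0 0) * (l 1 == 0%N)%:R *
    sc_g (sc k) (l 2) (x 0 2) * (l 3 == 0%N)%:R.
Proof.
move=> pl; rewrite /tensor_sum (@sumr_single _ _ k) => [|j jk].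
  by rewrite /tensor prod_ord4 /v_jets /jets /= (sc_w_plateau (spec k)).
by rewrite /tensor prod_ord4 /v_jets /jets /= (w_out_plateau _ jk pl) mulr0 !mul0r.
Qed.

Lemma u_tensor_sum0 l (x : 'rV[R]_4) : x 0 1 = 0 -> tensor_sum (@u_jets 4) l x = 0.
Proof.
move=> x1; apply: sumr0 => k.
by rewrite /tensor prod_ord4 x1 /u_jets /jets /= w_out_le0 // mulr0 !mul0r.
Qed.

Lemma v_tensor_sum0 l (x : 'rV[R]_4) : x 0 1 = 0 -> tensor_sum v_jets l x = 0.
Proof.
move=> x1; apply: sumr0 => k.
by rewrite /tensor prod_ord4 x1 /v_jets /jets /= w_out_le0 // mulr0 !mul0r.
Qed.

Lemma row4_eq0 : row4 0 0 0 0 = 0 :> 'rV[R]_4.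
Proof. by apply/rowP => -[[|[|[|[|//]]]] j]; rewrite !mxE. Qed.

Lemma row4D (a b d e a' b' d' e' : R) :
  row4 a b d e + row4 a' b' d' e' = row4 (a + a') (b + b') (d + d') (e + e').
Proof. by apply/rowP => -[[|[|[|[|//]]]] j]; rewrite !mxE. Qed.

Lemma row4Z (t a b d e : R) : t *: row4 a b d e = row4 (t * a) (t * b) (t * d) (t * e).
Proof. by apply/rowP => -[[|[|[|[|//]]]] j]; rewrite !mxE. Qed.

Lemma u_field0 (x : 'rV[R]_4) : x 0 1 = 0 -> tensor_field (@u_jets 4) x = 0.
Proof. by move=> x1; rewrite /tensor_field !u_tensor_sum0 // oppr0 row4_eq0. Qed.

Lemma v_field0 (x : 'rV[R]_4) : x 0 1 = 0 -> tensor_field v_jets x = 0.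
Proof. by move=> x1; rewrite /tensor_field !v_tensor_sum0 // oppr0 row4_eq0. Qed.

Lemma u_field k (t1 r1 t2 r2 : R) : sc_plateau (sc k) r1 ->
  tensor_field (@u_jets 4) (row4 t1 r1 t2 r2) =
  row4 0 (- (sc_K (sc k) / (sc_N (sc k))%:R *
    sin (2 * pi * ((sc_N (sc k))%:R * t1)))) 0 0.
Proof.
move=> pr; rewrite /tensor_field !(@u_tensor_sum k) ?mxE //= /incr /=.
by rewrite !mulr0 ?mul0r !mulr1 oppr0 (sc_u_kick (spec k)).
Qed.

Lemma v_field k (t1 r1 t2 r2 : R) : sc_plateau (sc k) r1 ->
  tensor_field v_jets (row4 t1 r1 t2 r2) =
  row4 0 (- (sc_v (sc k) 1 t1 * sc_g (sc k) 0 t2)) 0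
    (- (sc_v (sc k) 0 t1 * sc_g (sc k) 1 t2)).
Proof.
move=> pr; rewrite /tensor_field !(@v_tensor_sum k) ?mxE //= /incr /=.
by rewrite !mulr0 ?mul0r !mulr1.
Qed.

Lemma u_time_one : exists Phi, [/\ is_time_one_map (the_u \o fst) Phi,
  forall x : 'rV[R]_4, x 0 1 = 0 -> Phi (phase_cover x) = phase_cover x &
  forall k t1 r1 t2 r2,
    let r1' := r1 - sc_K (sc k) / (sc_N (sc k))%:R *
      sin (2 * pi * ((sc_N (sc k))%:R * t1)) in
    sc_plateau (sc k) r1 -> sc_plateau (sc k) r1' ->
    Phi (phase_cover (row4 t1 r1 t2 r2)) = phase_cover (row4 t1 r1' t2 r2)].
Proof.
have [Phi PhiT PhiE] := tensor_sum_time_one B0 (@u_jets_gevrey 4) u4_bounds cS the_u4E.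
exists Phi; split=> // [x x1|k t1 r1 t2 r2 r1' p1 p1'].
  by rewrite (PhiE x 0) ?addr0 // => t _; rewrite scaler0 addr0 u_field0.
pose kick := - (sc_K (sc k) / (sc_N (sc k))%:R * sin (2 * pi * ((sc_N (sc k))%:R * t1))).
rewrite (PhiE _ (row4 0 kick 0 0)) ?row4D ?addr0 // => t /andP[t0 t1'].
rewrite row4Z row4D !mulr0 !addr0; apply: u_field.
have r1E : r1' = r1 + kick by [].
move: p1 p1'; rewrite /sc_plateau r1E => /andP[a1 a2] /andP[b1 b2].
(* The plateau is convex: it contains the travelled segment because it contains its ends. *)
have [k0|/ltW k0] := leP 0 kick.
  have h1 : 0 <= t * kick by exact: mulr_ge0.
  have h2 : t * kick <= kick by exact: ler_piMl.
  by apply/andP; split; lra.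
have h1 : t * kick <= 0 by exact: mulr_ge0_le0.
have h2 : kick <= t * kick by rewrite ler_niMl.
by apply/andP; split; lra.
Qed.

(** On a plateau the field of [v] depends only on the angles, which it leaves fixed. Off the bump it
    vanishes; at an integer [theta_1] the bump is 1 with derivative 0, so only [r_2] moves. *)
Lemma v_time_one : exists Phi, [/\ is_time_one_map the_v Phi,
  forall x : 'rV[R]_4, x 0 1 = 0 -> Phi (phase_cover x) = phase_cover x,
  forall k t1 r1 t2 r2, sc_plateau (sc k) r1 ->
    (forall z : R, z \is a Num.int ->
      sc_K (sc k) / (2 * (sc_N (sc k))%:R) <= `|t1 - z|) ->
    Phi (phase_cover (row4 t1 r1 t2 r2)) = phase_cover (row4 t1 r1 t2 r2) &
  forall k t1 r1 t2 r2, sc_plateau (sc k) r1 -> t1 \is a Num.int ->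
    Phi (phase_cover (row4 t1 r1 t2 r2)) = phase_cover (row4 t1 r1 t2
      (r2 + (sc_q (sc k))%:R^-1 * sin (2 * pi * ((sc_N (sc k))%:R * t2))))].
Proof.
have [Phi PhiT PhiE] := tensor_sum_time_one B0 v_jets_gevrey v4_bounds cS the_vE.
exists Phi; split=> // [x x1|k t1 r1 t2 r2 p1 far|k t1 r1 t2 r2 p1 t1i].
- by rewrite (PhiE x 0) ?addr0 // => t _; rewrite scaler0 addr0 v_field0.
- have vf j : sc_v (sc k) j t1 = 0 by exact: (sc_v_far (spec k)).
  rewrite (PhiE _ 0) ?addr0 // => t _; rewrite scaler0 addr0 (v_field _ _ _ p1).
  by rewrite !vf !mul0r oppr0 row4_eq0.
have [v1 v0] := sc_v_int (spec k) t1i.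
pose kick := (sc_q (sc k))%:R^-1 * sin (2 * pi * ((sc_N (sc k))%:R * t2)).
rewrite (PhiE _ (row4 0 0 0 kick)) ?row4D ?addr0 // => t _.
rewrite row4Z row4D !mulr0 !addr0 (v_field _ _ _ p1) v0 v1 mul0r oppr0 mul1r.
by rewrite (sc_g_kick (spec k)) opprK.
Qed.

End Assembly.

(** * The sequence of scales and the waiting time *)

Lemma scales_exist (R : realType) (s : R) (Z : nat -> R) : 0 < s ->
  exists Ns : nat -> nat,
    [/\ forall k, (k < Ns k)%N, forall k, Z k <= (Ns k)%:R `^ s &
        forall j k, (j < k)%N -> (16 * Ns j <= Ns k)%N].
Proof.
move=> s0.
have /choice[thr thrP] : forall k, exists m : nat, forall N, (m <= N)%N ->
    Z k <= N%:R `^ s.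
  move=> k; exists (Num.bound (`|Z k| `^ s^-1)) => N mN.
  apply: le_trans (ler_norm _) _.
  have E : `|Z k| = (`|Z k| `^ s^-1) `^ s by rewrite -powRrM mulVf ?gt_eqF // powRr1.
  rewrite [leLHS]E.
  apply: ge0_ler_powR; rewrite ?nnegrE ?powR_ge0 ?(ltW s0) //.
  by apply: le_trans (ltW (archi_boundP (powR_ge0 _ _))) _; rewrite ler_nat.
pose fix Ns k := if k is i.+1 then (16 * Ns i + thr k + 1)%N else (thr 0 + 1)%N.
have NsS k : Ns k.+1 = (16 * Ns k + thr k.+1 + 1)%N by [].
exists Ns; split.
- by elim=> [|k IH]; [rewrite /= addn1|rewrite NsS; lia].
- by case=> [|k]; apply: thrP; rewrite ?NsS /=; lia.
- move=> j; elim=> [//|k IH]; rewrite ltnS leq_eqVlt NsS => /predU1P[->|/IH]; lia.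
Qed.

Lemma sum_half_powS (R : realType) (n : nat) (S : R) : 0 <= S ->
  \sum_(k < n) S / 2 ^+ k.+1 <= S.
Proof.
move=> S0; have -> : \sum_(k < n) S / 2 ^+ k.+1 = S - S / 2 ^+ n.
  elim: n => [|n IH]; first by rewrite big_ord0 expr0 divr1 subrr.
  by rewrite big_ord_recr /= IH exprS; field; rewrite expf_neq0.
by rewrite gerBl divr_ge0 // exprn_ge0.
Qed.

(** The factor [12 ^ s] is tuned to [2 nu = 12 / N]: for [a = 12] the inner exponent is [c N^s], as
    in the bound on the period, and for [a = 6] it is [2^s] times larger. *)
Lemma double_exp_scale (R : realType) (c s a : R) (N : nat) : 0 < s -> 0 < a ->
  (0 < N)%N -> double_exp (c * (12 `^ s)) s (a / N%:R) =
  expR (expR (c * (12 / a) `^ s * N%:R `^ s)).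
Proof.
move=> s0 a0 N0; have n0 : 0 < N%:R :> R by rewrite ltr0n.
rewrite /double_exp; congr (expR (expR _)); rewrite -!mulrA; congr (_ * _).
have aN : a / N%:R = (N%:R / a)^-1 by rewrite invf_div.
have h : 0 <= N%:R / a by rewrite divr_ge0 // ltW.
rewrite aN -(powR_inv1 h) -powRrM mulN1r opprK -!powRM ?divr_ge0 ?(ltW a0) //.
by congr (_ `^ _); field; rewrite gt_eqF.
Qed.

(** The left side is at most [2 exp (3 G)], hence at most [exp (4 G)], and [4 <= exp h]. *)
Lemma exp_time_bound (R : realType) (q E2 G h : R) :
  0 <= q -> 1 <= G -> q <= expR G -> E2 = expR G -> 3 <= h ->
  q * (q * E2 + 1) <= expR (G * expR h).
Proof.
move=> q0 G1 qG -> h3; have e1 : 1 <= expR G by rewrite -expR0 ler_expR; lra.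
apply: (@le_trans _ _ (expR G * (expR G * expR G + expR G * expR G))).
  apply: ler_pM => //; first by rewrite addr_ge0 // mulr_ge0 // expR_ge0.
  apply: lerD; first by rewrite ler_wpM2r ?expR_ge0.
  by rewrite -[leLHS](mulr1 1); apply: ler_pM.
have e2 : 2 <= expR G by have := expR_ge1Dx G; lra.
apply: (@le_trans _ _ (expR G * (expR G * (expR G * expR G)))).
  apply: ler_wpM2l; first exact: expR_ge0.
  rewrite -mulrDr; apply: ler_wpM2l; first exact: expR_ge0.
  have -> : expR G + expR G = 2 * expR G by ring.
  by apply: ler_wpM2r; first exact: expR_ge0.
rewrite -!expRD ler_expR.
have : 4 <= expR h by have := expR_ge1Dx h; lra.
have G0 : 0 < G by lra.
rewrite -(ler_pM2l G0); lra.
Qed.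

Lemma drift_time_bound (R : realType) (c s : R) (N : nat) (q : R) :
  0 < c -> 0 < s -> (0 < N)%N -> 0 <= q ->
  q <= expR (expR (c * N%:R `^ s)) -> 3 <= (2 `^ s - 1) * c * N%:R `^ s ->
  q * (q * double_exp (c * 12 `^ s) s (2 * (6 / N%:R)) + 1) <=
    double_exp (c * 12 `^ s) s (6 / N%:R).
Proof.
move=> c0 s0 N0 q0 qN h3.
have -> : 2 * (6 / N%:R) = 12 / N%:R :> R by ring.
rewrite !double_exp_scale // divff // powR1 mulr1.
have -> : 12 / 6 = 2 :> R by field.
set G := expR (c * N%:R `^ s) in qN *.
have -> : expR (c * 2 `^ s * N%:R `^ s) = G * expR ((2 `^ s - 1) * c * N%:R `^ s).
  by rewrite /G -expRD; congr expR; ring.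
apply: exp_time_bound => //.
by rewrite /G -expR0 ler_expR mulr_ge0 ?powR_ge0 // ltW.
Qed.

Lemma torus0_cover (R : realType) (z : phase_space R) : @torus0 R z ->
  exists2 x : 'rV[R]_4, x 0 1 = 0 & z = phase_cover x.
Proof.
move=> [z1 z2]; exists (phase_repr z); last by rewrite phase_reprK.
by rewrite !mxE.
Qed.

Unset Implicit Arguments.

Theorem theorem3p3 (R : realType) (omega : R * R) (alpha L : R)
    (halpha : 1 < alpha) (hL : 0 < L) :
  exists C : R, 0 < C /\
  forall eps : R, 0 < eps ->
  exists (u : annulus R -> R) (v : phase_space R -> R)
         (Phi_u Phi_v : phase_space R -> phase_space R),
    let gamma := (alpha - 1)^-1 in
    let T := Phi_v \o Phi_u \o T0 omega in
    gevrey (@annulus_cover R) alpha L u /\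
    gevrey (@phase_cover R) alpha L v /\
    is_time_one_map (u \o fst) Phi_u /\
    is_time_one_map v Phi_v /\
    flat_on (@annulus_cover R) u [set z | z.2 = 0] /\
    flat_on (@phase_cover R) v [set z | z.1.2 = 0] /\
    (gevrey_norm (@annulus_cover R) alpha L u +
     gevrey_norm (@phase_cover R) alpha L v < eps%:E)%E /\
    T @` @torus0 R = @torus0 R /\
    diffusive (@phase_dist R) (double_exp C gamma) T (@torus0 R).
Proof.
pose s := (alpha - 1)^-1; have s0 : 0 < s by rewrite invr_gt0 subr_gt0.
pose B := (2 * L `^ alpha)^-1.
have B0 : 0 < B by rewrite invr_gt0 mulr_gt0 // powR_gt0.
have [c c0 scaleP] := @scale_exists R alpha B omega.1 halpha B0.
have t0 : 0 < 12 `^ s :> R by rewrite powR_gt0.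
exists (c * 12 `^ s); split=> [|eps eps0]; first by rewrite mulr_gt0.
(* The norms are at most [2 ^ 2 * S] and [2 ^ 4 * S], together half of [eps]. *)
pose S := eps / 40; have S0 : 0 < S by rewrite divr_gt0.
have b1 : 0 < (2 `^ s - 1) * c.
  rewrite mulr_gt0 // subr_gt0 -[X in X < _](powRr0 2).
  by rewrite /powR !gt_eqF // ltr_expR mul0r mulr_gt0 // ln_gt0 // ltr1n.
(* The first summand yields [exp (- N^s) <= S / 2 ^ (k + 1)], the second the value 3 required by
   [drift_time_bound]. *)
pose Z k := 2 ^+ k.+1 / S + 3 / ((2 `^ s - 1) * c).
have [Ns [Ns_gt NsZ Ns16]] := scales_exist Z s0.
have Ns0 k : (0 < Ns k)%N by apply: leq_ltn_trans (Ns_gt k).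
have /choice[sc scP] : forall k, exists D : scale R,
    sc_N D = Ns k /\ scale_spec alpha B omega.1 c D.
  by move=> k; have [D DN DP] := scaleP _ (Ns0 k); exists D.
have spec k : scale_spec alpha B omega.1 c (sc k) by case: (scP k).
have scN k : sc_N (sc k) = Ns k by case: (scP k).
have growth j k : (j < k)%N -> (16 * sc_N (sc j) <= sc_N (sc k))%N.
  by rewrite !scN; exact: Ns16.
have pZ k : 0 < 2 ^+ k.+1 / S by rewrite divr_gt0 // exprn_gt0.
have cS n : \sum_(k < n) expR (- (sc_N (sc k))%:R `^ (alpha - 1)^-1) <= S.
  apply: le_trans (sum_half_powS n (ltW S0)); apply: ler_sum => k _.
  rewrite scN -/s expRN; have := NsZ k; rewrite /Z => h.
  have h3 : 0 < 3 / ((2 `^ s - 1) * c) by rewrite divr_gt0.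
  have Y0 : 0 < (Ns k)%:R `^ s by rewrite powR_gt0 // ltr0n.
  rewrite -[S / _]invf_div lef_pV2 ?posrE ?expR_gt0 //.
  by have := expR_ge1Dx ((Ns k)%:R `^ s); lra.
have gu2 := u_jets_gevrey B0 spec (N := 2); have gv := v_jets_gevrey B0 spec.
have bu2 := u2_bounds spec; have bv := v4_bounds spec.
have uE := the_uE spec; have vE := the_vE spec.
have [Phi_u [PuT Pu0 PuE]] := u_time_one B0 spec growth cS.
have [Phi_v [PvT Pv0 PvF PvN]] := v_time_one B0 spec growth cS.
have nu_u := gevrey_norm_tensor_sum hL gu2 bu2 cS uE.
have nu_v := gevrey_norm_tensor_sum hL gv bv cS vE.
exists (the_u sc), (the_v sc), Phi_u, Phi_v => gamma T.
(* Both time-one maps fix [r_1 = 0] pointwise, so on the torus only a rotation remains. *)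
have fix0 z : torus0 z -> T z = T0 omega z.
  move=> [z1 z2]; have : torus0 (T0 omega z) by split.
  move=> /torus0_cover[x x1 xE]; rewrite /T /= xE Pu0 // Pv0 //.
split; first by split; [rewrite uE; exact: tensor_sum_smooth B0 gu2 bu2 cS|
  exact: le_lt_trans nu_u (ltry _)].
split; first by split; [rewrite vE; exact: tensor_sum_smooth B0 gv bv cS|
  exact: le_lt_trans nu_v (ltry _)].
split=> //; split=> //.
split; first by move=> l x x1; exact: (u_flat B0 spec cS).
split; first by move=> l x x1; exact: (v_flat B0 spec cS).
split.
  apply: le_lt_trans (leeD nu_u nu_v) _; rewrite -EFinD lte_fin.
  by rewrite /S; lra.
split.
  apply/seteqP; split=> [_ [z z0 <-]|w [w1 w2]].
    by rewrite fix0 //; case: z0.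
  have wE : w = ((w.1.1, 0), (w.2.1, 0)).
    by case: w w1 w2 => [[a b] [d e]] /= -> ->.
  pose z : phase_space R :=
    ((w.1.1 - to_circle omega.1, 0), (w.2.1 - to_circle omega.2, 0)).
  have z0 : torus0 z by [].
  exists z => //; rewrite fix0 // /T0 /= !addr0 !subrK.
  by rewrite [RHS]wE.
exists (fun k => 6 / (Ns k)%:R); split.
- by move=> k; rewrite divr_gt0 // ltr0n.
- apply/cvgrPdist_lt => e e0; near=> k.
  have k0 : 0 < (Ns k)%:R :> R by rewrite ltr0n.
  rewrite sub0r normrN ger0_norm ?divr_ge0 // ltr_pdivrMr // mulrC -ltr_pdivrMr //.
  apply: (@lt_trans _ _ k%:R); last by rewrite ltr_nat.
  by near: k; exact: nbhs_infty_gtr.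
move=> k z z0; have sk := spec k.
have n0 : (0 < sc_n (sc k))%N := sc_n_gt0 sk.
have rho0 : 0 <= sc_rho (sc k).
  by apply: le_trans (ltW (sc_rho_gt sk)); rewrite invr_ge0.
have [zh zhz zhd] := drift (sc_N_gt0 sk) n0 (sc_N_dvd sk) (sc_K_gt0 sk) (sc_K_le sk)
  (sc_rhoE sk) rho0 (sc_rho_le sk) (PuE k) (PvF k) (PvN k) z0.
rewrite -/(sc_q (sc k)) in zhd.
set q := sc_q (sc k) in zhd; have q0 : (0 < q)%N.
  by rewrite /q /sc_q muln_gt0 double_gt0 n0 (sc_N_gt0 sk).
have qr0 : 0 < q%:R :> R by rewrite ltr0n.
pose E2 := double_exp (c * 12 `^ s) gamma (2 * (6 / (Ns k)%:R)).
have E20 : 0 <= E2 by exact: expR_ge0.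
(* The number of periods: [w / q] exceeds [E2], while [w <= q * E2 + 1]. *)
pose w := (Num.truncn (q%:R * E2)).+1.
have /andP[w1 w2] : (Num.truncn (q%:R * E2))%:R <= q%:R * E2 < w%:R.
  by apply: truncn_itv; rewrite mulr_ge0.
exists zh, (q * w)%N; split.
- by rewrite muln_gt0 q0.
- by rewrite -(scN k).
- have hE : 3 <= (2 `^ s - 1) * c * (Ns k)%:R `^ s.
    have h := NsZ k; have h2 := pZ k; have h4 : 3 / ((2 `^ s - 1) * c) <= (Ns k)%:R `^ s.
      by apply: le_trans h; rewrite /Z lerDr ltW.
    by move: h4; rewrite (ler_pdivrMr _ _ b1) mulrC.
  have qle : q%:R <= expR (expR (c * (Ns k)%:R `^ s)).
    by have := sc_q_le sk; rewrite scN.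
  apply: le_trans (drift_time_bound c0 s0 (Ns0 k) (ltW qr0) qle hE).
  rewrite natrM (ler_pM2l qr0) /w [_.+1%:R]mulrSr lerD2r; exact: w1.
- rewrite -/E2; apply: le_trans (zhd w).
  by rewrite ler_pdivlMr // mulrC ltW.
Unshelve. all: by end_near. Qed.
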